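(* Let $L>0$ and let $\alpha,h$ be constants with $0<\alpha<h$. Set $$A_1:=\Big\{b\in L^1_{\rm loc}(\mathbb{R})\ \Big|\ b(\cdot+L)=b(\cdot),\ 0\le b\le h,\ \int_0^L b\,dx=\alpha L\Big\},$$ $$b_1(x):=\sum_{k\in\mathbb{Z}}h\,\chi_{I_k}(x),\qquad I_k:=\Big(k+\frac12\Big)L+\Big[-\frac{\alpha L}{2h},\frac{\alpha L}{2h}\Big],$$ where $\chi_{I}$ denotes the characteristic function of $I$. Then $$c^*(b_1)=\max_{b\in A_1}c^*(b).$$ Moreover, the maximizer of $c^*(b)$ in $A_1$ is unique up to translation in $x$.
   Context: For $\lambda\in\mathbb{R}$ and a real $L$-periodic function $b\in L^1_{\rm loc}(\mathbb{R})$, $k(\lambda,b)\in\mathbb{R}$ denotes the principal eigenvalue of $-L_{\lambda,b}\psi:=-\psi''-2\lambda\psi'-(b(x)+\lambda^2)\psi$ on $\mathbb{R}/L\mathbb{Z}$, i.e. the unique real number for which $-L_{\lambda,b}\psi=k(\lambda,b)\psi$ has an $L$-periodic positive solution $\psi$. For $b\ge0$, $b\not\equiv0$, the minimal speed of pulsating traveling waves of $u_t=u_{xx}+b(x)(1-u)u$ is $c^*(b)=\min_{\lambda>0}\frac{-k(\lambda,b)}{\lambda}$. Functions are identified when equal almost everywhere. *)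

(* Defs.v *)
From HB Require Import structures.
From mathcomp Require Import all_boot all_order all_algebra.
From mathcomp Require Import all_classical all_reals all_analysis.

Set Implicit Arguments.
Unset Strict Implicit.
Unset Printing Implicit Defensive.

Import Order.TTheory GRing.Theory Num.Theory.
Import numFieldNormedType.Exports.

Local Open Scope classical_set_scope.
Local Open Scope ring_scope.

Section Definitions.
Context {R : realType}.
Notation mu := (@lebesgue_measure R).

Definition eq_ae (f g : R -> R) : Prop := {ae mu, forall x, f x = g x}.

(* [f] is locally absolutely continuous, with almost everywhere derivative the
   L^1_loc function [g]; equivalently, [f] is continuous and its distributional
   derivative is [g]. *)
Definition weak_derivative (f g : R -> R) : Prop :=
  locally_integrable setT g /\
  forall x y : R, x <= y -> f y - f x = \int[mu]_(t in `[x, y]) g t.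

(* The coefficient [b] is only L^1_loc, so the eigenvalue problem is posed in
   W^{2,1}_loc: [psi] is differentiable, its derivative has the weak
   derivative [psi''], and the equation holds almost everywhere. *)
Definition is_principal_eigenvalue (L lam : R) (b : R -> R) (k : R) : Prop :=
  exists psi psi'' : R -> R,
    [/\ periodic psi L,
        (forall x, 0 < psi x),
        (forall x, derivable psi x 1),
        weak_derivative (derive1 psi) psi'' &
        {ae mu, forall x,
          - psi'' x - 2 * lam * derive1 psi x - (b x + lam ^+ 2) * psi x
          = k * psi x}].

(* [get] returns an arbitrary value if no such real number exists; for the
   periodic coefficients considered here there is exactly one. *)
Definition principal_eigenvalue (L lam : R) (b : R -> R) : R :=
  get [set k | is_principal_eigenvalue L lam b k].

Definition speeds (L : R) (b : R -> R) : set R :=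
  [set - principal_eigenvalue L lam b / lam | lam in [set lam : R | 0 < lam]].

(* The minimum (attained) of [speeds L b]. *)
Definition cstar (L : R) (b : R -> R) : R :=
  get [set c | speeds L b c /\ lbound (speeds L b) c].

(* Functions are identified when equal almost everywhere, so periodicity and
   the bounds are almost everywhere conditions on a representative. *)
Definition A1 (L alpha h : R) : set (R -> R) :=
  [set b | [/\ locally_integrable setT b,
               eq_ae (fun x => b (x + L)) b,
               {ae mu, forall x, 0 <= b x <= h} &
               \int[mu]_(x in `[0, L]) b x = alpha * L]].

Definition I1 (L alpha h : R) (k : int) : set R :=
  `[(k%:~R + 1 / 2) * L - alpha * L / (2 * h),
    (k%:~R + 1 / 2) * L + alpha * L / (2 * h)].

(* For 0 < alpha < h and 0 < L the intervals are pairwise disjoint, so the sum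
   over [int] has at most one nonzero term at each [x]. *)
Definition b1 (L alpha h : R) (x : R) : R :=
  \sum_(k \in [set: int]) h * \1_(I1 L alpha h k) x.

Definition is_maximizer (L : R) (A : set (R -> R)) (b : R -> R) : Prop :=
  A b /\ forall b', A b' -> cstar L b' <= cstar L b.

End Definitions.

(* Main.v *)
(* Put v = psi'/psi + lam and kappa = - k: the eigenvalue problem becomes the
   periodic Riccati equation v' = kappa - b - v^2 with mean of v equal to lam.
   A solution exists as the subsolution of least kappa (Lipschitz subsolutions
   are compact, and one that is not a solution can be improved), and kappa is
   minimal among all subsolutions of mean lam, hence unique.

   Let p > 0 be the periodic solution of the adjoint equation p' = 2 v p - 1.
   For two coefficients b, b~ with solutions v, v~ one has exactly
     (kappa~ - kappa) int p = int (b~ - b) p + int (v~ - v)^2 p.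
   Hence kappa increases when b is rearranged to h on a superlevel set of p
   (bathtub principle), and kappa has a maximiser b of given mass. Reflecting
   a maximiser on an interval whose ends are at the same height of p shows that
   p has opposite slopes there. Three points at one height would thus make p
   stationary, so p, started at its minimum, has no interior dip; its
   superlevel sets are intervals, and the maximiser is h times the
   characteristic function of an interval, whatever lam is.

   Finally c^* = min_(lam > 0) kappa / lam is attained. At the lam that is
   optimal for b1, every b has kappa(b) <= kappa(b1), with equality only for
   translates of b1; this gives both the maximality and the uniqueness. *)

Require Import Defs.
From HB Require Import structures.
From mathcomp Require Import all_boot all_order all_algebra.
From mathcomp Require Import all_classical all_reals all_analysis.
From mathcomp Require Import measurable_realfun ring lra.

Import Order.TTheory GRing.Theory Num.Theory.
Import numFieldNormedType.Exports.
Local Open Scope classical_set_scope.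
Local Open Scope ring_scope.

Set Implicit Arguments.
Unset Strict Implicit.
Unset Printing Implicit Defensive.

(* [lra] translates the whole context, which is slow, so only order and
   equational hypotheses are kept. Section hypotheses cannot be cleared: [b]
   stands for the section variable whose hypotheses are kept. *)
Ltac keep_order b := repeat match goal with
  | H : ?P |- _ =>
    lazymatch type of P with
    | Prop => lazymatch P with
      | is_true _ => fail
      | ~ _ => fail
      | _ = _ => fail
      | context [b] => fail
      | forall f : (_ -> _), _ => fail
      | _ => clear H
      end
    end
  end.
Ltac olra := keep_order tt; lra.
Ltac onra := keep_order tt; nra.

(** The coefficient is only bounded and measurable, so no equation holds at every point. Each
    [F' = f] is read as [F y - F x = ig f x y] with [f] bounded; products, exponentials and
    integrating factors are then handled by one remark: if increments miss the integral by an error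
    quadratic in the step, the error is zero. The Riccati form replaces spectral theory by
    comparison for scalar first-order inequalities, where the sign of a mean over one period decides
    the direction. This is where [lam > 0] enters. Up to a factor, [p] is the product of the
    eigenfunction and the adjoint eigenfunction, hence the density of the derivative of [kappa] with
    respect to [b]. The function [v - 1 / p] solves the same Riccati equation as [v] (it comes from
    the adjoint eigenfunction), and its negative, read backwards in [x], solves the equation of the
    reflected coefficient. The drift [lam] makes the problem non-self-adjoint, so one cannot
    symmetrise an eigenfunction in a Rayleigh quotient. Reflections of [b] on intervals selected by
    [p] take the place of that argument. *)

(** * Bounded measurable functions, Lipschitz functions and primitives on a segment *)

Section Segments.
Context {R : realType}.
Implicit Types (c d e r s t : R).
Notation mu := (@lebesgue_measure R).
Implicit Types (a b x y z : R) (f g F G : R -> R).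

Definition ig f x y : R := \int[mu]_(t in `[x, y]) f t.

Definition bm a b f : Prop :=
  measurable_fun `[a, b] f /\ exists M, forall x, a <= x <= b -> `|f x| <= M.

Definition lip a b f : Prop :=
  exists2 K, 0 <= K &
  forall x y, a <= x -> x <= y -> y <= b -> `|f y - f x| <= K * (y - x).

(** The integrated form of [F' = f]: it says nothing about any single point and is insensitive to
    null sets of [f]. *)
Definition prim a b F f : Prop :=
  bm a b f /\
  forall x y, a <= x -> x <= y -> y <= b -> F y - F x = ig f x y.

Lemma bm_sub a b x y f : a <= x -> y <= b -> bm a b f -> bm x y f.
Proof.
move=> ax yb [mf [M hM]]; split; last first.
  by exists M => t /andP[xt ty]; apply: hM; olra.
apply: measurable_funS mf => // t /=; rewrite !in_itv/= => /andP[xt ty].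
by apply/andP; olra.
Qed.

Lemma bm_ge0 a b f : bm a b f ->
  exists2 M, 0 <= M & forall x, a <= x <= b -> `|f x| <= M.
Proof.
move=> [_ [M hM]]; exists (Num.max 0 M); first by rewrite le_max lexx.
by move=> x /hM h; rewrite le_max h orbT.
Qed.

Lemma bm_integrable x y f : bm x y f -> mu.-integrable `[x, y] (EFin \o f).
Proof.
move=> [mf [M hM]]; apply: measurable_bounded_integrable => //.
  by rewrite /= lebesgue_measure_itv/=; case: ifP => // _; rewrite -EFinB ltry.
exists M; split; rewrite ?num_real// => N MN t /=; rewrite in_itv/= => ht.
exact: le_trans (hM _ ht) (ltW MN).
Qed.

Lemma bm_cst a b c : bm a b (fun=> c).
Proof. by split; [exact: measurable_cst | exists `|c|]. Qed.

Lemma bmN a b f : bm a b f -> bm a b (fun x => - f x).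
Proof.
move=> [mf [M hM]]; split; first exact: measurable_funN.
by exists M => x hx; rewrite normrN hM.
Qed.

Lemma bmD a b f g : bm a b f -> bm a b g -> bm a b (fun x => f x + g x).
Proof.
move=> [mf [M hM]] [mg [N hN]]; split; first exact: measurable_funD.
exists (M + N) => x hx; apply: le_trans (ler_normD _ _) _.
by rewrite lerD ?hM ?hN.
Qed.

Lemma bmB a b f g : bm a b f -> bm a b g -> bm a b (fun x => f x - g x).
Proof. by move=> hf hg; apply: (bmD hf (bmN hg)). Qed.

Lemma bmM a b f g : bm a b f -> bm a b g -> bm a b (fun x => f x * g x).
Proof.
move=> [mf [M hM]] [mg [N hN]]; split; first exact: measurable_funM.
by exists (M * N) => x hx; rewrite normrM ler_pM// ?hM ?hN.
Qed.

Lemma bmX a b f n : bm a b f -> bm a b (fun x => f x ^+ n).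
Proof.
move=> hf; elim: n => [|n IH].
  by under eq_fun do rewrite expr0; exact: bm_cst.
by under eq_fun do rewrite exprS; exact: bmM.
Qed.

Lemma bm_ext a b f g : (forall x, a <= x <= b -> f x = g x) ->
  bm a b f -> bm a b g.
Proof.
move=> fg [mf [M hM]]; split.
  apply: (eq_measurable_fun f) => // x; rewrite inE/= in_itv/= => hx.
  exact: fg.
by exists M => x hx; rewrite -fg// hM.
Qed.

Lemma lip_continuous a b f : lip a b f -> {within `[a, b], continuous f}.
Proof.
move=> [K K0 hK]; have K1 : 0 < K + 1 by olra.
have hK1 x y : a <= x <= b -> a <= y <= b -> `|f y - f x| <= K * `|y - x|.
  move=> /andP[ax xb] /andP[ay yb]; have [xy|yx] := leP x y.
    by rewrite (@ger0_norm _ (y - x)) ?subr_ge0//; exact: hK.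
  rewrite distrC (@ler0_norm _ (y - x)) ?subr_le0 ?(ltW yx)// opprB.
  by apply: hK => //; exact: ltW.
apply/subspace_continuousP => x /=; rewrite in_itv/= => hx.
apply/cvgrPdist_lt => e e0; rewrite near_withinE.
near=> y => /=; rewrite in_itv/= => hy.
apply: le_lt_trans (hK1 _ _ hy hx) _.
apply: (@le_lt_trans _ _ ((K + 1) * `|x - y|)).
  by rewrite ler_wpM2r//; olra.
rewrite mulrC -ltr_pdivlMr//.
by near: y; apply/nbhs_ballP; exists (e / (K + 1)); first exact: divr_gt0.
Unshelve. all: end_near. Qed.

Lemma lip_bm a b f : lip a b f -> bm a b f.
Proof.
move=> lf; split.
  by apply: subspace_continuous_measurable_fun => //; exact: lip_continuous.
case: lf => K K0 hK.
exists (`|f a| + K * (b - a)) => x /andP[ax xb].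
rewrite -[f x](subrK (f a)) addrC; apply: le_trans (ler_normD _ _) _.
rewrite lerD2l; apply: le_trans (hK _ _ _ _ xb) _ => //.
by rewrite ler_wpM2l//; olra.
Qed.

Lemma igD x y f g : bm x y f -> bm x y g ->
  ig (fun t => f t + g t) x y = ig f x y + ig g x y.
Proof. by move=> hf hg; rewrite /ig RintegralD//; exact: bm_integrable. Qed.

Lemma igB x y f g : bm x y f -> bm x y g ->
  ig (fun t => f t - g t) x y = ig f x y - ig g x y.
Proof. by move=> hf hg; rewrite /ig RintegralB//; exact: bm_integrable. Qed.

Lemma igZ x y c f : bm x y f -> ig (fun t => c * f t) x y = c * ig f x y.
Proof. by move=> hf; rewrite /ig RintegralZl//; exact: bm_integrable. Qed.

Lemma igN x y f : bm x y f -> ig (fun t => - f t) x y = - ig f x y.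
Proof.
move=> hf; rewrite -mulN1r -igZ//; congr ig; apply/funext => t.
by rewrite mulN1r.
Qed.

Lemma ig_cst x y c : x <= y -> ig (fun=> c) x y = c * (y - x).
Proof.
move=> xy; rewrite /ig Rintegral_cst// /= lebesgue_measure_itv/= lte_fin.
by case: ltP => [_|yx]; rewrite ?EFinB//=; have -> : y - x = 0 by olra.
Qed.

Lemma ig_eq x y f g : (forall t, x <= t <= y -> f t = g t) ->
  ig f x y = ig g x y.
Proof.
move=> fg; apply: eq_Rintegral => t; rewrite inE/= in_itv/= => ht.
exact: fg.
Qed.

Lemma ig_le x y f g : bm x y f -> bm x y g ->
  (forall t, x <= t <= y -> f t <= g t) -> ig f x y <= ig g x y.
Proof.
by move=> hf hg fg; apply: le_Rintegral => //; exact: bm_integrable.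
Qed.

Lemma ig_ge0 x y f : (forall t, x <= t <= y -> 0 <= f t) -> 0 <= ig f x y.
Proof.
by move=> h; apply: Rintegral_ge0 => t /=; rewrite in_itv/= => ht; exact: h.
Qed.

Lemma ig_split x y z f : x <= y -> y <= z -> bm x z f ->
  ig f x z = ig f x y + ig f y z.
Proof.
move=> xy yz hf; have hi := bm_integrable hf.
have := @Rintegral_itvB R f (BLeft x) (BRight z) y hi.
rewrite !bnd_simp => /(_ xy yz) h.
rewrite /ig; apply/eqP; rewrite addrC -subr_eq h; apply/eqP.
apply: Rintegral_itv_obnd_cbnd; apply: integrableS hi => // t /=.
by rewrite !in_itv/= => /andP[yt tz]; apply/andP; olra.
Qed.

Lemma ig_abs x y f M : x <= y -> bm x y f ->
  (forall t, x <= t <= y -> `|f t| <= M) -> `|ig f x y| <= M * (y - x).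
Proof.
move=> xy hf hM; rewrite ler_norml -mulNr -!(ig_cst _ xy).
apply/andP; split; apply: ig_le => //; try exact: bm_cst;
  by move=> t /hM; rewrite ler_norml => /andP[].
Qed.

Lemma igxx x f : ig f x x = 0.
Proof. by rewrite /ig set_itv1 Rintegral_set1. Qed.

Lemma prim_lip a b F f : prim a b F f -> lip a b F.
Proof.
move=> [hf hF]; have [M M0 hM] := bm_ge0 hf; exists M => // x y ax xy yb.
rewrite hF//; apply: ig_abs => //; first exact: bm_sub hf.
by move=> t /andP[xt ty]; apply: hM; olra.
Qed.

Lemma prim_bm a b F f : prim a b F f -> bm a b F.
Proof. by move=> /prim_lip/lip_bm. Qed.

Lemma prim_sub a b x y F f : a <= x -> y <= b -> prim a b F f -> prim x y F f.
Proof.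
move=> ax yb [hf hF]; split; first exact: bm_sub hf.
by move=> s t xs st ty; apply: hF => //; olra.
Qed.

Lemma prim_ext a b F G f g : (forall x, a <= x <= b -> F x = G x) ->
  (forall x, a <= x <= b -> f x = g x) -> prim a b F f -> prim a b G g.
Proof.
move=> FG fg [hf hF]; split; first exact: bm_ext fg hf.
move=> x y ax xy yb; rewrite -!FG ?hF//; try by apply/andP; olra.
by apply: ig_eq => t /andP[xt ty]; apply: fg; olra.
Qed.

Lemma prim_exists a b f : a <= b -> bm a b f -> exists2 F, prim a b F f & F a = 0.
Proof.
move=> ab hf; exists (ig f a); last exact: igxx.
split=> // x y ax xy yb; rewrite (ig_split (y := x) ax xy); first by ring.
exact: bm_sub hf.
Qed.

Lemma primD a b F G f g : prim a b F f -> prim a b G g ->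
  prim a b (fun x => F x + G x) (fun x => f x + g x).
Proof.
move=> [hf hF] [hg hG]; split; first exact: bmD.
move=> x y ax xy yb; rewrite igD -?hF -?hG//; first by ring.
- exact: bm_sub hf.
- exact: bm_sub hg.
Qed.

Lemma primZ a b c F f : prim a b F f ->
  prim a b (fun x => c * F x) (fun x => c * f x).
Proof.
move=> [hf hF]; split; first by apply: bmM => //; exact: bm_cst.
move=> x y ax xy yb; rewrite igZ -?hF//; first by ring.
exact: bm_sub hf.
Qed.

Lemma primN a b F f : prim a b F f -> prim a b (fun x => - F x) (fun x => - f x).
Proof.
move=> h; apply: prim_ext (primZ (-1) h) => x _ /=; by rewrite mulN1r.
Qed.

Lemma primB a b F G f g : prim a b F f -> prim a b G g ->
  prim a b (fun x => F x - G x) (fun x => f x - g x).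
Proof. by move=> hF hG; exact: primD hF (primN hG). Qed.

Lemma prim_cst a b c : prim a b (fun=> c) (fun=> 0).
Proof.
split; first exact: bm_cst.
by move=> x y _ xy _; rewrite ig_cst// mul0r subrr.
Qed.

Lemma prim_id a b : prim a b id (fun=> 1).
Proof.
split; first exact: bm_cst.
by move=> x y _ xy _; rewrite ig_cst// mul1r.
Qed.

(* Over [n] equal steps the total loss is at most [C (y - x)^2 / n]. *)
Lemma quad_nondecr a b (D : R -> R) C :
  (forall x y, a <= x -> x <= y -> y <= b -> D y - D x >= - C * (y - x) ^+ 2) ->
  forall x y, a <= x -> x <= y -> y <= b -> D x <= D y.
Proof.
move=> hD x y ax xy yb.
have step n : (0 < n)%N -> - (`|C| * (y - x) ^+ 2) <= (D y - D x) * n%:R.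
  move=> n0; have n0' : 0 < n%:R :> R by rewrite ltr0n.
  set d := (y - x) / n%:R; have d0 : 0 <= d by rewrite divr_ge0// subr_ge0.
  have yd : y = x + n%:R * d by rewrite /d; field; rewrite gt_eqF.
  have ind k : (k <= n)%N -> - `|C| * d ^+ 2 * k%:R <= D (x + k%:R * d) - D x.
    elim: k => [_|k IH kn]; first by rewrite mul0r addr0 subrr mulr0.
    have kd : x + k%:R * d + d = x + k.+1%:R * d by rewrite -natr1; ring.
    have le1 : x + k.+1%:R * d <= b.
      by apply: le_trans yb; rewrite yd lerD2l ler_wpM2r// ler_nat.
    have le0 : 0 <= k%:R * d by rewrite mulr_ge0.
    have h1 := IH (ltnW kn).
    have h2 : - C * d ^+ 2 <= D (x + k.+1%:R * d) - D (x + k%:R * d).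
      have -> : d ^+ 2 = (x + k.+1%:R * d - (x + k%:R * d)) ^+ 2.
        by rewrite -kd; ring.
      apply: hD => //; first by rewrite (le_trans ax)// lerDl.
      by rewrite -kd lerDl.
    have h3 : - `|C| * d ^+ 2 <= - C * d ^+ 2.
      by rewrite ler_wpM2r ?sqr_ge0// lerN2 ler_norm.
    by rewrite -[in leLHS]natr1 mulrDr mulr1; olra.
  have := ind n (leqnn n); rewrite -yd => h.
  have -> : `|C| * (y - x) ^+ 2 = `|C| * d ^+ 2 * n%:R * n%:R.
    by rewrite yd; ring.
  rewrite -!mulNr ler_wpM2r//; exact: ltW.
rewrite leNgt; apply/negP => yx.
have e0 : 0 < D x - D y by olra.
set B := `|C| * (y - x) ^+ 2 in step.
have B0 : 0 <= B by rewrite mulr_ge0// sqr_ge0.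
have := archi_boundP (divr_ge0 B0 (ltW e0)).
set n := Num.bound _ => hn.
have n0 : (0 < n)%N.
  by rewrite lt0n; apply/eqP => n0; move: hn; rewrite n0 ltNge divr_ge0// ltW.
have := step _ n0; move: hn; rewrite ltr_pdivrMr//; olra.
Qed.

(** Subtract a primitive of [f]: the difference and its opposite both lose only quadratically, so
    both are nondecreasing. This reduces every differentiation rule below to a remainder estimate on
    one short interval. *)
Lemma quad_prim a b F f C : bm a b f ->
  (forall x y, a <= x -> x <= y -> y <= b ->
    `|F y - F x - ig f x y| <= C * (y - x) ^+ 2) -> prim a b F f.
Proof.
move=> hf h; split => // x y ax xy yb.
have ab : a <= b by olra.
have [P [_ hP] _] := prim_exists ab hf.
have hd s t : a <= s -> s <= t -> t <= b ->
    `|(F t - P t) - (F s - P s)| <= C * (t - s) ^+ 2.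
  move=> as' st tb; have := h s t as' st tb; rewrite -hP//.
  by congr (`|_| <= _); ring.
have h1 : F x - P x <= F y - P y.
  apply: (@quad_nondecr a b (fun t => F t - P t) C) => // s t as' st tb.
  by have := hd s t as' st tb; rewrite ler_norml mulNr => /andP[].
have h2 : - (F x - P x) <= - (F y - P y).
  apply: (@quad_nondecr a b (fun t => - (F t - P t)) C) => // s t as' st tb.
  by have := hd s t as' st tb; rewrite ler_norml mulNr; olra.
by rewrite -hP//; olra.
Qed.

End Segments.

Ltac bm_tac := repeat first
  [ assumption | apply: bm_cst | apply: bmN | apply: bmD | apply: bmM
  | apply: bmX ].

(** * Product rule, exponential and integrating factors in integrated form *)

Section Calculus.
Context {R : realType}.
Implicit Types (c d e r s t : R).
Implicit Types (a b x y z : R) (f g F G w A al : R -> R).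

Lemma lipB_ge0 a b f : lip a b f -> exists2 K, 0 <= K &
  forall x y, a <= x -> x <= y -> y <= b -> `|f x - f y| <= K * (y - x).
Proof. by move=> [K K0 hK]; exists K => // x y *; rewrite distrC hK. Qed.

Lemma lip_sub a b x y f : a <= x -> y <= b -> lip a b f -> lip x y f.
Proof.
by move=> ax yb [K K0 hK]; exists K => // s t xs st ty; apply: hK => //; olra.
Qed.

Lemma lip_cst a b c : lip a b (fun=> c).
Proof. by exists 0 => // x y *; rewrite subrr normr0 mul0r. Qed.

Lemma lipN a b f : lip a b f -> lip a b (fun x => - f x).
Proof.
by move=> [K K0 hK]; exists K => // x y *; rewrite -opprD normrN; exact: hK.
Qed.

Lemma lipD a b f g : lip a b f -> lip a b g -> lip a b (fun x => f x + g x).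
Proof.
move=> [K K0 hK] [J J0 hJ]; exists (K + J); first exact: addr_ge0.
move=> x y ax xy yb; rewrite opprD addrACA mulrDl.
by apply: le_trans (ler_normD _ _) _; rewrite lerD ?hK ?hJ.
Qed.

Lemma lipM a b f g : lip a b f -> lip a b g -> lip a b (fun x => f x * g x).
Proof.
move=> hf hg; have [M M0 hM] := bm_ge0 (lip_bm hf).
have [N N0 hN] := bm_ge0 (lip_bm hg).
case: hf => [K K0 hK]; case: hg => [J J0 hJ].
exists (K * N + M * J); first by rewrite addr_ge0// mulr_ge0.
move=> x y ax xy yb.
have -> : f y * g y - f x * g x = (f y - f x) * g y + f x * (g y - g x) by ring.
apply: le_trans (ler_normD _ _) _; rewrite !normrM mulrDl.
have h1 := hK _ _ ax xy yb; have h2 := hJ _ _ ax xy yb.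
have h3 : `|g y| <= N by apply: hN; olra.
have h4 : `|f x| <= M by apply: hM; olra.
rewrite mulrAC -(mulrA M) lerD// ler_pM//.
Qed.

Lemma lip_exp a b A : lip a b A -> lip a b (fun x => expR (A x)).
Proof.
move=> hA; have [M M0 hM] := bm_ge0 (lip_bm hA); case: hA => [K K0 hK].
exists (expR M * K); first by rewrite mulr_ge0// expR_ge0.
move=> x y ax xy yb; have h := hK _ _ ax xy yb.
have ex : expR (A x) <= expR M.
  by rewrite ler_expR; apply: le_trans (ler_norm _) _; apply: hM; olra.
have ey : expR (A y) <= expR M.
  by rewrite ler_expR; apply: le_trans (ler_norm _) _; apply: hM; olra.
(* The tangents of the exponential at both ends bound its increment from below and from above, so no
   mean value theorem is used. *)
have h1 : expR (A y) - expR (A x) >= expR (A x) * (A y - A x).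
  rewrite -{2}[A y](subrK (A x)) expRD.
  have := expR_ge1Dx (A y - A x); have := expR_gt0 (A x); onra.
have h2 : expR (A x) - expR (A y) >= expR (A y) * (A x - A y).
  rewrite -{2}[A x](subrK (A y)) expRD.
  have := expR_ge1Dx (A x - A y); have := expR_gt0 (A y); onra.
have := expR_gt0 (A x); have := expR_gt0 (A y).
move: h; rewrite -mulrA !ler_norml => /andP[k1 k2] e1 e2.
have k0 : 0 <= K * (y - x) by olra.
apply/andP; split; onra.
Qed.

(** With [G] frozen at the right end and [F] at the left end, the increment of the product is exact;
    unfreezing them costs a derivative times a Lipschitz increment, which is quadratic after
    integration. *)
Lemma primM a b F G f g : prim a b F f -> prim a b G g ->
  prim a b (fun x => F x * G x) (fun x => f x * G x + F x * g x).
Proof.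
move=> hF hG; have bF := prim_bm hF; have bG := prim_bm hG.
have [KF KF0 hKF] := lipB_ge0 (prim_lip hF).
have [KG KG0 hKG] := prim_lip hG.
case: hF => bf hF; case: hG => bg hG.
have [M M0 hM] := bm_ge0 bf; have [N N0 hN] := bm_ge0 bg.
apply: (@quad_prim _ _ _ _ _ (M * KG + KF * N)); first by bm_tac.
move=> x y ax xy yb.
have sub h : bm a b h -> bm x y h by exact: bm_sub.
have -> : F y * G y - F x * G x - ig (fun t => f t * G t + F t * g t) x y =
    ig (fun t => (G y * f t + F x * g t) - (f t * G t + F t * g t)) x y.
  rewrite igB ?igD ?igZ -?hF -?hG//; try (apply: sub; bm_tac).
  ring.
rewrite expr2 mulrA; apply: ig_abs => //.
  by apply: bmB; apply: sub; bm_tac.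
move=> t /andP[xt ty].
have -> : G y * f t + F x * g t - (f t * G t + F t * g t) =
  f t * (G y - G t) + (F x - F t) * g t by ring.
apply: le_trans (ler_normD _ _) _; rewrite !normrM mulrDl.
have h1 : `|f t| <= M by apply: hM; olra.
have h2 : `|g t| <= N by apply: hN; olra.
have h3 : `|G y - G t| <= KG * (y - x).
  by apply: le_trans (hKG _ _ _ _ _) _; rewrite ?ler_wpM2l//; olra.
have h4 : `|F x - F t| <= KF * (y - x).
  by apply: le_trans (hKF _ _ _ _ _) _; rewrite ?ler_wpM2l//; olra.
by rewrite -mulrA (mulrAC KF) lerD// ler_pM.
Qed.

(** The first-order remainder of the exponential lies between 0 and the product of the increments of
    [expR (A _)] and of [A], by the tangents at both ends; both factors are Lipschitz. *)
Lemma prim_exp a b A al : prim a b A al ->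
  prim a b (fun x => expR (A x)) (fun x => al x * expR (A x)).
Proof.
move=> hA; have lA := prim_lip hA; have lE := lip_exp lA.
have [M M0 hM] := bm_ge0 (proj1 hA); have bE := lip_bm lE.
case: lA => K K0 hK; case: lE => J J0 hJ; case: hA => bal hA.
apply: (@quad_prim _ _ _ _ _ (J * K + M * J)); first by bm_tac.
move=> x y ax xy yb.
have sub h : bm a b h -> bm x y h by exact: bm_sub.
have -> : expR (A y) - expR (A x) - ig (fun t => al t * expR (A t)) x y =
   (expR (A y) - expR (A x) - expR (A x) * (A y - A x)) -
   ig (fun t => al t * expR (A t) - expR (A x) * al t) x y.
  rewrite igB ?igZ -?hA//; try (apply: sub; bm_tac).
  ring.
have h1 : expR (A y) - expR (A x) >= expR (A x) * (A y - A x).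
  rewrite -{2}[A y](subrK (A x)) expRD.
  have := expR_ge1Dx (A y - A x); have := expR_gt0 (A x); onra.
have h2 : expR (A x) - expR (A y) >= expR (A y) * (A x - A y).
  rewrite -{2}[A x](subrK (A y)) expRD.
  have := expR_ge1Dx (A x - A y); have := expR_gt0 (A y); onra.
apply: le_trans (ler_normB _ _) _; rewrite mulrDl; apply: lerD.
  rewrite ger0_norm; last olra.
  apply: (@le_trans _ _ ((expR (A y) - expR (A x)) * (A y - A x))); first onra.
  apply: le_trans (ler_norm _) _; rewrite normrM expr2 mulrACA.
  by rewrite ler_pM ?hJ ?hK.
rewrite expr2 mulrA; apply: ig_abs => //; first by apply: sub; bm_tac.
move=> t /andP[xt ty].
rewrite (mulrC (expR _)) -mulrBr normrM -mulrA ler_pM//; first by apply: hM; olra.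
apply: le_trans (hJ _ _ ax xt _) _; first by olra.
by rewrite ler_wpM2l//; olra.
Qed.

(* Integrating factor for the differential inequality [w' >= - al w]. *)
Lemma exp_nondecr a b A al w : prim a b A al -> lip a b w ->
  (forall x y, a <= x -> x <= y -> y <= b ->
     w y - w x >= - ig (fun t => al t * w t) x y) ->
  forall x y, a <= x -> x <= y -> y <= b ->
    expR (A x) * w x <= expR (A y) * w y.
Proof.
move=> hA lw hw; have hE := prim_exp hA; have bE := prim_bm hE.
have [J J0 hJ] := lipB_ge0 (prim_lip hE).
have [B B0 hB] := bm_ge0 bE.
have bw := lip_bm lw; have [W W0 hW] := bm_ge0 bw.
have [K K0 hK] := lipB_ge0 lw; have bal := proj1 hA.
have [M M0 hM] := bm_ge0 bal.
apply: (@quad_nondecr _ _ _ (fun x => expR (A x) * w x) (M * (W * J + B * K))).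
move=> x y ax xy yb.
have sub h : bm a b h -> bm x y h by exact: bm_sub.
(* Freezing the exponential at [y] and [w] at [x] lets the inequality for [w] be multiplied by a
   positive constant. *)
have key : expR (A y) * w y - expR (A x) * w x >=
   ig (fun t => w x * (al t * expR (A t)) - expR (A y) * (al t * w t)) x y.
  rewrite igB ?igZ ?(proj2 hE)//; try (apply: sub; bm_tac).
  have := hw x y ax xy yb; have := expR_gt0 (A y).
  rewrite -(proj2 hE)//; set I := ig _ _ _ => e0 h; onra.
apply: le_trans key.
suff : `|ig (fun t => w x * (al t * expR (A t)) -
    expR (A y) * (al t * w t)) x y| <= M * (W * J + B * K) * (y - x) * (y - x).
  by rewrite ler_norml expr2 mulrA !mulNr => /andP[].
apply: ig_abs => //.
- by apply: bmB; apply: sub; bm_tac.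
- move=> t /andP[xt ty].
  have -> : w x * (al t * expR (A t)) - expR (A y) * (al t * w t) =
    al t * (w x * (expR (A t) - expR (A y)) + expR (A y) * (w x - w t)) by ring.
  rewrite normrM -mulrA ler_pM//; first by apply: hM; olra.
  apply: le_trans (ler_normD _ _) _; rewrite !normrM mulrDl -!mulrA.
  have yxt : y - t <= y - x by olra.
  rewrite lerD// ler_pM//.
  + by apply: hW; olra.
  + apply: le_trans (hJ _ _ _ _ yb) _; [olra|olra|].
    by rewrite ler_wpM2l.
  + by apply: hB; olra.
  + apply: le_trans (hK _ _ ax xt _) _; [olra|].
    by rewrite ler_wpM2l//; olra.
Qed.

End Calculus.

(** * Periodic comparison and periodic solutions of linear first-order equations *)

Section PeriodicLinear.
Context {R : realType}.
Implicit Types (c d e r s t : R).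
Implicit Types (a b x y z : R) (f g F G w A al v p : R -> R).

(** Over one period the integrating factor exceeds 1 while [w] returns to its initial value, so
    [w a] cannot be negative; monotonicity then carries the sign forward from [a]. *)
Lemma cmp_ge0 a b al w : a <= b -> bm a b al -> lip a b w ->
  (forall x y, a <= x -> x <= y -> y <= b ->
     w y - w x >= - ig (fun t => al t * w t) x y) ->
  w a = w b -> 0 < ig al a b -> forall x, a <= x <= b -> 0 <= w x.
Proof.
move=> ab bal lw hw wab al0 x /andP[ax xb].
have [A hA A0] := prim_exists ab bal; have mono := exp_nondecr hA lw hw.
have Ab : A b = ig al a b by rewrite -(proj2 hA) ?lexx// A0 subr0.
have := mono a b (lexx a) ab (lexx b); rewrite A0 expR0 mul1r -wab => h.
have eb : 1 < expR (A b) by rewrite expR_gt1 Ab.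
have wa : 0 <= w a by rewrite leNgt; apply/negP => wa; onra.
have := mono a x (lexx a) ax xb; rewrite A0 expR0 mul1r => h2.
by have := le_trans wa h2; rewrite pmulr_rge0// expR_gt0.
Qed.

(** Same inequality, opposite sign of the mean: the factor is now below 1, which forces [w a] to be
    nonpositive, and the sign is carried backwards from [b]. *)
Lemma cmp_le0 a b al w : a <= b -> bm a b al -> lip a b w ->
  (forall x y, a <= x -> x <= y -> y <= b ->
     w y - w x >= - ig (fun t => al t * w t) x y) ->
  w a = w b -> ig al a b < 0 -> forall x, a <= x <= b -> w x <= 0.
Proof.
move=> ab bal lw hw wab al0 x /andP[ax xb].
have [A hA A0] := prim_exists ab bal; have mono := exp_nondecr hA lw hw.
have Ab : A b = ig al a b by rewrite -(proj2 hA) ?lexx// A0 subr0.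
have := mono a b (lexx a) ab (lexx b); rewrite A0 expR0 mul1r -wab => h.
have eb : expR (A b) < 1 by rewrite expR_lt1 Ab.
have wa : w a <= 0 by rewrite leNgt; apply/negP => wa; onra.
have := mono x b ax xb (lexx b); rewrite -wab => h2.
have h3 : expR (A b) * w a <= 0 by rewrite pmulr_rle0// expR_gt0.
by have := le_trans h2 h3; rewrite pmulr_rle0// expR_gt0.
Qed.

Lemma cmp_gt0 a b al w c : a <= b -> bm a b al -> lip a b w -> 0 < c ->
  (forall x y, a <= x -> x <= y -> y <= b ->
     w y - w x >= ig (fun t => c - al t * w t) x y) ->
  w a = w b -> 0 < ig al a b ->
  exists2 eta, 0 < eta & forall x, a <= x <= b -> eta <= w x.
Proof.
move=> ab bal lw c0 hw wab al0; have [M M0 hM] := bm_ge0 bal.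
have bw := lip_bm lw.
(* This [eta] satisfies [al * eta <= c], so subtracting it from [w] uses up the source term and
   leaves the homogeneous inequality. *)
exists (c / (M + 1)) => [|x hx]; first by rewrite divr_gt0//; olra.
set eta := c / _; have e0 : 0 < eta by rewrite divr_gt0//; olra.
have ce : c = eta * M + eta by rewrite /eta; field; olra.
rewrite -subr_ge0; apply: (cmp_ge0 (w := fun t => w t - eta) ab bal) => //.
- exact: lipD lw (lip_cst _ _ _).
- move=> s t as' st tb; have := hw s t as' st tb.
  have sub h : bm a b h -> bm s t h by exact: bm_sub.
  have -> : w t - eta - (w s - eta) = w t - w s by ring.
  apply: le_trans; rewrite -igN; last by apply: sub; bm_tac.
  apply: ig_le; try (apply: sub; bm_tac).
  move=> r /andP[sr rt].
  have : `|al r| <= M by apply: hM; olra.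
  by rewrite ler_norml => /andP[]; onra.
- by rewrite wab.
Qed.

Lemma cmp_lt0 a b al w c : a <= b -> bm a b al -> lip a b w -> 0 < c ->
  (forall x y, a <= x -> x <= y -> y <= b ->
     w y - w x >= ig (fun t => c - al t * w t) x y) ->
  w a = w b -> ig al a b < 0 ->
  exists2 eta, 0 < eta & forall x, a <= x <= b -> w x <= - eta.
Proof.
move=> ab bal lw c0 hw wab al0; have [M M0 hM] := bm_ge0 bal.
have bw := lip_bm lw.
exists (c / (M + 1)) => [|x hx]; first by rewrite divr_gt0//; olra.
set eta := c / _; have e0 : 0 < eta by rewrite divr_gt0//; olra.
have ce : c = eta * M + eta by rewrite /eta; field; olra.
suff : w x + eta <= 0 by olra.
apply: (cmp_le0 (w := fun t => w t + eta) ab bal) => //.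
- exact: lipD lw (lip_cst _ _ _).
- move=> s t as' st tb; have := hw s t as' st tb.
  have sub h : bm a b h -> bm s t h by exact: bm_sub.
  have -> : w t + eta - (w s + eta) = w t - w s by ring.
  apply: le_trans; rewrite -igN; last by apply: sub; bm_tac.
  apply: ig_le; try (apply: sub; bm_tac).
  move=> r /andP[sr rt].
  have : `|al r| <= M by apply: hM; olra.
  by rewrite ler_norml => /andP[]; onra.
- by rewrite wab.
Qed.

Lemma lin_per a b al f : a <= b -> bm a b al -> bm a b f -> ig al a b != 0 ->
  exists2 w, prim a b w (fun t => f t - al t * w t) & w a = w b.
Proof.
move=> ab bal bf al0.
have [A hA A0] := prim_exists ab bal.
have Ab : A b = ig al a b by rewrite -(proj2 hA) ?lexx// A0 subr0.
have hE := prim_exp hA; have bE := prim_bm hE.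
have bEf : bm a b (fun t => expR (A t) * f t) by bm_tac.
have [F hF F0] := prim_exists ab bEf.
have hE' : prim a b (fun t => expR (- A t)) (fun t => - al t * expR (- A t)).
  exact: (prim_exp (primN hA)).
have eb : expR (A b) - 1 != 0 by rewrite subr_eq0 -expR0 (inj_eq (@expR_inj R)) Ab.
(* The constant of variation of constants, fixed by periodicity: [C = expR (- A b) * (C + F b)]. *)
pose C := F b / (expR (A b) - 1).
have hw := primM hE' (primD (prim_cst a b C) hF).
exists (fun t => expR (- A t) * (C + F t)).
  apply: prim_ext hw => // t _ /=.
  rewrite expRN; have := expR_gt0 (A t); move: (expR (A t)) => e e0.
  by field; rewrite gt_eqF.
rewrite A0 F0 oppr0 expR0 expRN /C.
by field; rewrite eb gt_eqF// expR_gt0.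
Qed.

(** For [q = - p] the equation has source 1 and multiplier [- 2 v], whose mean is negative: this
    gives both solvability and a strict sign. *)
Lemma adjoint_exists a b v : a <= b -> bm a b v -> 0 < ig v a b ->
  exists p, [/\ prim a b p (fun t => 2 * v t * p t - 1), p a = p b &
    exists2 eta, 0 < eta & forall x, a <= x <= b -> eta <= p x].
Proof.
move=> ab bv v0.
have bal : bm a b (fun t => - 2 * v t) by bm_tac.
have al0 : ig (fun t => - 2 * v t) a b < 0 by rewrite igZ//; olra.
have [q hq qab] := lin_per ab bal (bm_cst a b 1) (ltr0_neq0 al0).
exists (fun t => - q t); split; last 1 first.
- have [eta e0 he] : exists2 eta, 0 < eta & forall x, a <= x <= b -> q x <= - eta.
    apply: (cmp_lt0 (al := fun t => - 2 * v t) (c := 1)) => //.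
      exact: prim_lip hq.
    by move=> x y ax xy yb; rewrite (proj2 hq).
  by exists eta => // x hx; have := he x hx; olra.
- by apply: prim_ext (primN hq) => // t _; ring.
- by rewrite qab.
Qed.

End PeriodicLinear.

(** * Uniform limits of equi-Lipschitz sequences *)

Section Selection.
Context {R : realType}.
Implicit Types (c d e r s t x y : R).

Lemma ultra_bounded_limit (G : set_system nat) (u : nat -> R) V :
  UltraFilter G -> (forall n, `|u n| <= V) ->
  exists l, forall e, 0 < e -> G [set n | `|u n - l| < e].
Proof.
move=> GU hu.
have GP : ProperFilter (u @ G) by exact: fmap_proper_filter.
have hV : (u @ G) `[- V, V]%classic.
  by apply: nearW => n /=; rewrite in_itv/= -ler_norml.
have [l [_ hl]] := segment_compact GP hV.
exists l => e e0.
have [//|hn] := in_ultra_setVsetC [set n | `|u n - l| < e] GU.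
have h1 : (u @ G) (~` ball l e).
  by rewrite /fmap/=; apply: filterS hn => n /= h; rewrite /ball/= distrC.
by have [y [h2 h3]] := hl _ _ h1 (nbhsx_ballx l e e0).
Qed.

(** Arzela-Ascoli without diagonal extraction: limits along one ultrafilter exist at all points at
    once, and a finite grid together with the common Lipschitz constant makes the approximation
    uniform. *)
Lemma equilip_selection (a b C V : R) (vs : nat -> R -> R) :
  a <= b -> 0 <= C ->
  (forall n x, a <= x <= b -> `|vs n x| <= V) ->
  (forall n x y, a <= x -> x <= y -> y <= b ->
     `|vs n y - vs n x| <= C * (y - x)) ->
  exists2 v : R -> R,
    forall x y, a <= x -> x <= y -> y <= b -> `|v y - v x| <= C * (y - x) &
    forall e (N : nat), 0 < e -> exists2 n, (N <= n)%N &
      forall x, a <= x <= b -> `|vs n x - v x| <= e.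
Proof.
move=> ab C0 hV hC.
have [G [GU sG]] := ultraFilterLemma (@eventually_filter).
have lim x : exists l, a <= x <= b ->
    forall e, 0 < e -> G [set n | `|vs n x - l| < e].
  have [hx|hx] := boolP (a <= x <= b); last by exists 0.
  have [l hl] := @ultra_bounded_limit G (vs^~ x) V GU (fun n => hV n x hx).
  by exists l.
have {lim} [v hv] := choice lim.
have lv x y : a <= x -> x <= y -> y <= b -> `|v y - v x| <= C * (y - x).
  move=> ax xy yb; apply/ler_addgt0Pr => e e0.
  have hx : a <= x <= b by olra.
  have hy : a <= y <= b by olra.
  have e2 : 0 < e / 2 by olra.
  have [n [/= h1 h2]] := filter_ex (filterI (hv x hx _ e2) (hv y hy _ e2)).
  have := hC n x y ax xy yb.
  move: h1 h2; rewrite !ltr_norml !ler_norml; olra.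
exists v => // e N e0.
(* A grid of mesh [d] splits [e] into thirds: the variation of [vs n], the variation of [v], and the
   error at a grid point. *)
have [d d0 hd] : exists2 d, 0 < d & C * d <= e / 3.
  exists (e / 3 / (C + 1)); first by rewrite !divr_gt0//; olra.
  rewrite mulrCA ler_piMr//; first olra.
  by rewrite ler_pdivrMr; olra.
pose m := Num.bound ((b - a) / d).
have m0 : 0 < m%:R :> R.
  rewrite ltr0n lt0n; apply/eqP => m0.
  have := archi_boundP (divr_ge0 (_ : 0 <= b - a) (ltW d0)).
  rewrite -/m m0 subr_ge0 => /(_ ab); rewrite ltNge divr_ge0//; olra.
have md : (b - a) <= m%:R * d.
  have := archi_boundP (divr_ge0 (_ : 0 <= b - a) (ltW d0)).
  by rewrite -/m subr_ge0 => /(_ ab) /ltW; rewrite ler_pdivrMr.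
pose xi (i : 'I_m.+1) := a + i%:R * ((b - a) / m%:R).
have hxi i : a <= xi i <= b.
  have h0 : 0 <= i%:R * ((b - a) / m%:R).
    by rewrite mulr_ge0// divr_ge0// ?subr_ge0// ltW.
  have h1 : i%:R * ((b - a) / m%:R) <= b - a.
    rewrite mulrCA ler_piMr ?subr_ge0// ler_pdivrMr// mul1r ler_nat.
    by rewrite -ltnS.
  by rewrite /xi; olra.
have e3 : 0 < e / 3 by olra.
have hG : G [set n | forall i, `|vs n (xi i) - v (xi i)| < e / 3].
  by apply: filter_forall => i; exact: hv.
have hN : G [set n | (N <= n)%N] by apply: sG; exact: nbhs_infty_ge.
have [n [/= h1 Nn]] := filter_ex (filterI hG hN).
exists n => // x /andP[ax xb].
have [i [ix xi1]] : exists i : 'I_m.+1, xi i <= x /\ x - xi i <= d.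
  have [be|ne] := eqVneq a b.
    exists ord0; rewrite /xi mul0r addr0; split=> //.
    have -> : x - a = 0 by olra.
    exact: ltW.
  have ba : 0 < b - a by rewrite subr_gt0 lt_neqAle ne ab.
  pose k := Num.truncn ((x - a) / ((b - a) / m%:R)).
  have s0 : 0 < (b - a) / m%:R by rewrite divr_gt0.
  have q0 : 0 <= (x - a) / ((b - a) / m%:R).
    by rewrite divr_ge0//; [olra | exact: ltW].
  have /andP[k1 k2] := truncn_itv q0; rewrite -/k in k1 k2.
  move: k1 k2; rewrite ler_pdivlMr// ltr_pdivrMr// => k1 k2.
  have km : (k < m.+1)%N.
    rewrite ltnS -(ler_nat R) -(ler_pM2r s0).
    apply: le_trans k1 _.
    have -> : m%:R * ((b - a) / m%:R) = b - a by field; rewrite gt_eqF.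
    olra.
  exists (Ordinal km); rewrite /xi /=; split; first olra.
  have : (b - a) / m%:R <= d by rewrite ler_pdivrMr// mulrC.
  move: k2; rewrite -natr1; olra.
have /andP[axi _] := hxi i.
have := h1 i; have := lv _ _ axi ix xb; have := hC n _ _ axi ix xb.
have : C * (x - xi i) <= e / 3.
  by apply: le_trans hd; rewrite ler_wpM2l.
rewrite !ler_norml !ltr_norml; olra.
Qed.

End Selection.

(** * Existence and minimality for the periodic Riccati equation of prescribed mean *)

Section Riccati.
Context {R : realType}.
Implicit Types (c d r s t x y : R).
Implicit Types (k K e lam : R) (v u w : R -> R).
Variables (L h : R) (b : R -> R).

Definition subsol k v : Prop :=
  [/\ lip 0 L v, v 0 = v L &
      forall x y, 0 <= x -> x <= y -> y <= L ->
        v y - v x <= ig (fun t => k - b t - v t ^+ 2) x y].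

Definition riccati k v : Prop :=
  prim 0 L v (fun t => k - b t - v t ^+ 2) /\ v 0 = v L.

Hypotheses (L0 : 0 < L) (bb : bm 0 L b)
  (b0 : forall x, 0 <= x <= L -> 0 <= b x <= h).

Ltac rlra := keep_order b; lra.
Ltac rnra := keep_order b; nra.

Let h0 : 0 <= h.
Proof. have := b0 (x := 0); rewrite lexx ltW// => /(_ isT); rlra. Qed.

Let L0' : 0 <= L := ltW L0.

Let sub f x y : bm 0 L f -> 0 <= x -> y <= L -> bm x y f.
Proof. by move=> bf x0 yL; exact: bm_sub bf. Qed.

Lemma riccati_subsol k v : riccati k v -> subsol k v.
Proof.
move=> [hv v0L]; split => //; first exact: prim_lip hv.
by move=> x y x0 xy yL; rewrite (proj2 hv).
Qed.

Lemma subsol_energy k v : subsol k v ->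
  ig b 0 L + ig (fun t => v t ^+ 2) 0 L <= k * L.
Proof.
move=> [lv v0L hv]; have bv := lip_bm lv.
have := hv 0 L (lexx _) L0' (lexx _); rewrite v0L subrr.
rewrite !igB ?ig_cst//; try bm_tac; rlra.
Qed.

Lemma riccati_energy k v : riccati k v ->
  k * L = ig b 0 L + ig (fun t => v t ^+ 2) 0 L.
Proof.
move=> [hv v0L]; have bv := prim_bm hv.
have := proj2 hv 0 L (lexx _) L0' (lexx _); rewrite v0L subrr.
rewrite !igB ?ig_cst//; try bm_tac; rlra.
Qed.

Lemma subsol_ge0 k v : subsol k v -> 0 <= k.
Proof.
move=> hv; have := subsol_energy hv.
have : 0 <= ig b 0 L by apply: ig_ge0 => t /b0/andP[].
have : 0 <= ig (fun t => v t ^+ 2) 0 L by apply: ig_ge0 => t _; exact: sqr_ge0.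
move=> h1 h2 h3; have : 0 <= k * L by rlra.
by rewrite pmulr_lge0.
Qed.

(** Constants [c] with [c ^ 2 >= K] act as barriers. The differences to [v] satisfy linear
    inequalities with multipliers [V + v] and [v - (K + 1)]; the positive mean of [v] gives the
    first its sign, and the upper bound so obtained gives the second its sign. *)
Lemma subsol_bound K k v : k <= K -> subsol k v -> 0 < ig v 0 L ->
  forall x, 0 <= x <= L -> `|v x| <= K + 1.
Proof.
move=> kK sv v0; have K0 := le_trans (subsol_ge0 sv) kK.
case: sv => lv v0L hv; have bv := lip_bm lv.
(* The upper barrier is placed strictly below [K + 1], so that [v - (K + 1)] has a strictly negative
   mean. *)
set V := K + 2^-1; have VK : K <= V ^+ 2 by rewrite /V; rnra.
have V0 : 0 < V by rewrite /V; rlra.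
have up x : 0 <= x <= L -> 0 <= V - v x.
  apply: (cmp_ge0 (al := fun t => V + v t) (w := fun t => V - v t)) => //.
  - by bm_tac.
  - exact: lipD (lip_cst _ _ _) (lipN lv).
  - move=> s t s0 st tL; have := hv s t s0 st tL.
    have -> : V - v t - (V - v s) = - (v t - v s) by ring.
    move=> h1; rewrite lerN2; apply: le_trans h1 _.
    apply: ig_le; try (apply: sub => //; bm_tac).
    by move=> r /andP[sr rt]; have /andP[] := b0 (x := r) ltac:(rlra); rnra.
  - by rewrite v0L.
  - rewrite igD ?ig_cst//; last exact: bm_cst.
    have : 0 < V * (L - 0) by rewrite mulr_gt0// subr0.
    by rlra.
have vV : ig v 0 L <= V * (L - 0).
  rewrite -ig_cst//; apply: ig_le => //; first exact: bm_cst.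
  by move=> t /up; rlra.
have dn x : 0 <= x <= L -> - (v x + (K + 1)) <= 0.
  apply: (cmp_le0 (al := fun t => v t - (K + 1))
    (w := fun t => - (v t + (K + 1)))) => //.
  - by bm_tac.
  - exact: lipN (lipD lv (lip_cst _ _ _)).
  - move=> s t s0 st tL; have := hv s t s0 st tL.
    have -> : - (v t + (K + 1)) - - (v s + (K + 1)) = - (v t - v s) by ring.
    move=> h1; rewrite lerN2; apply: le_trans h1 _.
    apply: ig_le; try (apply: sub => //; bm_tac).
    by move=> r /andP[sr rt]; have /andP[] := b0 (x := r) ltac:(rlra); rnra.
  - by rewrite v0L.
  - rewrite igB ?ig_cst//; last exact: bm_cst.
    by move: vV; rewrite /V; rnra.
by move=> x hx; have := up x hx; have := dn x hx; rewrite ler_norml /V; rlra.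
Qed.

(* A priori bound for [k - b + M v - v ^ 2 - M u] when [u] and [v] are bounded
   by [K + 1] and [M = 2 (K + 1) + 1]. *)
Definition slope K : R :=
  K + h + (2 * (K + 1) + 1) * (K + 1) + (K + 1) ^+ 2 + (2 * (K + 1) + 1) * (K + 1).

(** One step of monotone iteration: [u' + M u = k - b + M v - v ^ 2] with periodic [u]. Comparison
    gives [v <= u], and the slack of [u] in the inequality is [(u - v) * (M - u - v)]. If [u] and
    [v] differ anywhere, the slack is bounded below over the whole period and [k] can be lowered.
    The slope bound depends on [K] only, which is what compactness needs. *)
Lemma subsol_improve K k v : k <= K -> subsol k v -> 0 < ig v 0 L ->
  exists u, [/\ subsol k u,
    forall x y, 0 <= x -> x <= y -> y <= L -> `|u y - u x| <= slope K * (y - x),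
    forall x, 0 <= x <= L -> v x <= u x &
    riccati k v \/ exists2 e, 0 < e & subsol (k - e) u].
Proof.
move=> kK sv v0; have hV := subsol_bound kK sv v0.
have k0 := subsol_ge0 sv; case: sv => lv v0L hv; have bv := lip_bm lv.
set V := K + 1 in hV *; have VK : K <= V ^+ 2 by rewrite /V; rnra.
have V0 : 0 < V by rewrite /V; rlra.
(* Both functions stay below [V], so [M - u - v >= 1] and the slack is at least [u - v]. *)
pose M := 2 * V + 1; have M0 : 0 < M by rewrite /M; rlra.
have M0' : 0 < ig (fun=> M) 0 L by rewrite ig_cst// subr0 mulr_gt0.
pose f t := k - b t + M * v t - v t ^+ 2.
have bf : bm 0 L f by rewrite /f; bm_tac.
have [u hu u0L] := lin_per L0' (bm_cst 0 L M) bf (lt0r_neq0 M0').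
have bu := prim_bm hu; have lu := prim_lip hu.
have iu x y : 0 <= x -> x <= y -> y <= L -> u y - u x = ig (fun t => f t - M * u t) x y.
  by move=> *; rewrite (proj2 hu).
have lw : lip 0 L (fun t => u t - v t) by exact: lipD lu (lipN lv).
have hw s t : 0 <= s -> s <= t -> t <= L ->
    u t - v t - (u s - v s) >= - ig (fun t => M * (u t - v t)) s t.
  move=> s0 st tL; have := hv s t s0 st tL.
  have -> : u t - v t - (u s - v s) = (u t - u s) - (v t - v s) by ring.
  rewrite iu// => h1.
  have -> : - ig (fun r => M * (u r - v r)) s t =
    ig (fun r => f r - M * u r) s t - ig (fun r => k - b r - v r ^+ 2) s t.
    rewrite -igN -?igB; try (apply: sub => //; bm_tac).
    by apply: ig_eq => r _; rewrite /f; ring.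
  by rewrite lerD2l lerN2.
have vu x : 0 <= x <= L -> 0 <= u x - v x.
  apply: (cmp_ge0 (al := fun=> M) (w := fun t => u t - v t)) => //.
    exact: bm_cst.
  by rewrite v0L u0L.
have uV x : 0 <= x <= L -> 0 <= V - u x.
  apply: (cmp_ge0 (al := fun=> M) (w := fun t => V - u t)) => //.
  - exact: bm_cst.
  - exact: lipD (lip_cst _ _ _) (lipN lu).
  - move=> s t s0 st tL.
    have -> : V - u t - (V - u s) = - (u t - u s) by ring.
    rewrite iu// lerN2; apply: ig_le; try (apply: sub => //; bm_tac).
    move=> r /andP[sr rt]; have /andP[] := b0 (x := r) ltac:(rlra).
    have := hV r ltac:(rlra); rewrite /f /M ler_norml => /andP[]; rnra.
  - by rewrite u0L.
have usub e : (forall x, 0 <= x <= L -> e <= u x - v x) -> subsol (k - e) u.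
  move=> he; split=> // x y x0 xy yL; rewrite iu//.
  apply: ig_le; try (apply: sub => //; bm_tac).
  move=> r /andP[sr rt]; have hr : 0 <= r <= L by rlra.
  have /andP[] := b0 hr; have := hV r hr; have := uV r hr; have := vu r hr.
  have := he r hr; rewrite /f /M ler_norml => q1 q2 q3 /andP[q4 q5] q6 q7.
  have : (u r - v r) * 1 <= (u r - v r) * (M - u r - v r).
    by rewrite ler_wpM2l// /M; rlra.
  by rewrite /M; rnra.
exists u; split.
- by rewrite -[k]subr0; exact: usub.
- move=> x y x0 xy yL; rewrite iu//; apply: ig_abs => //.
    by apply: sub => //; bm_tac.
  move=> r /andP[sr rt]; have hr : 0 <= r <= L by rlra.
  have /andP[] := b0 hr; have := hV r hr; have := uV r hr; have := vu r hr.
  rewrite /f /slope -/V -/M !ler_norml => q2 q3 /andP[q4 q5] q6 q7.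
  have n1 : M * v r <= M * V by rewrite ler_pM2l.
  have n2 : - (M * V) <= M * v r by rewrite -mulrN ler_pM2l.
  have n3 : M * u r <= M * V by rewrite ler_pM2l//; rlra.
  have n4 : - (M * V) <= M * u r by rewrite -mulrN ler_pM2l//; rlra.
  have n5 : v r ^+ 2 <= V ^+ 2 by rnra.
  have n6 : 0 <= v r ^+ 2 := sqr_ge0 _.
  by apply/andP; rlra.
- by move=> x /vu; rlra.
- have [eqv|] := pselect (forall x, 0 <= x <= L -> u x = v x).
    left; split=> //; apply: prim_ext hu => // x hx.
    by rewrite /f eqv//; ring.
  move=> /existsNP[x /not_implyP[hx neq]]; right.
  have wx : 0 < u x - v x by rewrite lt_neqAle vu// andbT eq_sym subr_eq0; exact/eqP.
  have hA : prim 0 L (fun t => M * t) (fun=> M).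
    by apply: prim_ext (primZ M (prim_id 0 L)) => // t _ /=; rewrite mulr1.
  have mono := exp_nondecr hA lw hw.
  have hx0 : 0 <= x by rlra.
  have hxL : x <= L by rlra.
  have m1 := mono x L hx0 hxL (lexx L).
  have ex1 : 1 <= expR (M * x) by rewrite -expR0 ler_expR mulr_ge0// ltW.
  have eL := expR_gt0 (M * L).
  (* Positivity at [x] is transported to [L] by the integrating factor, then from 0, which has the
     same value, to every point; each passage costs at most [expR (M * L)]. *)
  pose d := (u x - v x) / expR (M * L).
  have d0 : 0 < d by rewrite divr_gt0.
  have wL : d <= u L - v L.
    rewrite /d ler_pdivrMr// mulrC; apply: le_trans m1.
    by rewrite ler_peMl// ltW.
  exists (d / expR (M * L)); first by rewrite divr_gt0.
  apply: usub => y hy; have hy0 : 0 <= y by rlra. have hyL : y <= L by rlra.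
  have m2 := mono 0 y (lexx 0) hy0 hyL.
  rewrite mulr0 expR0 mul1r u0L v0L in m2.
  rewrite ler_pdivrMr//; apply: le_trans wL _; apply: le_trans m2 _.
  rewrite mulrC ler_wpM2l//; first exact: vu.
  by rewrite ler_expR ler_pM2l.
Qed.

(** If [k' < k], the difference [w = v - v'] satisfies [w' >= (k - k') - (v + v') w] with a
    multiplier of positive mean. Hence [w] is bounded below by a positive constant, against the
    order of the means. *)
Lemma riccati_minimal k k' v v' : riccati k v -> subsol k' v' ->
  0 < ig v 0 L -> ig v 0 L <= ig v' 0 L -> k <= k'.
Proof.
move=> [hv v0L] [lv' v0L' hv'] v0 vv'.
have bv := prim_bm hv; have bv' := lip_bm lv'; have lv := prim_lip hv.
rewrite leNgt; apply/negP => kk'.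
have [||||||eta e0 he] := @cmp_gt0 R 0 L (fun t => v t + v' t)
  (fun t => v t - v' t) (k - k') L0'.
- by bm_tac.
- exact: lipD lv (lipN lv').
- by rlra.
- move=> x y x0 xy yL; have := hv' x y x0 xy yL.
  have -> : v y - v' y - (v x - v' x) = (v y - v x) - (v' y - v' x) by ring.
  rewrite (proj2 hv)// => h1.
  have -> : ig (fun t => k - k' - (v t + v' t) * (v t - v' t)) x y =
    ig (fun t => k - b t - v t ^+ 2) x y - ig (fun t => k' - b t - v' t ^+ 2) x y.
    rewrite -igB; try (apply: sub => //; bm_tac).
    by apply: ig_eq => t _; ring.
  by rewrite lerD2l lerN2.
- by rewrite v0L v0L'.
- by rewrite igD//; rlra.
have : ig (fun=> eta) 0 L <= ig (fun t => v t - v' t) 0 L.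
  by apply: ig_le => //; bm_tac.
rewrite ig_cst// igB// subr0.
have := mulr_gt0 e0 L0; rlra.
Qed.

Lemma subsol_closed k v : lip 0 L v ->
  (forall e, 0 < e -> exists k' v', [/\ subsol k' v', k' <= k + e &
     forall x, 0 <= x <= L -> `|v' x - v x| <= e]) -> subsol k v.
Proof.
move=> lv H; have bv := lip_bm lv; have [W W0 hW] := bm_ge0 bv.
have c0 : (0 : R) <= 0 <= L by rewrite lexx.
have cL : 0 <= L <= L by have := L0; rlra.
have v0L : v 0 = v L.
  apply/eqP; rewrite -subr_eq0 -normr_le0; apply/ler_addgt0Pr => e e0.
  have [|k' [v' [[_ e' _] _ he]]] := H (e / 2); first rlra.
  have := he _ c0; have := he _ cL; rewrite e' !ler_norml; rlra.
split=> // x y x0 xy yL; apply/ler_addgt0Pr => d d0.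
(* The total error per unit of [e]: 2 from the two endpoint values, and [2 + 2 W] times the length
   from [k'] and from the squares in the integrand. *)
pose c := (2 + 2 * W) * L + 2.
have cc : 2 <= c by rewrite /c lerDr mulr_ge0//; rlra.
pose e := Num.min 1 (d / c).
have e0 : 0 < e by rewrite /e lt_min ltr01 divr_gt0//; rlra.
have e1 : e <= 1 by rewrite /e ge_min lexx.
have ed : e * c <= d.
  by rewrite -ler_pdivlMr ?/e ?ge_min ?lexx ?orbT//; rlra.
have [k' [v' [[lv' _ hv'] k'k he]]] := H e e0.
have bv' := lip_bm lv'.
have := hv' x y x0 xy yL; have := he x ltac:(rlra); have := he y ltac:(rlra).
rewrite !ler_norml => h1 h2 h3.
have h4 : ig (fun t => k' - b t - v' t ^+ 2) x y <=
    ig (fun t => (k - b t - v t ^+ 2) + e * (2 + 2 * W)) x y.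
  apply: ig_le; try (apply: sub => //; bm_tac).
  move=> t /andP[xt ty]; have ht : 0 <= t <= L by rlra.
  have := he t ht; have := hW t ht; rewrite !ler_norml => /andP[q1 q2] /andP[q3 q4].
  have : v t ^+ 2 - v' t ^+ 2 <= e * (2 * W + 1).
    have -> : v t ^+ 2 - v' t ^+ 2 = (v t - v' t) * (2 * v t) - (v t - v' t) ^+ 2.
      by ring.
    have : (v t - v' t) * (2 * v t) <= e * (2 * W) by rnra.
    have := sqr_ge0 (v t - v' t); rnra.
  by rnra.
rewrite [leRHS]igD ?ig_cst// in h4; try (apply: sub => //; bm_tac).
have h5 : e * (2 + 2 * W) * (y - x) <= e * (2 + 2 * W) * L.
  by rewrite ler_wpM2l ?mulr_ge0 ?(ltW e0)//; rlra.
by move: ed; rewrite /c; rlra.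
Qed.

Lemma subsol_cst k lam : k = h + lam ^+ 2 -> subsol k (fun=> lam).
Proof.
move=> ->; split=> //; first exact: lip_cst.
move=> x y x0 xy yL; rewrite subrr; apply: ig_ge0 => t /andP[xt ty].
by have := b0 (x := t) ltac:(rlra); rlra.
Qed.

(** The infimum is taken over subsolutions of mean at least [lam], since improving a subsolution
    raises it and cannot keep the mean. Equality of the mean is recovered at the end: a surplus of
    mean could be traded for a smaller [k]. *)
Lemma riccati_exists lam : 0 < lam ->
  exists k v, riccati k v /\ ig v 0 L = lam * L.
Proof.
move=> lam0; pose K := h + lam ^+ 2.
have lL : 0 < lam * L by rewrite mulr_gt0.
pose S := [set k | k <= K /\ exists v, [/\ subsol k v, lam * L <= ig v 0 L &
   forall x y, 0 <= x -> x <= y -> y <= L -> `|v y - v x| <= slope K * (y - x)]].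
have K0 : 0 <= K by rewrite addr_ge0// sqr_ge0.
have sK0 : 0 <= slope K.
  by rewrite /slope !addr_ge0 ?mulr_ge0 ?sqr_ge0//; rlra.
have SK : S K.
  split=> //; exists (fun=> lam); split; first exact: subsol_cst.
    by rewrite ig_cst// subr0.
  by move=> x y x0 xy yL; rewrite subrr normr0 mulr_ge0// subr_ge0.
have lS : lbound S 0 by move=> k [_ [v [/subsol_ge0]]].
have iS : has_inf S by split; [exists K | exists 0].
pose k0 := inf S.
have seq n : exists kv : R * (R -> R), [/\ kv.1 <= K, subsol kv.1 kv.2,
    lam * L <= ig kv.2 0 L, kv.1 <= k0 + n.+1%:R^-1 &
   forall x y, 0 <= x -> x <= y -> y <= L ->
     `|kv.2 y - kv.2 x| <= slope K * (y - x)].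
  have n0 : 0 < n.+1%:R^-1 :> R by rewrite invr_gt0.
  have [k [kK [v [h1 h2 h3]]] hk] := inf_adherent n0 iS.
  by exists (k, v); split=> //; exact: ltW.
have {seq} [kv hkv] := choice seq.
have bnd n x : 0 <= x <= L -> `|(kv n).2 x| <= K + 1.
  case: (hkv n) => h1 h2 h3 _ _; apply: (subsol_bound h1 h2).
  exact: lt_le_trans h3.
have [v lv hv] := equilip_selection L0' sK0 bnd
  (fun n => let: And5 _ _ _ _ h := hkv n in h).
have lv' : lip 0 L v by exists (slope K).
have bv := lip_bm lv'.
have k0S k : S k -> k0 <= k by apply: ge_inf; exists 0.
have sv : subsol k0 v.
  apply: subsol_closed => // e e0.
  have [n Nn he] := hv e (Num.bound e^-1) e0.
  exists (kv n).1, (kv n).2; case: (hkv n) => h1 h2 h3 h4 _; split=> //.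
  apply: le_trans h4 _; rewrite lerD2l invf_ple ?posrE// ltW//.
  apply: lt_le_trans (archi_boundP _) _; first by rewrite invr_ge0 ltW.
  by rewrite ler_nat ltnW.
have mv : lam * L <= ig v 0 L.
  apply/ler_addgt0Pr => e e0.
  have [n _ he] := hv (e / L) 0%N (divr_gt0 e0 L0).
  case: (hkv n) => _ [l2 _ _] h3 _ _; have b2 := lip_bm l2.
  apply: le_trans h3 _; have -> : e = e / L * (L - 0) by field; rewrite gt_eqF.
  rewrite -ig_cst// -igD//; last exact: bm_cst.
  apply: ig_le => //; first by bm_tac.
  by move=> t ht; have := he t ht; rewrite ler_norml; rlra.
have k0K : k0 <= K by exact: k0S.
have v0 : 0 < ig v 0 L by rlra.
have rv : riccati k0 v.
  have [u [_ lu vu [//|[e e0 su]]]] := subsol_improve k0K sv v0.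
  suff : k0 <= k0 - e by rlra.
  apply: k0S; split; first rlra.
  exists u; split=> //; apply: le_trans mv _; apply: ig_le => //.
  by case: su => l _ _; exact: lip_bm.
exists k0, v; split=> //; apply/eqP; rewrite eq_le mv andbT.
rewrite leNgt; apply/negP => gap.
have bv2 : bm 0 L (fun t => 2 * v t) by bm_tac.
have iv2 : 0 < ig (fun t => 2 * v t) 0 L by rewrite igZ//; rlra.
have [w hw w0L] := lin_per L0' bv2 (bm_cst 0 L 1) (lt0r_neq0 iv2).
have bw := prim_bm hw; have lw := prim_lip hw; have [W W0 hW] := bm_ge0 bw.
pose g := ig v 0 L - lam * L; have g0 : 0 < g by rewrite /g; rlra.
pose c := 2 * (W + 1) ^+ 2; have c0 : 0 < c by rewrite /c mulr_gt0// exprn_gt0//; rlra.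
(* Moving along [- w], where [w' + 2 v w = 1], lowers [k] at unit rate. The first bound keeps the
   quadratic term below half of this gain; the second spends no more mean than the surplus [g]. *)
pose d := Num.min c^-1 (g / (W * L + 1)).
have WL : 0 <= W * L by rewrite mulr_ge0.
have d0 : 0 < d by rewrite lt_min invr_gt0 c0 divr_gt0//; rlra.
have d1 : d * c <= 1.
  by rewrite -ler_pdivlMr// div1r /d ge_min lexx.
have d2 : d * (W * L) <= g.
  have : d * (W * L + 1) <= g.
    by rewrite -ler_pdivlMr ?/d ?ge_min ?lexx ?orbT//; rlra.
  rlra.
pose u t := v t - d * w t.
have hu : prim 0 L u (fun t => (k0 - b t - v t ^+ 2) - d * (1 - 2 * v t * w t)).
  exact: primB (proj1 rv) (primZ d hw).
have bu := prim_bm hu.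
have su : subsol (k0 - d / 2) u.
  split; first exact: prim_lip hu.
    by rewrite /u w0L (proj2 rv).
  move=> x y x0 xy yL; rewrite (proj2 hu)//.
  apply: ig_le; try (apply: sub => //; bm_tac).
  move=> t /andP[xt ty]; have ht : 0 <= t <= L by rlra.
  have wW : w t ^+ 2 <= (W + 1) ^+ 2.
    by have := hW t ht; rewrite ler_norml; rnra.
  have : d * (d * w t ^+ 2) <= d * 2^-1.
    rewrite ler_pM2l//; move: d1; rewrite /c; rnra.
  by rewrite /u; rnra.
have mu' : lam * L <= ig u 0 L.
  rewrite /u igB ?igZ//; try bm_tac.
  have : ig w 0 L <= W * (L - 0).
    rewrite -ig_cst//; apply: ig_le => //; first exact: bm_cst.
    by move=> t /hW; rewrite ler_norml => /andP[].
  rewrite subr0 -(ler_pM2l d0); rewrite /g in d2; rlra.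
have u0 : 0 < ig u 0 L by rlra.
have kd : k0 - d / 2 <= K by rlra.
(* The improvement step serves here to restore the slope bound required by [S]. *)
have [u' [su' lu' uu' _]] := subsol_improve kd su u0.
suff : k0 <= k0 - d / 2 by rlra.
apply: k0S; split=> //; exists u'; split=> //.
apply: le_trans mu' _; apply: ig_le => //.
by case: su' => l _ _; exact: lip_bm.
Qed.

End Riccati.

(** * Integrals under translations and reflections *)

Section ChangeOfVariable.
Context {R : realType}.
Implicit Types (d e r s t : R).
Notation mu := (@lebesgue_measure R).
Implicit Types (phi f F : R -> R) (a b c x y : R).

Lemma mu_itv_cc (x y : R) : x <= y -> mu `[x, y]%classic = (y - x)%:E.
Proof.
move=> xy; rewrite /= lebesgue_measure_itv/= lte_fin.
by case: ltP => [_|yx]; rewrite -?EFinB//; congr EFin; olra.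
Qed.

Section isometry.
Variable phi : R -> R.
Hypothesis mphi : measurable_fun setT phi.
Hypothesis phi_itv : forall a b, mu (phi @^-1` `]a, b]%classic) = mu `]a, b]%classic.

(** Lebesgue measure is determined by half-open intervals, so translations and reflections are
    treated alike by checking their preimages of intervals. *)
Lemma measure_isometry (A : set R) : measurable A ->
  pushforward mu (phi : _ -> measurableTypeR R) A = mu A.
Proof.
move=> mA; apply/esym/lebesgue_measure_unique => //= _ [[a b]] _ <-.
by rewrite /pushforward phi_itv.
Qed.

Lemma bm_isometry x y x' y' f : (forall t, x' <= t <= y' -> x <= phi t <= y) ->
  bm x y f -> bm x' y' (fun t => f (phi t)).
Proof.
move=> h [mf [M hM]]; split; last by exists M => t /h; exact: hM.
apply: (@measurable_comp _ _ _ _ _ _ `[x, y]) => //.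
- by move=> _ [t + <-] /=; rewrite !in_itv/=; exact: h.
- exact: measurable_funTS.
Qed.

Lemma ig_isometry x y x' y' f :
  phi @^-1` `[x, y]%classic = `[x', y']%classic -> bm x y f ->
  ig (fun t => f (phi t)) x' y' = ig f x y.
Proof.
move=> hphi bf; pose g := f \_ `[x, y].
have mg : measurable_fun setT g.
  by apply/(measurable_restrictT f _) => //; exact: (proj1 bf).
have hphi' t : x' <= t <= y' -> x <= phi t <= y.
  move=> ht; have : (phi @^-1` `[x, y]%classic) t by rewrite hphi/= in_itv.
  by rewrite /= in_itv.
have bfp := bm_isometry hphi' bf.
have -> : ig f x y = ig g x y.
  by apply: ig_eq => t ht; rewrite /g patchE mem_set//= in_itv.
have gphi t : x' <= t <= y' -> f (phi t) = g (phi t).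
  by move=> ht; rewrite /g patchE mem_set//= in_itv/=; exact: hphi'.
rewrite (ig_eq gphi) /ig /Rintegral; congr fine; apply/esym.
rewrite -hphi.
transitivity (\int[pushforward mu (phi : _ -> measurableTypeR R)]_(t in `[x, y]) (g t)%:E)%E.
  by apply: eq_measure_integral => //= A mA _; exact/esym/measure_isometry.
rewrite integral_pushforward//=.
- exact/measurable_EFinP.
- rewrite hphi; apply: (@eq_integrable _ _ _ mu `[x', y'] _ (EFin \o (fun t => f (phi t)))) => //.
    move=> t; rewrite inE/= in_itv/= => ht.
    by rewrite /= gphi.
  exact: bm_integrable.
Qed.

End isometry.

Lemma ig_reflect c x y f : bm x y f ->
  ig (fun t => f (c - t)) (c - y) (c - x) = ig f x y.
Proof.
apply: (@ig_isometry (fun t => c - t)).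
- by apply: measurable_funB => //; exact: measurable_cst.
- move=> a b.
  have -> : (fun t => c - t) @^-1` `]a, b]%classic = `[c - b, c - a[%classic.
    apply/seteqP; split=> t /=; rewrite !in_itv/= => /andP[h1 h2];
    by apply/andP; split; olra.
  rewrite /= !lebesgue_measure_itv/= !lte_fin.
  case: ltP => h1; case: ltP => h2; rewrite -?EFinB//; [|exfalso; olra..].
  by congr EFin; olra.
- apply/seteqP; split=> t /=; rewrite !in_itv/= => /andP[h1 h2];
  by apply/andP; split; olra.
Qed.

Lemma bm_reflect c x y f : bm x y f -> bm (c - y) (c - x) (fun t => f (c - t)).
Proof.
apply: bm_isometry; first by apply: measurable_funB => //; exact: measurable_cst.
by move=> t ht; olra.
Qed.

Lemma mu_preimage_shift c a b :
  mu ((fun t => t + c) @^-1` `]a, b]%classic) = mu `]a, b]%classic.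
Proof.
have -> : (fun t => t + c) @^-1` `]a, b]%classic = `]a - c, b - c]%classic.
  apply/seteqP; split=> t /=; rewrite !in_itv/= => /andP[h1 h2];
  by apply/andP; split; olra.
rewrite /= !lebesgue_measure_itv/= !lte_fin ltrD2r.
by case: ifP => // _; rewrite -!EFinB; congr EFin; ring.
Qed.

Lemma ig_shift c x y f : bm (x + c) (y + c) f ->
  ig (fun t => f (t + c)) x y = ig f (x + c) (y + c).
Proof.
apply: (@ig_isometry (fun t => t + c)).
- by apply: measurable_funD => //; exact: measurable_cst.
- by move=> a b; exact: mu_preimage_shift.
- apply/seteqP; split=> t /=; rewrite !in_itv/= => /andP[h1 h2];
  by apply/andP; split; olra.
Qed.

Lemma bm_shift c x y f : bm (x + c) (y + c) f -> bm x y (fun t => f (t + c)).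
Proof.
apply: bm_isometry; first by apply: measurable_funD => //; exact: measurable_cst.
by move=> t ht; olra.
Qed.

Lemma prim_reflect x y F f : prim x y F f ->
  prim x y (fun t => F (x + y - t)) (fun t => - f (x + y - t)).
Proof.
move=> [bf hF].
have br : bm x y (fun t => f (x + y - t)).
  have := bm_reflect (x + y) bf.
  have -> : x + y - y = x by ring.
  by have -> : x + y - x = y by ring.
split; first exact: bmN.
move=> s t xs st ty.
rewrite igN; last exact: bm_sub br.
have := @ig_reflect (x + y) (x + y - t) (x + y - s) f.
have -> : x + y - (x + y - s) = s by ring.
have -> : x + y - (x + y - t) = t by ring.
move=> ->; last by apply: bm_sub bf; olra.
by rewrite -hF; [ring | olra..].
Qed.

End ChangeOfVariable.

(** * Level sets and the bathtub principle *)

Section Bathtub.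
Context {R : realType}.
Implicit Types (c d e r s t : R).
Notation mu := (@lebesgue_measure R).
Implicit Types (a b x y : R) (f g p : R -> R).

Lemma ig_subset a b x y f : a <= x -> x <= y -> y <= b -> bm a b f ->
  (forall t, a <= t <= b -> 0 <= f t) -> ig f x y <= ig f a b.
Proof.
move=> ax xy yb bf f0.
rewrite (@ig_split _ a x b)//; [|olra].
rewrite (@ig_split _ x y b)//; [|exact: bm_sub bf].
have : 0 <= ig f a x by apply: ig_ge0 => t ht; apply: f0; olra.
have : 0 <= ig f y b by apply: ig_ge0 => t ht; apply: f0; olra.
olra.
Qed.

Lemma lip_ig_eq0 a b f : a < b -> lip a b f ->
  (forall t, a <= t <= b -> 0 <= f t) -> ig f a b <= 0 ->
  forall t, a <= t <= b -> f t = 0.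
Proof.
move=> ab lf f0 i0 x /andP[ax xb]; apply/eqP; rewrite eq_le f0 ?ax//= andbT.
rewrite leNgt; apply/negP => fx; have bf := lip_bm lf.
case: lf => K K0 hK.
have [d d0 Kd] : exists2 d, 0 < d & K * d <= f x / 2.
  exists (f x / 2 / (K + 1)); first by rewrite !divr_gt0//; olra.
  by rewrite mulrCA ler_piMr ?ler_pdivrMr//; olra.
have [s [sa sx sd sa']] : exists s, [/\ a <= s, s <= x, x - d <= s &
    s = a \/ s = x - d].
  by have [h1|h1] := leP a (x - d); [exists (x - d)|exists a]; split; olra || auto.
have [t [tb tx td tb']] : exists t, [/\ t <= b, x <= t, t <= x + d &
    t = b \/ t = x + d].
  by have [h1|h1] := leP (x + d) b; [exists (x + d)|exists b]; split; olra || auto.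
have st : s < t by case: sa' tb' => -> [] ->; olra.
have : ig (fun=> f x / 2) s t <= ig f s t.
  apply: ig_le; [exact: bm_cst|exact: bm_sub bf|move=> r /andP[sr rt]].
  have [rx|xr] := leP r x.
    have := hK r x ltac:(olra) rx xb; rewrite ler_norml.
    have : K * (x - r) <= K * d by rewrite ler_wpM2l//; olra.
    olra.
  have := hK x r ax (ltW xr) ltac:(olra); rewrite ler_norml.
  have : K * (r - x) <= K * d by rewrite ler_wpM2l//; olra.
  olra.
rewrite ig_cst ?(ltW st)//.
have := ig_subset sa (ltW st) tb bf f0.
have : 0 < f x / 2 * (t - s) by rewrite mulr_gt0//; olra.
olra.
Qed.

Lemma bm_indic a b (A : set R) : measurable A -> bm a b (\1_A : R -> R).
Proof.
move=> mA; split; first exact: measurable_indic.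
by exists 1 => x _; rewrite indicE; case: (_ \in _); rewrite ?normr1// normr0.
Qed.

Lemma ig_indic a b (A : set R) : measurable A ->
  (ig (\1_A : R -> R) a b)%:E = mu (A `&` `[a, b]).
Proof.
move=> mA; rewrite /ig /Rintegral -integral_indic// fineK//.
exact: integrable_fin_num (bm_integrable (bm_indic a b mA)).
Qed.

Lemma ig_indic_bigcup a b (A : nat -> set R) c : a <= b ->
  (forall n, measurable (A n)) ->
  nondecreasing_seq A -> (forall n, ig (\1_(A n) : R -> R) a b <= c) ->
  ig (\1_(\bigcup_n A n) : R -> R) a b <= c.
Proof.
move=> ab mA ndA hc; have mU : measurable (\bigcup_n A n) by exact: bigcup_measurable.
rewrite -lee_fin ig_indic// setI_bigcupl.
have := @nondecreasing_cvg_mu _ _ _ mu (fun n => A n `&` `[a, b]).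
move=> /(_ (fun n => measurableI _ _ (mA n) (measurable_itv _))).
move=> /(_ (bigcup_measurable (fun n _ => measurableI _ _ (mA n) (measurable_itv _)))).
have nd : nondecreasing_seq (fun n => A n `&` `[a, b]).
  move=> m n mn; apply/subsetPset; apply: setSI.
  by apply/subsetPset; exact: ndA.
move=> /(_ nd) cv; rewrite -(cvg_lim _ cv)//.
apply: lime_le; first by apply/cvg_ex; eexists; exact: cv.
by apply: nearW => n /=; rewrite -ig_indic// lee_fin.
Qed.

Lemma ig_indicC a b (A : set R) : a <= b -> measurable A ->
  ig (\1_(~` A) : R -> R) a b = b - a - ig (\1_A : R -> R) a b.
Proof.
move=> ab mA; rewrite -[b - a]mul1r -ig_cst// -igB; last 2 first.
- exact: bm_cst.
- exact: bm_indic.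
by apply: ig_eq => t _; rewrite !indicE in_setC; case: (t \in A); rewrite /= ?subrr ?subr0.
Qed.

Lemma bm_gt_measurable a b p s : bm a b p ->
  measurable (`[a, b]%classic `&` [set t | s < p t]).
Proof.
move=> [mp _]; have := mp ltac:(by []) `]s, +oo[%classic ltac:(by []).
by congr measurable; apply/seteqP; split=> t /=; rewrite !in_itv/= !andbT.
Qed.

Lemma bm_ge_measurable a b p s : bm a b p ->
  measurable (`[a, b]%classic `&` [set t | s <= p t]).
Proof.
move=> [mp _]; have := mp ltac:(by []) `[s, +oo[%classic ltac:(by []).
by congr measurable; apply/seteqP; split=> t /=; rewrite !in_itv/= !andbT.
Qed.

(** The level is the infimum of those [s] for which [p > s] has measure at most [c]. The open
    superlevel set is approached from levels above, the closed one from levels below. Two sets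
    appear because the level itself may have positive measure. *)
Lemma level_exists a b p c : a < b -> bm a b p -> 0 < c < b - a ->
  exists t,
    ig (\1_(`[a, b]%classic `&` [set x | t < p x]) : R -> R) a b <= c <=
    ig (\1_(`[a, b]%classic `&` [set x | t <= p x]) : R -> R) a b.
Proof.
move=> ab bp /andP[c0 cb]; have [M M0 hM] := bm_ge0 bp.
pose A s := `[a, b]%classic `&` [set x | s < p x].
have mA s : measurable (A s) by exact: bm_gt_measurable.
pose S := [set s | ig (\1_(A s) : R -> R) a b <= c].
have SM : S M.
  rewrite /S/= (@ig_eq _ a b _ (fun=> 0)); first by rewrite ig_cst ?(ltW ab)// mul0r ltW.
  move=> t ht; rewrite indicE memNset//= => -[_]; apply/negP; rewrite -leNgt.
  by have := hM t ht; rewrite ler_norml => /andP[].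
have lS s : S s -> - M - 1 <= s.
  rewrite /S/= leNgt => h; apply/negP => sM; move: h.
  rewrite (@ig_eq _ a b _ (fun=> 1)); first by rewrite ig_cst ?(ltW ab)//; olra.
  move=> t ht; rewrite indicE mem_set//=; split; first by rewrite /= in_itv.
  by have := hM t ht; rewrite /= ler_norml; olra.
have iS : has_inf S by split; [exists M|exists (- M - 1)].
have hl : has_lbound S by exists (- M - 1).
have monoS s s' : S s -> s <= s' -> S s'.
  rewrite /S /= => h ss'; apply: le_trans h; apply: ig_le; try exact: bm_indic.
  move=> t _; rewrite !indicE ler_nat; case: (boolP (t \in A s')) => //.
  by rewrite inE => -[h1 /= h2]; rewrite mem_set//; split=> //=; exact: le_lt_trans h2.
pose t := inf S; exists t; apply/andP; split.
  have -> : `[a, b]%classic `&` [set x | t < p x] = \bigcup_n A (t + n.+1%:R^-1).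
    apply/seteqP; split=> x /=.
      move=> [hx tp]; exists (Num.bound (p x - t)^-1) => //; split=> //=.
      rewrite -ltrBrDl invf_plt ?posrE ?subr_gt0//.
      apply: lt_le_trans (archi_boundP _) _; first by rewrite invr_ge0 subr_ge0 ltW.
      by rewrite ler_nat.
    move=> [n _ [hx /= h]]; split=> //=; apply: le_lt_trans h.
    by rewrite lerDl invr_ge0.
  apply: ig_indic_bigcup => //; first exact: ltW.
    move=> m n mn; apply/subsetPset => x [hx /= h]; split=> //=.
    by apply: le_lt_trans h; rewrite lerD2l lef_pV2 ?posrE// ler_nat.
  move=> n; have n0 : 0 < n.+1%:R^-1 :> R by rewrite invr_gt0.
  have [s Ss st] := inf_adherent n0 iS; exact: monoS Ss (ltW st).
(* Taking complements turns the decreasing intersection into an increasing union, so continuity from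
   below serves in both cases. *)
have -> : `[a, b]%classic `&` [set x | t <= p x] =
    `[a, b]%classic `\` \bigcup_n (`[a, b]%classic `\` A (t - n.+1%:R^-1)).
  apply/seteqP; split=> x /=.
    move=> [hx tp]; split=> // -[n _ [_ []]]; split=> //=.
    by apply: lt_le_trans tp; rewrite ltrBlDr ltrDl invr_gt0.
  move=> [hx H]; split=> //=; rewrite leNgt; apply/negP => pt; apply: H.
  exists (Num.bound (t - p x)^-1) => //; split=> // -[_ /=]; apply/negP.
  rewrite -leNgt lerBrDl -lerBrDr invf_ple ?posrE ?subr_gt0//.
  apply/ltW; apply: lt_le_trans (archi_boundP _) _.
    by rewrite invr_ge0 subr_ge0 ltW.
  by rewrite ler_nat.
set U := \bigcup_n _.
have mU : measurable U.
  by apply: bigcup_measurable => n _; apply: measurableD.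
have -> : ig (\1_(`[a, b] `\` U) : R -> R) a b = ig (\1_(~` U) : R -> R) a b.
  apply: ig_eq => x hx; rewrite !indicE; congr (nat_of_bool _)%:R.
  by rewrite in_setD [x \in _]mem_set//= ?in_itv//= in_setC.
rewrite ig_indicC ?(ltW ab)// lerBrDl -lerBrDr.
apply: ig_indic_bigcup; first exact: ltW.
- by move=> n; apply: measurableD.
- move=> m n mn; apply/subsetPset => x [hx /= h]; split=> //= -[_ /= h2]; apply: h.
  split=> //=; apply: le_lt_trans h2; rewrite lerD2l lerN2 lef_pV2 ?posrE// ler_nat.
  by [].
move=> n.
have -> : ig (\1_(`[a, b] `\` A (t - n.+1%:R^-1)) : R -> R) a b =
          ig (\1_(~` A (t - n.+1%:R^-1)) : R -> R) a b.
  apply: ig_eq => x hx; rewrite !indicE; congr (nat_of_bool _)%:R.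
  by rewrite in_setD [x \in _]mem_set//= ?in_itv//= in_setC.
rewrite ig_indicC ?(ltW ab)// lerD2l lerN2 leNgt; apply/negP => h.
have : S (t - n.+1%:R^-1) by rewrite /S/= ltW.
move=> /(ge_inf hl); rewrite -/t lerBrDr gerDl leNgt invr_gt0.
by rewrite ltr0Sn.
Qed.

(** On the plateau [p = t] the function takes an intermediate value [th], chosen to interpolate the
    mass between the open and the closed superlevel set. *)
Lemma bathtub_exists a b p m h : a < b -> bm a b p -> 0 < h ->
  0 < m < h * (b - a) ->
  exists g t, [/\ bm a b g, forall x, a <= x <= b -> 0 <= g x <= h, ig g a b = m &
    forall x, a <= x <= b -> (t < p x -> g x = h) /\ (p x < t -> g x = 0)].
Proof.
move=> ab bp h0 /andP[m0 mh].
have [|t] := @level_exists a b p (m / h) ab bp.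
  by rewrite divr_gt0//= ltr_pdivrMr// mulrC.
set A := _ `&` [set x | t < p x]; set B := _ `&` [set x | t <= p x].
have mA : measurable A by exact: bm_gt_measurable.
have mB : measurable B by exact: bm_ge_measurable.
have bA := bm_indic a b mA; have bB := bm_indic a b mB.
set i := ig _ a b; set j := ig _ a b => /andP[].
rewrite ler_pdivlMr// ler_pdivrMr// => im mj.
have gP th : 0 <= th <= h -> forall x, a <= x <= b ->
    let g := th * \1_B x + (h - th) * \1_A x in
    0 <= g <= h /\ ((t < p x -> g = h) /\ (p x < t -> g = 0)).
  move=> hth x hx /=; rewrite !indicE.
  have hA : (x \in A) = (t < p x).
    apply/idP/idP; first by rewrite inE => -[].
    by move=> tp; rewrite mem_set//; split=> //=; rewrite in_itv.
  have hB : (x \in B) = (t <= p x).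
    apply/idP/idP; first by rewrite inE => -[].
    by move=> tp; rewrite mem_set//; split=> //=; rewrite in_itv.
  rewrite hA hB; case: ltgtP => tp /=; rewrite ?mulr1 ?mulr0.
  - by split; [olra|split=> // _; olra].
  - by split; [olra|split=> // _; olra].
  - by split; [olra|split=> //; rewrite ?tp ?ltxx].
have gi th : ig (fun x => th * \1_B x + (h - th) * \1_A x) a b =
    th * j + (h - th) * i.
  by rewrite igD ?igZ//; apply: bmM => //; exact: bm_cst.
have bg th : bm a b (fun x => th * \1_B x + (h - th) * \1_A x).
  by bm_tac.
suff [th hth e] : exists2 th, 0 <= th <= h & th * j + (h - th) * i = m.
  exists (fun x => th * \1_B x + (h - th) * \1_A x), t; split=> //.
  - by move=> x hx; case: (gP th hth x hx).
  - by rewrite gi.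
  - by move=> x hx; case: (gP th hth x hx).
have [ij|ij] := eqVneq i j.
  by exists 0; [olra | move: mj; rewrite -ij; olra].
have ji : 0 < j - i.
  rewrite subr_gt0 lt_neqAle ij/=.
  have : i * h <= j * h by exact: le_trans mj.
  by rewrite ler_pM2r.
exists ((m - h * i) / (j - i)); last by field; rewrite gt_eqF.
apply/andP; split; first by rewrite divr_ge0//; olra.
by rewrite ler_pdivrMr//; olra.
Qed.

(** Equal masses allow [p] to be replaced by [p - t], after which the integrand is nonnegative at
    every point. *)
Lemma bathtub_le a b p g f t h : a <= b -> bm a b p -> bm a b f -> bm a b g ->
  (forall x, a <= x <= b -> 0 <= f x <= h) -> ig f a b = ig g a b ->
  (forall x, a <= x <= b -> (t < p x -> g x = h) /\ (p x < t -> g x = 0)) ->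
  0 <= ig (fun x => (g x - f x) * p x) a b.
Proof.
move=> ab bp bf bg f01 fg hg.
have -> : ig (fun x => (g x - f x) * p x) a b =
    ig (fun x => (g x - f x) * (p x - t) + t * (g x - f x)) a b.
  by apply: ig_eq => x _; ring.
rewrite igD ?igZ ?igB//; try bm_tac.
rewrite fg subrr mulr0 addr0; apply: ig_ge0 => x hx.
have [h1 h2] := hg x hx; have := f01 x hx.
case: (ltgtP t (p x)) => tp; last by rewrite tp subrr mulr0.
- by rewrite h1//; onra.
- by rewrite h2//; onra.
Qed.

End Bathtub.

(** * The comparison identity and the existence of a maximising coefficient *)

Section Maximum.
Context {R : realType}.
Implicit Types (c d e r s t x y : R).
Implicit Types (k : R) (b v p u : R -> R).
Variables (L h m lam : R).

Definition adm b : Prop :=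
  [/\ bm 0 L b, forall x, 0 <= x <= L -> 0 <= b x <= h & ig b 0 L = m].

Definition eig b k v : Prop := riccati L b k v /\ ig v 0 L = lam * L.

Definition maximal b k v : Prop :=
  [/\ adm b, eig b k v & forall b' k' v', adm b' -> eig b' k' v' -> k' <= k].

Hypotheses (L0 : 0 < L) (h0 : 0 < h) (m0 : 0 < m) (mh : m < h * L) (lam0 : 0 < lam).

Let L0' : 0 <= L := ltW L0.
Let lL : 0 < lam * L. Proof. exact: mulr_gt0. Qed.

Lemma adm_eig b : adm b -> exists k v, eig b k v.
Proof. by move=> [bb b01 _]; exact: (riccati_exists L0 bb b01 lam0). Qed.

Lemma eig_le b k v : adm b -> eig b k v -> k <= h + lam ^+ 2.
Proof.
move=> [bb b01 _] [rv mv].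
apply: (riccati_minimal L0 bb rv (subsol_cst b01 (erefl _) : subsol L b _ (fun=> lam))).
  by rewrite mv.
by rewrite mv ig_cst// subr0.
Qed.

(** Multiply the difference of the two Riccati equations by [p] and integrate over a period. The
    weight belongs to a third function [u], because in the existence proof it comes from the limit
    of a maximising sequence and not from a member of it. *)
Lemma compare_formula b b' k k' v v' u p :
  bm 0 L b -> bm 0 L b' -> eig b k v -> eig b' k' v' -> bm 0 L u ->
  prim 0 L p (fun t => 2 * u t * p t - 1) -> p 0 = p L ->
  (k' - k) * ig p 0 L = ig (fun t => (b' t - b t) * p t) 0 L +
    ig (fun t => (v' t + v t - 2 * u t) * (v' t - v t) * p t) 0 L.
Proof.
move=> bb bb' [[hv v0L] mv] [[hv' v0L'] mv'] bu hp p0L.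
have bv := prim_bm hv; have bv' := prim_bm hv'; have bp := prim_bm hp.
have hH := primM (primB hv' hv) hp.
have := proj2 hH 0 L (lexx _) L0' (lexx _).
rewrite v0L v0L' p0L subrr.
have -> : ig (fun t => (k' - b' t - v' t ^+ 2 - (k - b t - v t ^+ 2)) * p t +
     (v' t - v t) * (2 * u t * p t - 1)) 0 L =
   ig (fun t => (k' - k) * p t - ((b' t - b t) * p t +
       (v' t + v t - 2 * u t) * (v' t - v t) * p t) - (v' t - v t)) 0 L.
  by apply: ig_eq => t _; ring.
rewrite !igB ?igZ ?igD ?mv ?mv'//; try bm_tac.
by rewrite subrr subr0 => /eqP; rewrite eq_sym subr_eq0 => /eqP.
Qed.

(** Only the Riccati solutions of a maximising sequence converge uniformly, and no limit of the
    coefficients is taken. The limit [v] defines a weight [p], and the bathtub function of that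
    weight is shown to reach the supremum. *)
Lemma maximal_exists : exists b k v, maximal b k v.
Proof.
pose S := [set k | exists b v, adm b /\ eig b k v].
have adm_cst : adm (fun=> m / L).
  split; first exact: bm_cst.
    by move=> x _; rewrite divr_ge0 ?(ltW m0)//= ler_pdivrMr// ltW.
  by rewrite ig_cst//; field; rewrite gt_eqF.
have Sne : S !=set0 by have [k [v ev]] := adm_eig adm_cst; exists k, (fun=> m / L), v.
pose K := h + lam ^+ 2.
have ubS : ubound S K by move=> k [b [v [ab ev]]]; exact: eig_le ev.
have sS : has_sup S by split=> //; exists K.
pose ks := sup S.
have leS k b v : adm b -> eig b k v -> k <= ks.
  by move=> ab ev; apply: ub_le_sup; [exists K|exists b, v].
have seq n : exists bkv : (R -> R) * R * (R -> R),
    [/\ adm bkv.1.1, eig bkv.1.1 bkv.1.2 bkv.2 & ks - n.+1%:R^-1 <= bkv.1.2].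
  have n0 : 0 < n.+1%:R^-1 :> R by rewrite invr_gt0.
  have [k [b [v [ab ev]]] hk] := sup_adherent n0 sS.
  by exists (b, k, v); split=> //; exact: ltW.
have {seq} [bkv hs] := choice seq.
pose V := K + 1; have K0 : 0 <= K by rewrite addr_ge0 ?sqr_ge0// ltW.
have bnd n x : 0 <= x <= L -> `|(bkv n).2 x| <= V.
  case: (hs n) => ab ev _; have [bb b01 _] := ab; apply: (subsol_bound L0 bb b01).
  - exact: eig_le ev.
  - exact: riccati_subsol ev.1.
  - by rewrite ev.2.
have lips n x y : 0 <= x -> x <= y -> y <= L ->
    `|(bkv n).2 y - (bkv n).2 x| <= (K + h + V ^+ 2) * (y - x).
  move=> x0 xy yL; case: (hs n) => ab ev _; have [bb b01 _] := ab.
  have kK := eig_le ab ev; have [[hv _] _] := ev; have bv := prim_bm hv.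
  have k0 := subsol_ge0 L0 bb b01 (riccati_subsol ev.1).
  rewrite (proj2 hv)//; apply: ig_abs => //.
    by apply: (@bm_sub _ 0 L) => //; bm_tac.
  move=> t /andP[xt ty]; have ht : 0 <= t <= L by olra.
  have /andP[q1 q2] := b01 t ht; have := bnd n t ht; rewrite ler_norml => /andP[q3 q4].
  have q5 : (bkv n).2 t ^+ 2 <= V ^+ 2 by onra.
  have q6 := sqr_ge0 ((bkv n).2 t).
  rewrite ler_norml; move: kK; rewrite -/K => kK; olra.
have c0 : 0 <= K + h + V ^+ 2 by rewrite !addr_ge0 ?sqr_ge0// ltW.
have [v lv hv] := equilip_selection L0' c0 bnd lips.
have lv' : lip 0 L v by exists (K + h + V ^+ 2).
have bv := lip_bm lv'.
have mv : ig v 0 L = lam * L.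
  apply/eqP; rewrite -subr_eq0 -normr_le0; apply/ler_addgt0Pr => e e0.
  have [n _ he] := hv (e / L) 0%N (divr_gt0 e0 L0).
  case: (hs n) => ab [[hvn _] mvn] _; have bvn := prim_bm hvn.
  rewrite -mvn -igB// add0r; have -> : e = e / L * (L - 0) by field; rewrite gt_eqF.
  apply: ig_abs => //; first by bm_tac.
  by move=> t ht; rewrite distrC; exact: he.
have v0 : 0 < ig v 0 L by rewrite mv.
have [p [hp p0L [eta eta0 pe]]] := adjoint_exists L0' bv v0.
have bp := prim_bm hp.
have [|g [t [bg g01 gm hg]]] := @bathtub_exists _ 0 L p m h L0 bp h0.
  by rewrite m0 subr0.
have ag : adm g by [].
have [kt [vt et]] := adm_eig ag.
have [[hvt _] mvt] := et; have bvt := prim_bm hvt.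
pose P := ig p 0 L.
have P0 : 0 < P.
  have : ig (fun=> eta) 0 L <= P by apply: ig_le => //; exact: bm_cst.
  by rewrite ig_cst//; have := mulr_gt0 eta0 L0; olra.
pose W := ig (fun x => (vt x - v x) ^+ 2 * p x) 0 L.
(* The two errors [e * P] come from the eigenvalue gap of the [n]-th term and from its distance to
   [v], through [(vt + vn - 2 v) (vt - vn) = (vt - v) ^ 2 - (vn - v) ^ 2]. *)
have key e : 0 < e -> e <= 1 -> W <= (kt - ks) * P + 2 * e * P.
  move=> e0 e1; have [n Nn he] := hv e (Num.bound e^-1) e0.
  case: (hs n) => ab ev kn; have [bbn bn01 bnm] := ab.
  have := compare_formula bbn bg ev et bv hp p0L.
  have := bathtub_le L0' bp bbn bg bn01 _ hg; rewrite bnm gm => /(_ erefl).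
  have bvn : bm 0 L (bkv n).2 by have [[hvn _] _] := ev; exact: prim_bm hvn.
  have -> : ig (fun t => (vt t + (bkv n).2 t - 2 * v t) * (vt t - (bkv n).2 t) * p t) 0 L
    = W - ig (fun t => ((bkv n).2 t - v t) ^+ 2 * p t) 0 L.
    by rewrite /W -igB; try bm_tac; apply: ig_eq => x _; ring.
  have : ig (fun t => ((bkv n).2 t - v t) ^+ 2 * p t) 0 L <= e * P.
    rewrite /P -igZ//; apply: ig_le; try bm_tac.
    move=> x hx; have := he x hx; have := pe x hx; rewrite ler_norml => q1 /andP[q2 q3].
    rewrite ler_wpM2r//; first olra.
    onra.
  have ne : n.+1%:R^-1 <= e.
    rewrite invf_ple ?posrE// ltW//; apply: lt_le_trans (archi_boundP _) _.
      by rewrite invr_ge0 ltW.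
    by rewrite ler_nat ltnW.
  have : (kt - (bkv n).1.2) * P <= (kt - ks + e) * P.
    have ke : ks - e <= (bkv n).1.2 by apply: le_trans kn; rewrite lerD2l lerN2.
    by rewrite ler_pM2r// -addrA lerD2l; olra.
  rewrite -/P mulrDl; olra.
have W0 : W <= (kt - ks) * P.
  apply/ler_addgt0Pr => d d0.
  pose e := Num.min 1 (d / (2 * P)).
  have e0 : 0 < e by rewrite lt_min ltr01 divr_gt0// mulr_gt0.
  have e1 : e <= 1 by rewrite ge_min lexx.
  have : e * (2 * P) <= d by rewrite -ler_pdivlMr ?mulr_gt0// ge_min lexx orbT.
  have := key e e0 e1; olra.
have W0' : 0 <= W.
  by apply: ig_ge0 => x hx; rewrite mulr_ge0 ?sqr_ge0//; have := pe x hx; olra.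
have ktk : kt = ks.
  apply/eqP; rewrite eq_le (leS kt g vt)//=.
  by rewrite -subr_ge0 -(pmulr_lge0 _ P0); olra.
exists g, kt, vt; split=> // b' k' v' ab' ev'; rewrite ktk; exact: leS ev'.
Qed.

(** With the weight of [v] the second integral of the comparison is a weighted square, so maximality
    leaves it no room: [v' = v], then [k' = k] by the energy identity, and subtracting the two
    equations identifies the coefficients. *)
Lemma maximal_bathtub b k v p b' : maximal b k v ->
  prim 0 L p (fun t => 2 * v t * p t - 1) -> p 0 = p L ->
  (forall x, 0 <= x <= L -> 0 < p x) -> adm b' ->
  0 <= ig (fun t => (b' t - b t) * p t) 0 L ->
  forall x y, 0 <= x -> x <= y -> y <= L -> ig b' x y = ig b x y.
Proof.
move=> [ab ev mx] hp p0L pp ab' hb.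
have [bb b01 bm_] := ab; have [bb' b01' bm_'] := ab'.
have [k' [v' ev']] := adm_eig ab'.
have [[hv v0L] mv] := ev; have [[hv' v0L'] mv'] := ev'.
have bv := prim_bm hv; have bv' := prim_bm hv'; have bp := prim_bm hp.
have := compare_formula bb bb' ev ev' bv hp p0L.
have -> : ig (fun t => (v' t + v t - 2 * v t) * (v' t - v t) * p t) 0 L =
    ig (fun t => (v' t - v t) ^+ 2 * p t) 0 L by apply: ig_eq => t _; ring.
set W := ig (fun t => (v' t - v t) ^+ 2 * p t) 0 L => e.
have W0 : 0 <= W.
  by apply: ig_ge0 => x hx; rewrite mulr_ge0 ?sqr_ge0// ltW// pp.
have kk := mx _ _ _ ab' ev'.
have P0 : 0 <= ig p 0 L by apply: ig_ge0 => x hx; rewrite ltW// pp.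
have kP : (k' - k) * ig p 0 L <= 0 by rewrite mulr_le0_ge0//; olra.
have lw : lip 0 L (fun t => (v' t - v t) ^+ 2 * p t).
  have l1 := lipD (prim_lip hv') (lipN (prim_lip hv)).
  exact: lipM (lipM l1 l1) (prim_lip hp).
have W00 : W <= 0 by olra.
have vv x : 0 <= x <= L -> v' x = v x.
  move=> hx.
  have /eqP := @lip_ig_eq0 _ 0 L _ L0 lw (fun t ht =>
    mulr_ge0 (sqr_ge0 _) (ltW (pp t ht))) W00 x hx.
  by rewrite mulf_eq0 (gt_eqF (pp x hx)) orbF sqrf_eq0 subr_eq0 => /eqP.
have k'k : k' = k.
  have : (k' - k) * L = 0.
    have e1 := riccati_energy L0 bb ev.1; have e2 := riccati_energy L0 bb' ev'.1.
    have e3 : ig (fun t => v' t ^+ 2) 0 L = ig (fun t => v t ^+ 2) 0 L.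
      by apply: ig_eq => t ht; rewrite vv.
    by rewrite mulrBl e1 e2 e3 bm_ bm_' subrr.
  by move=> /eqP; rewrite mulf_eq0 (gt_eqF L0) orbF subr_eq0 => /eqP.
move=> x y x0 xy yL.
have sub f : bm 0 L f -> bm x y f by exact: bm_sub.
have := proj2 hv' x y x0 xy yL; rewrite !vv; try olra.
rewrite (proj2 hv)// k'k.
have -> : ig (fun t => k - b' t - v' t ^+ 2) x y = ig (fun t => k - b' t - v t ^+ 2) x y.
  by apply: ig_eq => t ht; rewrite vv//; olra.
rewrite !igB; try (apply: sub; bm_tac).
olra.
Qed.

End Maximum.

(** * Reflecting a maximiser between two points of equal height *)

Section Reflection.
Context {R : realType}.
Implicit Types (e r s t : R).
Notation mu := (@lebesgue_measure R).
Implicit Types (a b c d x y : R) (f g F G p v : R -> R).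

Lemma ig_eq_oo x y f g : bm x y f -> bm x y g ->
  (forall t, x < t < y -> f t = g t) -> ig f x y = ig g x y.
Proof.
move=> bf bg fg.
have oo u : bm x y u -> ig u x y = \int[mu]_(t in `]x, y[) u t.
  move=> /bm_integrable ie.
  rewrite /ig -Rintegral_itv_obnd_cbnd -?Rintegral_itv_bndo_bndc//.
  - apply: integrableS ie => // t /=; rewrite !in_itv/= => /andP[? ?].
    by apply/andP; olra.
  - apply: integrableS ie => // t /=; rewrite !in_itv/= => /andP[? ?].
    by apply/andP; olra.
by rewrite !oo//; apply: eq_Rintegral => t; rewrite inE/= in_itv/=; exact: fg.
Qed.

Lemma prim_ext_oo a b F f g : prim a b F f -> bm a b g ->
  (forall t, a < t < b -> f t = g t) -> prim a b F g.
Proof.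
move=> [bf hF] bg fg; split=> // x y ax xy yb; rewrite hF//.
apply: ig_eq_oo; [exact: bm_sub bf|exact: bm_sub bg|].
by move=> t ht; apply: fg; olra.
Qed.

Lemma bm_if a b c d f g : bm c d f -> bm a b g ->
  bm a b (fun t => if c <= t <= d then f t else g t).
Proof.
move=> bf bg; have [M M0 hM] := bm_ge0 bf.
have b1 : bm a b (f \_ `[c, d]).
  split; last first.
    exists M => t _; rewrite patchE; case: ifPn => [|_]; last by rewrite normr0.
    by rewrite inE/= in_itv/=; exact: hM.
  apply: measurable_funTS; apply/(measurable_restrictT f _) => //.
  exact: (proj1 bf).
have b2 : bm a b (\1_(`[c, d]%classic) : R -> R) by exact: bm_indic.
have := bmD b1 (bmM (bmB (bm_cst a b 1) b2) bg).
apply: bm_ext => t _; rewrite patchE indicE.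
have -> : (t \in `[c, d]%classic) = (c <= t <= d) by rewrite mem_setE in_itv.
by case: ifP => _ /=; rewrite ?subrr ?subr0 ?mul0r ?mul1r ?addr0 ?add0r.
Qed.

Lemma lip_inv a b p eta : 0 < eta -> lip a b p ->
  (forall x, a <= x <= b -> eta <= p x) -> lip a b (fun x => (p x)^-1).
Proof.
move=> e0 [K K0 hK] pe; exists (K / eta ^+ 2).
  by rewrite divr_ge0// sqr_ge0.
move=> x y ax xy yb; have px := pe x ltac:(olra). have py := pe y ltac:(olra).
have px0 : 0 < p x by olra. have py0 : 0 < p y by olra.
have -> : (p y)^-1 - (p x)^-1 = (p x - p y) / (p x * p y).
  by field; rewrite !gt_eqF.
rewrite normrM normfV (@gtr0_norm _ (p x * p y)) ?mulr_gt0// mulrAC.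
rewrite distrC ler_pM ?invr_ge0 ?mulr_ge0 ?(ltW px0) ?(ltW py0)//; first exact: hK.
by rewrite lef_pV2 ?posrE ?mulr_gt0 ?exprn_gt0// expr2 ler_pM// ltW.
Qed.

(** The product of [P] and [expR (- A)] has zero derivative. Logarithmic increments and reciprocals
    are both derived from this formula, without differentiating a logarithm or a quotient. *)
Lemma exp_log a b P q A : prim a b P q ->
  (forall x, a <= x <= b -> 0 < P x) -> prim a b A (fun t => q t / P t) ->
  forall x, a <= x <= b -> P x = P a * expR (A x - A a).
Proof.
move=> hP P0 hA x hx.
have /andP[ax xb] := hx.
have hE := primM (prim_exp (primN hA)) hP.
have := proj2 hE a x (lexx _) ax xb.
rewrite (@ig_eq _ a x _ (fun=> 0)); last first.
  move=> t ht; have Pt : 0 < P t by apply: P0; olra.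
  by field; rewrite gt_eqF.
rewrite ig_cst// mul0r !expRN expRD expRN => /eqP; rewrite subr_eq0 => /eqP.
have := expR_gt0 (A x); have := expR_gt0 (A a).
move: (expR (A x)) (expR (A a)) => ex ea ea0 ex0 e.
rewrite mulrA mulrAC [P a * _]mulrC -e mulrC mulrA divff ?mul1r//.
by rewrite gt_eqF.
Qed.

Lemma log_increment a b P q eta : a <= b -> prim a b P q -> 0 < eta ->
  (forall x, a <= x <= b -> eta <= P x) -> P a = P b ->
  ig (fun t => q t / P t) a b = 0.
Proof.
move=> ab hP e0 Pe Pab.
have P0 x : a <= x <= b -> 0 < P x by move=> /Pe; olra.
have bi := lip_bm (lip_inv e0 (prim_lip hP) Pe).
have [A hA A0] := prim_exists ab (bmM (proj1 hP) bi).
rewrite -(proj2 hA)// A0 subr0.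
have := exp_log hP P0 hA (x := b); rewrite lexx ab A0 subr0 => /(_ isT).
have Pa : 0 < P a by apply: P0; rewrite lexx.
rewrite -Pab -{1}[P a]mulr1 => /(mulfI (lt0r_neq0 Pa)) e.
by apply: expR_inj; rewrite expR0.
Qed.

Lemma prim_inv a b P q eta : a <= b -> prim a b P q -> 0 < eta ->
  (forall x, a <= x <= b -> eta <= P x) ->
  prim a b (fun t => (P t)^-1) (fun t => - q t / P t ^+ 2).
Proof.
move=> ab hP e0 Pe.
have P0 x : a <= x <= b -> 0 < P x by move=> /Pe; olra.
have bi := lip_bm (lip_inv e0 (prim_lip hP) Pe).
have [A hA A0] := prim_exists ab (bmM (proj1 hP) bi).
have Pa : 0 < P a by apply: P0; rewrite lexx.
have eP x : a <= x <= b -> (P a)^-1 * expR (- A x) = (P x)^-1.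
  move=> hx; rewrite (exp_log hP P0 hA hx) A0 subr0 expRN.
  by rewrite invfM.
apply: prim_ext (primZ (P a)^-1 (prim_exp (primN hA))) => x hx.
  exact: eP.
have Px := P0 x hx; rewrite mulrCA eP//.
by field; rewrite gt_eqF.
Qed.

(** The logarithmic derivative of [p] is [2 v - 1 / p]. Equal heights are thus exactly what gives
    [1 / p - v] the same integral as [v], so exchanging them on the interval preserves the
    prescribed mean. *)
Lemma adjoint_mean x y v p eta : x <= y -> bm x y v -> 0 < eta ->
  prim x y p (fun t => 2 * v t * p t - 1) ->
  (forall t, x <= t <= y -> eta <= p t) -> p x = p y ->
  ig (fun t => (p t)^-1) x y = 2 * ig v x y.
Proof.
move=> xy bv e0 hp pe pxy.
have bi := lip_bm (lip_inv e0 (prim_lip hp) pe).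
have := log_increment xy hp e0 pe pxy.
rewrite (@ig_eq _ x y _ (fun t => 2 * v t - (p t)^-1)); last first.
  move=> t ht; have pt : 0 < p t by have := pe t ht; olra.
  by field; rewrite gt_eqF.
rewrite igB ?igZ//; try bm_tac.
by olra.
Qed.

(* Reflect [b] on [x, y]. There the reflected [p] is the adjoint weight of
   [1 / p - v], so the change of eigenvalue is again an integral of squares;
   maximality makes them vanish, and continuity of the new Riccati solution at
   [x] gives [v x = 1 / p y - v y]. *)
Lemma maximal_reflect (L h m lam : R) (b : R -> R) k v p eta x y :
  0 < L -> 0 < h -> 0 < m -> m < h * L -> 0 < lam ->
  maximal L h m lam b k v ->
  prim 0 L p (fun t => 2 * v t * p t - 1) -> p 0 = p L -> 0 < eta ->
  (forall t, 0 <= t <= L -> eta <= p t) ->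
  0 <= x -> x < y -> y < L -> p x = p y ->
  (2 * v x * p x - 1) + (2 * v y * p y - 1) = 0.
Proof.
move=> L0 h0 m0 mh lam0 [ab ev mx] hp p0L e0 pe x0 xy yL pxy.
have [xy' yL' xL] : [/\ x <= y, y <= L & x <= L] by split; olra.
have L0' := ltW L0.
have y0 : 0 <= y by olra.
have [bb b01 bmm] := ab; have [[hv v0L] mv] := ev.
have bv := prim_bm hv; have bp := prim_bm hp.
pose r t := x + y - t.
pose b' t := if x <= t <= y then b (r t) else b t.
have bbB : bm x y b by exact: bm_sub bb.
have brB : bm x y (fun t => b (r t)).
  have := bm_reflect (x + y) bbB.
  have -> : x + y - y = x by ring.
  by have -> : x + y - x = y by ring.
have bb' : bm 0 L b' by exact: bm_if.
have igr f : bm x y f -> ig (fun t => f (r t)) x y = ig f x y.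
  move=> bf; have := ig_reflect (x + y) bf.
  have -> : x + y - y = x by ring.
  by have -> : x + y - x = y by ring.
have three f : bm 0 L f -> ig f 0 L = ig f 0 x + ig f x y + ig f y L.
  move=> bf; rewrite (ig_split x0 xL bf) (ig_split xy' yL') ?addrA//.
  exact: bm_sub bf.
have subA f : bm 0 L f -> bm 0 x f by exact: bm_sub.
have subB f : bm 0 L f -> bm x y f by exact: bm_sub.
have subC f : bm 0 L f -> bm y L f by exact: bm_sub.
have b'A t : 0 < t < x -> b' t = b t.
  by move=> ht; rewrite /b'; case: ifP => // hh; olra.
have b'C t : y < t < L -> b' t = b t.
  by move=> ht; rewrite /b'; case: ifP => // hh; olra.
have b'B t : x <= t <= y -> b' t = b (r t) by move=> ht; rewrite /b' ht.
have ab' : adm L h m b'.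
  split=> //.
    move=> t ht; rewrite /b'; case: ifP => [hh|_]; last exact: b01.
    by apply: b01; rewrite /r; olra.
  rewrite -bmm !three// (ig_eq b'B) igr//.
  rewrite (ig_eq_oo (subA _ bb') (subA _ bb) b'A).
  by rewrite (ig_eq_oo (subC _ bb') (subC _ bb) b'C).
have [k' [v' ev']] := adm_eig L0 lam0 ab'.
have kk := mx _ _ _ ab' ev'.
have [[hv' v0L'] mv'] := ev'; have bv' := prim_bm hv'.
have hA : prim 0 x v' (fun t => k' - b t - v' t ^+ 2).
  apply: (prim_ext_oo (prim_sub (lexx 0) xL hv')).
    by apply: subA; bm_tac.
  by move=> t ht; rewrite b'A.
have hC : prim y L v' (fun t => k' - b t - v' t ^+ 2).
  apply: (prim_ext_oo (prim_sub y0 (lexx L) hv')).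
    by apply: subC; bm_tac.
  by move=> t ht; rewrite b'C.
pose u t := v' (r t).
have hB : prim x y u (fun t => - (k' - b t - u t ^+ 2)).
  have := prim_reflect (prim_sub x0 yL' hv').
  apply: prim_ext => // t ht; rewrite b'B; last by rewrite -/(r t) /r; olra.
  by rewrite -/(r t) /u; congr (- (_ - b _ - _)); rewrite /r; ring.
have bu := prim_bm hB.
have bi : bm 0 L (fun t => (p t)^-1) := lip_bm (lip_inv e0 (prim_lip hp) pe).
have mi : ig (fun t => (p t)^-1) x y = 2 * ig v x y.
  apply: (adjoint_mean xy' (subB _ bv) e0 (prim_sub x0 yL' hp)) => //.
  by move=> t ht; apply: pe; olra.
pose w t := v' t - v t.
have hw a c : 0 <= a -> c <= L -> prim a c v' (fun t => k' - b t - v' t ^+ 2) ->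
    prim a c (fun t => w t * p t)
      (fun t => (k' - k) * p t - w t ^+ 2 * p t - w t).
  move=> a0 cL hv2.
  have := primM (primB hv2 (prim_sub a0 cL hv)) (prim_sub a0 cL hp).
  by apply: prim_ext => // t _; rewrite /w; ring.
have hz : prim x y (fun t => p t * (u t + v t))
    (fun t => (k - k') * p t + (p t * (u t + v t) ^+ 2 - (u t + v t))).
  have := primM (prim_sub x0 yL' hp) (primD hB (prim_sub x0 yL' hv)).
  by apply: prim_ext => // t _; ring.
(* This is [p] times the square of [u - (1 / p - v)], expanded so that its integral splits into
   known terms. *)
pose w' t := p t * (u t + v t) ^+ 2 - 2 * (u t + v t) + (p t)^-1.
have bw : bm 0 L w by rewrite /w; bm_tac.
have bpB := subB _ bp; have bvB := subB _ bv; have biB := subB _ bi.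
have bw' : bm x y w' by rewrite /w'; bm_tac.
have eA := proj2 (hw 0 x (lexx _) xL hA) 0 x (lexx _) x0 (lexx _).
have eC := proj2 (hw y L y0 (lexx _) hC) y L (lexx _) yL' (lexx _).
have eB := proj2 hz x y (lexx _) xy' (lexx _).
have i1 a c : (forall f, bm 0 L f -> bm a c f) ->
    ig (fun t => (k' - k) * p t - w t ^+ 2 * p t - w t) a c =
    (k' - k) * ig p a c - ig (fun t => w t ^+ 2 * p t) a c - (ig v' a c - ig v a c).
  move=> s; rewrite igB ?igB ?igZ//; try (apply: s; bm_tac).
have i2 : ig (fun t => (k - k') * p t + (p t * (u t + v t) ^+ 2 - (u t + v t))) x y =
    (k - k') * ig p x y + ig w' x y + ig v' x y - ig v x y.
  have -> : ig v' x y = ig u x y by rewrite igr//; exact: subB.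
  have -> : ig (fun t => (k - k') * p t + (p t * (u t + v t) ^+ 2 - (u t + v t))) x y =
     ig (fun t => (k - k') * p t + w' t + ((u t + v t) - (p t)^-1)) x y.
    by apply: ig_eq => t _; rewrite /w'; ring.
  rewrite igD ?igB ?igD ?igZ ?mi//; try bm_tac.
  ring.
rewrite i1// in eA; rewrite i1// in eC; rewrite i2 in eB.
have ux : u x = v' y by rewrite /u /r; congr v'; ring.
have uy : u y = v' x by rewrite /u /r; congr v'; ring.
have mm : ig v' 0 L = ig v 0 L by rewrite mv mv'.
rewrite !three// in mm.
have total : (k' - k) * ig p 0 L = ig (fun t => w t ^+ 2 * p t) 0 x +
    ig (fun t => w t ^+ 2 * p t) y L + ig w' x y.
  rewrite three//.
  (* The contributions of [x] and [y] cancel because [p x = p y] and [u] swaps the values of [v']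
     there; those of 0 and [L] cancel by periodicity. *)
  have bdry : w x * p x - w 0 * p 0 + (w L * p L - w y * p y)
    - (p y * (u y + v y) - p x * (u x + v x)) = 0.
    by rewrite /w v0L v0L' p0L ux uy pxy; ring.
  rewrite eA eC eB in bdry; move: bdry mm.
  move: (ig p 0 x) (ig p x y) (ig p y L) (ig v 0 x) (ig v x y) (ig v y L).
  move: (ig v' 0 x) (ig v' x y) (ig v' y L) (ig w' x y).
  move: (ig (fun t => w t ^+ 2 * p t) 0 x) (ig (fun t => w t ^+ 2 * p t) y L).
  by clear=> *; olra.
clear eA eC eB i1 i2 mm mi bmm mv mv'.
have pp t : 0 <= t <= L -> 0 < p t by move=> /pe; olra.
have P0 : 0 <= ig p 0 L by apply: ig_ge0 => t ht; rewrite ltW// pp.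
have kP : (k' - k) * ig p 0 L <= 0 by rewrite mulr_le0_ge0//; olra.
have w2 t : 0 <= t <= L -> 0 <= w t ^+ 2 * p t.
  by move=> ht; rewrite mulr_ge0 ?sqr_ge0// ltW// pp.
have w'E t : 0 <= t <= L -> w' t = p t * (u t + v t - (p t)^-1) ^+ 2.
  by move=> /pp pt; rewrite /w'; field; rewrite gt_eqF.
have w'0 t : x <= t <= y -> 0 <= w' t.
  have ht' : x <= t <= y -> 0 <= t <= L by move=> ?; olra.
  by move=> /ht' ht; rewrite w'E// mulr_ge0 ?sqr_ge0// ltW// pp.
have IA : 0 <= ig (fun t => w t ^+ 2 * p t) 0 x.
  by apply: ig_ge0 => t ht; apply: w2; olra.
have IC : 0 <= ig (fun t => w t ^+ 2 * p t) y L.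
  by apply: ig_ge0 => t ht; apply: w2; olra.
have IB : 0 <= ig w' x y by apply: ig_ge0.
have IC0 : ig (fun t => w t ^+ 2 * p t) y L <= 0 by olra.
have IB0 : ig w' x y <= 0 by olra.
clear total IA IC IB kP P0.
have lw : lip 0 L w := lipD (prim_lip hv') (lipN (prim_lip hv)).
have lC : lip y L (fun t => w t ^+ 2 * p t).
  exact: (lip_sub y0 (lexx L) (lipM (lipM lw lw) (prim_lip hp))).
have lB : lip x y w'.
  have l1 := lipD (prim_lip hB) (lip_sub x0 yL' (prim_lip hv)).
  have lp := lip_sub x0 yL' (prim_lip hp).
  have li := lip_sub x0 yL' (lip_inv e0 (prim_lip hp) pe).
  exact: lipD (lipD (lipM lp (lipM l1 l1)) (lipN (lipM (lip_cst x y 2) l1))) li.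
(* The two pieces meet at the value [v' y]: the piece on [[y, L]], nondegenerate since [y < L],
   makes it [v y], and the reflected piece, read at [x], makes it [1 / p x - v x]. *)
have wy : w y = 0.
  have /eqP := lip_ig_eq0 yL lC (fun t ht => w2 t ltac:(olra)) IC0 (t := y) ltac:(olra).
  by rewrite mulf_eq0 (gt_eqF (pp y _)) ?orbF ?sqrf_eq0; [move/eqP|olra].
have w'x : u x + v x - (p x)^-1 = 0.
  have /eqP := lip_ig_eq0 xy lB w'0 IB0 (t := x) ltac:(olra).
  rewrite w'E; last by olra.
  by rewrite mulf_eq0 (gt_eqF (pp x _)) /= ?sqrf_eq0; [move/eqP|olra].
have vy : v' y = v y by move: wy; rewrite /w; olra.
rewrite ux vy in w'x.
have px0 : p x != 0 by rewrite gt_eqF// pp//; olra.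
have : (v y + v x) * p x = 1.
  have -> : v y + v x = (p x)^-1 by olra.
  by rewrite mulVf.
rewrite -pxy; olra.
Qed.

End Reflection.

(** * Periodic extension and rotation of the period *)

Section Periodic.
Context {R : realType}.
Implicit Types (e r s t : R).
Implicit Types (a b c d x y : R) (f g F G p v : R -> R).

Lemma bm_glue a c b f : a <= c -> c <= b -> bm a c f -> bm c b f -> bm a b f.
Proof.
move=> ac cb [mf [M hM]] [mg [N hN]]; split.
  have -> : `[a, b]%classic = `[a, c]%classic `|` `[c, b]%classic.
    apply/seteqP; split=> t /=; rewrite !in_itv/=.
      by move=> /andP[at_ tb]; have [h|h] := leP t c; [left|right]; apply/andP; olra.
    by case=> /andP[h1 h2]; apply/andP; olra.
  by apply/measurable_funU.
exists (`|M| + `|N|) => x /andP[ax xb]; have [xc|cx] := leP x c.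
  have h : `|f x| <= M by apply: hM; olra.
  have := normr_ge0 N; have := ler_norm M; olra.
have h : `|f x| <= N by apply: hN; olra.
have := normr_ge0 M; have := ler_norm N; olra.
Qed.

Lemma prim_glue a c b F f : a <= c -> c <= b ->
  prim a c F f -> prim c b F f -> prim a b F f.
Proof.
move=> ac cb [bf hF] [bg hG]; have bfg := bm_glue ac cb bf bg.
split=> // x y ax xy yb.
have [yc|cy] := leP y c; first exact: hF.
have [cx|xc] := leP c x; first exact: hG.
have h1 := hF x c ax (ltW xc) (lexx c).
have h2 := hG c y (lexx c) (ltW cy) yb.
rewrite (@ig_split _ x c y) ?(ltW xc) ?(ltW cy)//; first by olra.
exact: bm_sub bfg.
Qed.

Lemma prim_shift c a b F f : prim (a + c) (b + c) F f ->
  prim a b (fun t => F (t + c)) (fun t => f (t + c)).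
Proof.
move=> [bf hF]; split; first exact: bm_shift.
move=> x y ax xy yb; rewrite hF ?lerD2r// ig_shift//.
by apply: bm_sub bf; rewrite lerD2r.
Qed.

Variables (L : R) (L0 : 0 < L).

(** Only the values of [f] on the half-open period are used; at [L] the extension takes the value
    [f 0]. *)
Definition per f x := f (x - L * (Num.floor (x / L))%:~R).

Lemma per_eq f x (k : int) : L * k%:~R <= x < L * (k + 1)%:~R ->
  per f x = f (x - L * k%:~R).
Proof.
move=> /andP[h1 h2]; rewrite /per (@floor_def _ _ k)//.
by rewrite ler_pdivlMr// ltr_pdivrMr// !(mulrC _ L) h1.
Qed.

Lemma per_id f x : 0 <= x -> x < L -> per f x = f x.
Proof.
move=> x0 xL; rewrite (@per_eq _ _ 0); first by rewrite mulr0 subr0.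
by rewrite mulr0 x0 add0r mulr1.
Qed.

Lemma per_range x : 0 <= x - L * (Num.floor (x / L))%:~R < L.
Proof.
have /andP := floor_itv (x / L).
rewrite ler_pdivlMr// ltr_pdivrMr// intrD mulr1z => -[h1 h2].
by apply/andP; olra.
Qed.

Lemma per_periodic f x : per f (x + L) = per f x.
Proof.
have := per_range x; set k := Num.floor _ => h.
rewrite (@per_eq _ _ (k + 1)) ?/per -/k; last first.
  by rewrite !intrD !mulr1z; olra.
by congr f; rewrite intrD mulr1z; ring.
Qed.

Lemma per_closed F x : F 0 = F L -> 0 <= x <= L -> per F x = F x.
Proof.
move=> F0L /andP[x0]; rewrite le_eqVlt => /orP[/eqP->|xL]; last exact: per_id.
by rewrite -[L]add0r per_periodic per_id// add0r.
Qed.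

Lemma periodicN g x : (forall x, g (x + L) = g x) -> g (x - L) = g x.
Proof. by move=> h; rewrite -[in RHS](subrK L x) h. Qed.

Lemma prim_per F f : prim 0 L F f -> F 0 = F L -> forall a b,
  prim a b (per F) (per f).
Proof.
move=> hF F0L a b.
have base : prim 0 L (per F) (per f).
  have b1 : bm 0 L (per f).
    have := bm_if (bm_cst L L (per f L)) (proj1 hF).
    apply: bm_ext => t /andP[t0 tL]; have [Lt|Lt] := leP L t.
      by rewrite tL /=; congr per; olra.
    by rewrite /= per_id.
  apply: (prim_ext_oo (f := f)) => //.
    by apply: prim_ext hF => // t ht; rewrite per_closed.
  by move=> t ht; rewrite per_id//; olra.
have up c d : prim c d (per F) (per f) -> prim (c + L) (d + L) (per F) (per f).
  move=> h; have := @prim_shift (- L) (c + L) (d + L) (per F) (per f).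
  rewrite !addrK => /(_ h); apply: prim_ext => t _;
  by apply: periodicN => x; exact: per_periodic.
have dn c d : prim c d (per F) (per f) -> prim (c - L) (d - L) (per F) (per f).
  move=> h; have := @prim_shift L (c - L) (d - L) (per F) (per f).
  by rewrite !subrK => /(_ h); apply: prim_ext => t _; exact: per_periodic.
(* Each induction step glues on shifted copies that add one period at either end. *)
have big (n : nat) : prim (- (L * n%:R)) (L * n%:R + L) (per F) (per f).
  elim: n => [|n IH]; first by rewrite mulr0 oppr0 add0r.
  have nL : 0 <= L * n%:R by rewrite mulr_ge0// ltW.
  have L1 := L0.
  have e1 : - (L * n.+1%:R) = - (L * n%:R) - L by rewrite -natr1; ring.
  have e2 : L * n.+1%:R + L = L * n%:R + L + L by rewrite -natr1; ring.
  apply: (@prim_glue _ (- (L * n%:R))).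
  - by rewrite e1; olra.
  - by rewrite e2; olra.
  - by rewrite e1; apply: prim_sub (dn _ _ IH); olra.
  - apply: (@prim_glue _ (L * n%:R + L)); [olra | rewrite e2; olra | exact: IH|].
    by rewrite e2; apply: prim_sub (up _ _ IH); olra.
pose n := Num.bound ((`|a| + `|b|) / L).
have hn : `|a| + `|b| <= L * n%:R.
  have := archi_boundP (divr_ge0 (addr_ge0 (normr_ge0 a) (normr_ge0 b)) (ltW L0)).
  by rewrite -/n ltr_pdivrMr// mulrC => /ltW.
apply: prim_sub (big n).
  by have := normr_ge0 b; have := ler_norm (- a); rewrite normrN; olra.
by have := L0; have := normr_ge0 a; have := ler_norm b; olra.
Qed.

(** Subtracting the mean [c] makes the primitive periodic, so the statement about primitives applies
    and brings measurability with it. *)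
Lemma bm_per f a b : bm 0 L f -> bm a b (per f).
Proof.
move=> bf; have [F hF F0] := prim_exists (ltW L0) bf.
pose c := F L / L.
have h := primB hF (primZ c (prim_id 0 L)).
have := prim_per h _ a b; rewrite /= F0 mulr0 subr0 /c divfK ?gt_eqF// subrr.
move=> /(_ erefl) [bg _].
have := bmD bg (bm_cst a b c); apply: bm_ext => t _.
by rewrite /per /c mulr1 subrK.
Qed.

Lemma ig_per f x : bm 0 L f -> ig (per f) x (x + L) = ig f 0 L.
Proof.
move=> bf; have [F hF F0] := prim_exists (ltW L0) bf.
pose c := F L / L.
have h := primB hF (primZ c (prim_id 0 L)).
have := prim_per h _ x (x + L); rewrite /= F0 mulr0 subr0 /c divfK ?gt_eqF// subrr.
have xL : x <= x + L by rewrite lerDl ltW.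
move=> /(_ erefl) [_ /(_ x (x + L) (lexx _) xL (lexx _))].
rewrite per_periodic subrr -/c.
have -> : per (fun t => f t - c * 1) = (fun t => per f t - c).
  by apply/funext => t; rewrite /per mulr1.
rewrite igB; [|exact: bm_per|exact: bm_cst].
have := proj2 hF 0 L (lexx _) (ltW L0) (lexx _); rewrite F0 subr0 => <-.
rewrite ig_cst// /c addrAC subrr add0r divfK ?gt_eqF// => /eqP.
by rewrite eq_sym subr_eq0 => /eqP.
Qed.

Lemma eig_rotate (lam : R) (b : R -> R) k v x0 :
  eig L lam b k v ->
  eig L lam (fun t => per b (t + x0)) k (fun t => per v (t + x0)).
Proof.
move=> [[hv v0L] mv].
have per0 f : per f (0 + x0) = per f (L + x0).
  by rewrite (addrC L) per_periodic add0r.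
split; [split=> //|].
- have := prim_shift (prim_per hv v0L (0 + x0) (L + x0)).
  by apply: prim_ext.
- rewrite ig_shift ?add0r; last by apply: bm_per; exact: prim_bm hv.
  by rewrite addrC ig_per//; exact: prim_bm hv.
Qed.

(** Rotation makes it possible to start the period at a minimum of [p], as the absence of interior
    dips requires. *)
Lemma maximal_rotate (h m lam : R) (b : R -> R) k v p x0 :
  maximal L h m lam b k v ->
  prim 0 L p (fun t => 2 * v t * p t - 1) -> p 0 = p L ->
  let rot f := fun t => per f (t + x0) in
  [/\ maximal L h m lam (rot b) k (rot v),
      prim 0 L (rot p) (fun t => 2 * rot v t * rot p t - 1) &
      rot p 0 = rot p L].
Proof.
move=> [[bb b01 bm_] ev mx] hp p0L /=.
split; [split=> //; [split|exact: eig_rotate]|..].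
- by apply: bm_shift; exact: bm_per.
- by move=> t _; apply: b01; have := per_range (t + x0); olra.
- by rewrite ig_shift ?add0r; [rewrite addrC ig_per|exact: bm_per].
- have := prim_shift (prim_per hp p0L (0 + x0) (L + x0)).
  by apply: prim_ext.
- by rewrite (addrC L) per_periodic add0r.
Qed.

End Periodic.

(** * The adjoint weight has no interior dip *)

Section Quasiconcavity.
Context {R : realType}.
Implicit Types (e r s t : R).
Notation mu := (@lebesgue_measure R).
Implicit Types (a b c d x y : R) (p dp : R -> R).

Lemma lip_IVT a b f (s : R) : a <= b -> lip a b f ->
  (f a <= s <= f b) || (f b <= s <= f a) -> exists2 c, a <= c <= b & f c = s.
Proof.
move=> ab lf hs; have [|c] := IVT (v := s) ab (lip_continuous lf).
  case/orP: hs => /andP[h1 h2]; rewrite ge_min le_max ?h1 ?h2 ?orbT//.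
by rewrite in_itv/=; exists c.
Qed.

Lemma clip_lipschitz (lo hi x y : R) :
  `|Num.max lo (Num.min y hi) - Num.max lo (Num.min x hi)| <= `|y - x|.
Proof.
have hmax (c u w : R) : `|Num.max c w - Num.max c u| <= `|w - u|.
  have [?|?] := ger0P (w - u); rewrite ler_norml;
  by have [?|?] := leP c w; have [?|?] := leP c u; olra.
have hmin (c u w : R) : `|Num.min w c - Num.min u c| <= `|w - u|.
  have [?|?] := ger0P (w - u); rewrite ler_norml;
  by have [?|?] := leP w c; have [?|?] := leP u c; olra.
exact: le_trans (hmax _ _ _) (hmin _ _ _).
Qed.

(* Clipped to [s0, s1], [p] varies quadratically, hence is constant. *)
Lemma stationary_range a c (s0 s1 : R) p dp : a <= c -> prim a c p dp ->
  lip a c dp -> (forall t, a <= t <= c -> s0 < p t < s1 -> dp t = 0) ->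
  s1 <= p a -> p c <= s0 -> s1 <= s0.
Proof.
move=> ac hp ldp stat s1a cs0; rewrite leNgt; apply/negP => s01.
have lp := prim_lip hp; have [K K0 hK] := ldp; have bdp := lip_bm ldp.
have flat x y : a <= x -> x <= y -> y <= c ->
    (exists2 t, x <= t <= y & s0 < p t < s1) ->
    `|p y - p x| <= K * (y - x) ^+ 2.
  move=> ax xy yc [t /andP[xt ty] pt].
  have at_ := le_trans ax xt; have tc := le_trans ty yc.
  have t0 : dp t = 0 by apply: stat => //; rewrite at_.
  rewrite (proj2 hp)// expr2 mulrA; apply: ig_abs => //.
    exact: bm_sub bdp.
  move=> r /andP[xr ry]; have ar := le_trans ax xr; have rc := le_trans ry yc.
  case/orP: (le_total r t) => rt.
    have := hK r t ar rt tc; rewrite t0 sub0r normrN => h.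
    by apply: le_trans h _; rewrite ler_wpM2l// lerB.
  have := hK t r at_ rt rc; rewrite t0 subr0 => h.
  by apply: le_trans h _; rewrite ler_wpM2l// lerB.
have [q [qlip qlo qhi]] : exists q : R -> R,
    [/\ forall x y, `|q y - q x| <= `|p y - p x|,
        forall t, p t <= s0 -> q t = s0 & forall t, s1 <= p t -> q t = s1].
  exists (fun t => Num.max s0 (Num.min (p t) s1)); split.
  - by move=> x y; exact: clip_lipschitz.
  - by move=> t h; rewrite max_l// (le_trans _ h)// ge_min lexx.
  - by move=> t h; rewrite min_r// max_r// ltW.
have qquad x y : a <= x -> x <= y -> y <= c -> `|q y - q x| <= K * (y - x) ^+ 2.
  move=> ax xy yc.
  have [ex|nex] := pselect (exists2 t, x <= t <= y & s0 < p t < s1).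
    by apply: le_trans (qlip x y) _; exact: flat.
  have out t : x <= t <= y -> p t <= s0 \/ s1 <= p t.
    move=> ht; have [h1|] := boolP (p t <= s0); first by left.
    rewrite -ltNge => h1; have [h2|] := boolP (s1 <= p t); first by right.
    by rewrite -ltNge => h2; exfalso; apply: nex; exists t => //; rewrite h1 h2.
  (* Passing from one side of the band to the other would cross its midpoint, so on an interval that
     avoids the band the clipped function is constant. *)
  have mid : ~ ((p x <= s0 /\ s1 <= p y) \/ (s1 <= p x /\ p y <= s0)).
    move=> hxy; have [||t ht pt] := @lip_IVT x y p ((s0 + s1) / 2) xy.
    - exact: lip_sub lp.
    - by apply/orP; case: hxy => -[h1 h2]; [left|right]; clear -s01 h1 h2; olra.
    by apply: nex; exists t => //; rewrite pt; clear -s01; olra.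
  have -> : q y = q x.
    have hx : p x <= s0 \/ s1 <= p x by apply: out; rewrite lexx.
    have hy : p y <= s0 \/ s1 <= p y by apply: out; rewrite xy lexx.
    case: hx hy => hx [] hy.
    - by rewrite !qlo.
    - by exfalso; apply: mid; left.
    - by exfalso; apply: mid; right.
    - by rewrite !qhi.
  by rewrite subrr normr0 mulr_ge0// sqr_ge0.
have [_ hq] : prim a c q (fun=> 0).
  apply: (@quad_prim _ _ _ _ _ K); first exact: bm_cst.
  by move=> x y ax xy yc; rewrite ig_cst// mul0r subr0; exact: qquad.
have := hq a c (lexx _) ac (lexx _); rewrite ig_cst// mul0r.
rewrite (qhi a s1a) (qlo c cs0) => /eqP; rewrite subr_eq0 => /eqP s0E.
by rewrite s0E ltxx in s01.
Qed.

(* Three points on a common level have pairwise opposite slopes, so [p] is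
   stationary there; a dip of [p] would contain an interval of such levels. *)
Lemma quasiconcave (L : R) p dp : 0 < L -> prim 0 L p dp -> lip 0 L dp ->
  (forall x y, 0 <= x -> x < y -> y < L -> p x = p y -> dp x + dp y = 0) ->
  p 0 = p L -> (forall t, 0 <= t <= L -> p 0 <= p t) ->
  forall a c d, 0 <= a -> a <= c -> c <= d -> d <= L ->
    p a <= p c \/ p d <= p c.
Proof.
move=> L0 hp ldp opp p0L pmin a c d a0 ac cd dL.
have [//|pca] := leP (p a) (p c); first by left.
have [//|pcd] := leP (p d) (p c); first by right.
exfalso; have lp := prim_lip hp.
have cL : c <= L by olra.
have c0 : 0 <= c by olra.
have p0c := pmin c ltac:(olra).
have [s1 [s1a s1d cs1]] : exists s1 : R, [/\ s1 <= p a, s1 <= p d & p c < s1].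
  by exists (Num.min (p a) (p d)); rewrite !ge_min !lexx orbT lt_min pca pcd.
have stat t : a <= t <= c -> p c < p t < s1 -> dp t = 0.
  move=> /andP[at_ tc] /andP[ct ts].
  (* Two further points at the height of [t]: one on the way up from the minimum at 0 to [a], one on
     the way up from the dip at [c] to [d]. Three slopes that are pairwise opposite all vanish. *)
  have [||x hx px] := @lip_IVT 0 a p (p t) a0.
  - by apply: lip_sub lp; olra.
  - by apply/orP; left; olra.
  have [||y hy py] := @lip_IVT c d p (p t) cd.
  - by apply: lip_sub lp; olra.
  - by apply/orP; left; olra.
  have xa : x != a by apply/eqP => e; move: px; rewrite e; olra.
  have yc : y != c by apply/eqP => e; move: py; rewrite e; olra.
  have yd : y != d by apply/eqP => e; move: py; rewrite e; olra.
  have xa' : x < a by rewrite lt_neqAle xa; olra.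
  have yd' : y < d by rewrite lt_neqAle yd; olra.
  have yc' : c < y by rewrite lt_neqAle eq_sym yc; olra.
  have h1 := opp x t ltac:(olra) ltac:(olra) ltac:(olra) px.
  have h2 := opp t y ltac:(olra) ltac:(olra) ltac:(olra) (esym py).
  have h3 := opp x y ltac:(olra) ltac:(olra) ltac:(olra) (etrans px (esym py)).
  olra.
have : s1 <= p c.
  apply: (stationary_range ac _ _ stat s1a (lexx _)).
    exact: prim_sub hp.
  exact: lip_sub ldp.
by rewrite leNgt cs1.
Qed.

End Quasiconcavity.

(** * Superlevel sets as intervals and the shape of a maximiser *)

Section Window.
Context {R : realType}.
Implicit Types (e r s t : R).
Notation mu := (@lebesgue_measure R).
Implicit Types (a b c d x y : R) (p dp : R -> R).

Lemma ig_indic_itv a b x y : a <= x -> x <= y -> y <= b ->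
  ig (\1_(`[x, y]%classic) : R -> R) a b = y - x.
Proof.
move=> ax xy yb; apply: EFin_inj; rewrite ig_indic// -mu_itv_cc//.
congr mu; apply/seteqP; split=> t /=; rewrite !in_itv/=; first by case.
by move=> /andP[xt ty]; split; apply/andP; olra.
Qed.

Lemma lip_inf (L t : R) p (S : set R) : lip 0 L p -> S !=set0 ->
  (forall x, S x -> 0 <= x <= L) -> (forall x, S x -> t <= p x) ->
  t <= p (inf S).
Proof.
move=> [K K0 hK] S0 S01 tp; apply/ler_addgt0Pr => e e0.
have infS : has_inf S by split=> //; exists 0 => x /S01/andP[].
have i0 : 0 <= inf S by apply: lb_le_inf => // x /S01/andP[].
have K1 : 0 < K + 1 by rewrite ltr_wpDl.
have [x Sx xi] := inf_adherent (divr_gt0 e0 K1) infS.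
have ix : inf S <= x by apply: ge_inf => //; case: infS.
have /andP[_ xL] := S01 x Sx.
have := hK _ _ i0 ix xL; rewrite ler_norml => /andP[_ h].
apply: le_trans (tp x Sx) _; rewrite -lerBlDl; apply: le_trans h _.
apply: le_trans (_ : (K + 1) * (e / (K + 1)) <= e); last first.
  by rewrite mulrC divfK ?gt_eqF.
apply: ler_pM; rewrite ?subr_ge0 ?lerDl//.
by rewrite lerBlDl ltW.
Qed.

Lemma lip_sup (L t : R) p (S : set R) : lip 0 L p -> S !=set0 ->
  (forall x, S x -> 0 <= x <= L) -> (forall x, S x -> t <= p x) ->
  t <= p (sup S).
Proof.
move=> [K K0 hK] S0 S01 tp; apply/ler_addgt0Pr => e e0.
have supS : has_sup S by split=> //; exists L => x /S01/andP[].
have sL : sup S <= L by apply: ge_sup => // x /S01/andP[].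
have K1 : 0 < K + 1 by rewrite ltr_wpDl.
have [x Sx xs] := sup_adherent (divr_gt0 e0 K1) supS.
have sx : x <= sup S by apply: ub_le_sup => //; case: supS.
have /andP[x0 _] := S01 x Sx.
have := hK _ _ x0 sx sL; rewrite distrC ler_norml => /andP[_ h].
apply: le_trans (tp x Sx) _; rewrite -lerBlDl; apply: le_trans h _.
apply: le_trans (_ : (K + 1) * (e / (K + 1)) <= e); last first.
  by rewrite mulrC divfK ?gt_eqF.
apply: ler_pM; rewrite ?subr_ge0 ?lerDl//.
by rewrite lerBlDl -lerBlDr ltW.
Qed.

(* The window is wedged between the open and the closed superlevel set of a
   quantile of [p]. *)
Lemma window (L l : R) p : 0 < l -> l < L -> lip 0 L p ->
  (forall a c d, 0 <= a -> a <= c -> c <= d -> d <= L ->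
    p a <= p c \/ p d <= p c) ->
  exists a t, [/\ 0 <= a, a + l <= L &
    forall x, 0 <= x <= L ->
      (t < p x -> a <= x <= a + l) /\ (a <= x <= a + l -> t <= p x)].
Proof.
move=> l0 lL lp qc; have L0 : 0 < L by olra.
have bp := lip_bm lp.
have [|t /andP[]] := level_exists (c := l) L0 bp; first by rewrite subr0 l0.
set A := _ `&` [set x | t < p x]; set B := _ `&` [set x | t <= p x].
have mA : measurable A by exact: bm_gt_measurable.
have mB : measurable B by exact: bm_ge_measurable.
move=> hA hB.
have AB x : A x -> B x by move=> [h /= /ltW].
have A01 x : B x -> 0 <= x <= L by move=> [/=]; rewrite in_itv.
have [B0|/set0P/negP/negPn/eqP B0] := pselect (B !=set0); last first.
  move: hB; rewrite B0 (@ig_eq _ 0 L _ (fun=> 0)).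
    by rewrite ig_cst ?(ltW L0)// mul0r; olra.
  by move=> x _; rewrite indicE in_set0.
have supB : has_sup B by split=> //; exists L => x /A01; olra.
have infB : has_inf B by split=> //; exists 0 => x /A01; olra.
pose a2 := inf B; pose b2 := sup B.
have a2P x : B x -> a2 <= x by apply: ge_inf; case: infB.
have b2P x : B x -> x <= b2 by move=> Bx; apply: ub_le_sup => //; case: supB.
have a20 : 0 <= a2 by apply: lb_le_inf => // x /A01; olra.
have b2L : b2 <= L by apply: ge_sup => // x /A01; olra.
have ab2 : a2 <= b2 by case: B0 => x Bx; exact: le_trans (a2P _ Bx) (b2P _ Bx).
have pa2 : t <= p a2 by apply: (lip_inf lp) => // x Bx; have [_ /=] := Bx.
have pb2 : t <= p b2 by apply: (lip_sup lp) => // x Bx; have [_ /=] := Bx.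
clearbody a2 b2.
(* Absence of dips makes the closed superlevel set the full interval between its extreme points;
   [inA] gives the analogue for the interior of the open one. *)
have inB x : a2 <= x <= b2 -> t <= p x.
  move=> /andP[h1 h2]; have := qc a2 x b2 a20 h1 h2 b2L; case; olra.
have lB : l <= b2 - a2.
  apply: le_trans hB _; rewrite -(ig_indic_itv a20 ab2 b2L).
  apply: ig_le; try exact: bm_indic.
  move=> x _; rewrite !indicE ler_nat; case: (boolP (x \in B)) => //.
  by rewrite inE => Bx; rewrite mem_set//= in_itv/= a2P//= b2P.
have [A0|/set0P/negP/negPn/eqP A0] := pselect (A !=set0); last first.
  exists a2, t; split=> //; first olra.
  move=> x hx; split; last by move=> h; apply: inB; olra.
  move=> tx; suff : A x by rewrite A0.
  by split=> //=; rewrite in_itv.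
have supA : has_sup A by split=> //; exists L => x /AB/A01; olra.
have infA : has_inf A by split=> //; exists 0 => x /AB/A01; olra.
pose a1 := inf A; pose b1' := sup A.
have a1P x : A x -> a1 <= x by apply: ge_inf; case: infA.
have b1P x : A x -> x <= b1' by move=> Ax; apply: ub_le_sup => //; case: supA.
have a10 : 0 <= a1 by apply: lb_le_inf => // x /AB/A01; olra.
have b1L : b1' <= L by apply: ge_sup => // x /AB/A01; olra.
have a1A e (e0 : 0 < e) := inf_adherent e0 infA; rewrite -/a1 in a1A.
have b1A e (e0 : 0 < e) := sup_adherent e0 supA; rewrite -/b1' in b1A.
have ab1 : a1 <= b1' by case: A0 => x Ax; exact: le_trans (a1P _ Ax) (b1P _ Ax).
have a21 : a2 <= a1 by apply: lb_le_inf => // x /AB; exact: a2P.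
have b21 : b1' <= b2 by apply: ge_sup => // x /AB; exact: b2P.
clearbody a1 b1'.
have inA x : a1 < x < b1' -> A x.
  move=> /andP[h1 h2].
  have h1' : 0 < x - a1 by olra.
  have h2' : 0 < b1' - x by olra.
  have [y [hy /= ty] yx] := a1A _ h1'.
  have [z [hz /= tz] xz] := b1A _ h2'.
  have yx' : y <= x by olra.
  have xz' : x <= z by olra.
  move: hy hz; rewrite /= !in_itv/= => hy hz.
  split; first by rewrite /= in_itv/=; olra.
  have := qc y x z ltac:(olra) yx' xz' ltac:(olra).
  by rewrite /=; case; olra.
have lA : b1' - a1 <= l.
  apply: le_trans hA.
  rewrite -[leLHS](ig_indic_itv a10 ab1 b1L).
  have -> : ig (\1_(`[a1, b1']%classic) : R -> R) 0 L = ig (\1_(`]a1, b1'[%classic) : R -> R) 0 L.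
    apply: EFin_inj; rewrite !ig_indic//.
    rewrite (_ : `[a1, b1'] `&` `[0, L] = `[a1, b1'])%classic; last first.
      by apply/setIidl => s /=; rewrite !in_itv/=; olra.
    rewrite (_ : `]a1, b1'[ `&` `[0, L] = `]a1, b1'[)%classic; last first.
      by apply/setIidl => s /=; rewrite !in_itv/=; olra.
    by rewrite /= !lebesgue_measure_itv/=.
  apply: ig_le; try exact: bm_indic.
  move=> x _; rewrite !indicE ler_nat.
  case: (boolP (x \in `]a1, b1'[%classic)) => //.
  by rewrite inE/= in_itv/= => /inA Ax; rewrite mem_set.
(* The leftmost start that stays inside the closed set and reaches past the end of the open one; the
   length [l] lies between the two lengths. *)
have [a [h1 h2 h3 h4]] : exists a, [/\ a2 <= a, a <= a1, b1' <= a + l & a + l <= b2].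
  exists (Num.max a2 (b1' - l)).
  have w1 : a2 <= Num.max a2 (b1' - l) by rewrite le_max lexx.
  have w2 : b1' - l <= Num.max a2 (b1' - l) by rewrite le_max lexx orbT.
  have w3 : Num.max a2 (b1' - l) <= a1 by rewrite ge_max a21 lerBlDr -lerBlDl.
  have w4 : Num.max a2 (b1' - l) <= b2 - l by rewrite ge_max lerD2r b21 andbT; olra.
  by split=> //; olra.
exists a, t; split; [olra|olra|].
move=> x hx; split; last by move=> h; apply: inB; olra.
move=> tx; have Ax : A x by split=> //=; rewrite in_itv.
by have := a1P x Ax; have := b1P x Ax; olra.
Qed.

(** After rotation, the window of mass [m] is a bathtub arrangement for the rotated weight, so it is
    at least as good as the maximiser and must coincide with it. Equality of integrals expresses
    agreement almost everywhere. *)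
Lemma maximal_window (L h m lam : R) (b : R -> R) k v :
  0 < L -> 0 < h -> 0 < m -> m < h * L -> 0 < lam ->
  maximal L h m lam b k v ->
  exists a x0, [/\ 0 <= a, a + m / h <= L & forall x y, 0 <= x -> x <= y -> y <= L ->
    ig (fun s => per L b (s + x0)) x y =
    ig (fun s => h * \1_(`[a, a + m / h]%classic) s) x y].
Proof.
move=> L0 h0 m0 mh lam0 mx; have L0' := ltW L0.
have [_ [[hv v0L] mv] _] := mx; have bv := prim_bm hv.
have v0 : 0 < ig v 0 L by rewrite mv mulr_gt0.
have [p [hp p0L [eta e0 pe]]] := adjoint_exists L0' bv v0.
have [x0 hx0 pmin] := EVT_min L0' (lip_continuous (prim_lip hp)).
rewrite in_itv/= in hx0.
have [mx' hp' p0L'] := maximal_rotate L0 x0 mx hp p0L.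
set b' := (fun t => per L b (t + x0)) in mx' hp'.
set v' := (fun t => per L v (t + x0)) in mx' hp'.
set p' := (fun t => per L p (t + x0)) in hp' p0L'.
have pe' t : 0 <= t <= L -> eta <= p' t.
  by move=> _; apply: pe; have := per_range L0 (t + x0); olra.
have pp' t : 0 <= t <= L -> 0 < p' t by move=> /pe'; olra.
have pmin' t : 0 <= t <= L -> p' 0 <= p' t.
  move=> _; rewrite /p' add0r per_closed//.
  by apply: pmin; rewrite in_itv/=; have := per_range L0 (t + x0); olra.
have [[bb' b01' bm'] [[hv' v0L'] mv'] _] := mx'.
have ldp : lip 0 L (fun t => 2 * v' t * p' t - 1).
  exact: lipD (lipM (lipM (lip_cst _ _ _) (prim_lip hv')) (prim_lip hp')) (lip_cst _ _ _).
have qc := quasiconcave L0 hp' ldp (fun x y hx hxy hy pxy =>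
  maximal_reflect L0 h0 m0 mh lam0 mx' hp' p0L' e0 pe' hx hxy hy pxy) p0L' pmin'.
have l0 : 0 < m / h by rewrite divr_gt0.
have lL : m / h < L by rewrite ltr_pdivrMr// mulrC.
have [a [t [a0 aL hw]]] := window l0 lL (prim_lip hp') qc.
exists a, x0; split=> //.
pose g s : R := h * \1_(`[a, a + m / h]%classic) s.
have bg : bm 0 L g by apply: bmM; [exact: bm_cst|exact: bm_indic].
have gin s : (s \in `[a, a + m / h]%classic) = (a <= s <= a + m / h).
  by rewrite mem_setE in_itv.
have al : a <= a + m / h by rewrite lerDl ltW.
have gm : ig g 0 L = m.
  rewrite igZ ?ig_indic_itv//; last exact: bm_indic.
  by rewrite addrAC subrr add0r mulrC divfK// gt_eqF.
have ag : adm L h m g.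
  split=> // x _; rewrite /g indicE; case: (_ \in _); rewrite ?mulr1 ?mulr0; olra.
have hbt : 0 <= ig (fun t => (g t - b' t) * p' t) 0 L.
  apply: (bathtub_le (t := t) (h := h)) => //.
  - exact: prim_bm hp'.
  - by rewrite gm bm'.
  - move=> x hx; have [w1 w2] := hw x hx; rewrite /g indicE gin; split.
      by move=> /w1 ->; rewrite mulr1.
    move=> pt; case E : (a <= x <= a + m / h); last by rewrite mulr0.
    by have := w2 E; rewrite leNgt pt.
move=> x y hx hxy hy; apply/esym.
exact: (maximal_bathtub L0 lam0 mx' hp' p0L' pp' ag hbt).
Qed.

End Window.

(** * Attainment of the minimum over [lam] *)

Section MinimalSpeed.
Context {R : realType}.
Implicit Types (c d e r s t x y : R).
Implicit Types (k lam : R) (b v : R -> R).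

(** By Jensen [k >= m / L + lam ^ 2], so the ratio blows up at 0 and at infinity and minimising
    values of [lam] stay in a compact range. The limit is a subsolution with constant [c * lam], and
    minimality of Riccati solutions bounds the true [k] by it; this replaces continuity in [lam]. *)
Lemma ratio_min_attained (L h m : R) b : 0 < L -> 0 < m -> adm L h m b ->
  exists lam k v, [/\ 0 < lam, eig L lam b k v &
    forall lam' k' v', 0 < lam' -> eig L lam' b k' v' -> k / lam <= k' / lam'].
Proof.
move=> L0 m0 ab; have [bb b01 bm_] := ab; have L0' := ltW L0.
pose S := [set c | exists lam k v, [/\ 0 < lam, eig L lam b k v & c = k / lam]].
have h0 : 0 <= h by have := b01 0; rewrite lexx L0' => /(_ isT); olra.
have sq lam v : bm 0 L v -> ig v 0 L = lam * L ->
    lam ^+ 2 * L <= ig (fun t => v t ^+ 2) 0 L.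
  move=> bv mv.
  have : 0 <= ig (fun t => (v t ^+ 2 - (2 * lam) * v t) + lam ^+ 2) 0 L.
    apply: ig_ge0 => t _; have := sqr_ge0 (v t - lam).
    by rewrite sqrrB; olra.
  rewrite igD ?igB ?igZ ?ig_cst ?mv//; try bm_tac.
  olra.
have kge lam k v : eig L lam b k v -> m / L + lam ^+ 2 <= k.
  move=> [rv mv]; have bv := prim_bm rv.1; have := riccati_energy L0 bb rv.
  have := sq lam v bv mv; rewrite bm_ => h1 h2.
  rewrite -(ler_pM2r L0) mulrDl divfK ?gt_eqF//; olra.
have [k1 [v1 e1]] := adm_eig L0 (ltr01 : 0 < 1 :> R) ab.
have S1 : S (k1 / 1) by exists 1, k1, v1.
have lS : lbound S 0.
  move=> c [lam [k [v [l0 ev ->]]]]; rewrite divr_ge0 ?ltW//.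
  apply: lt_le_trans (kge _ _ _ ev).
  by rewrite ltr_wpDr ?sqr_ge0// divr_gt0.
have iS : has_inf S by split; [exists (k1 / 1)|exists 0].
pose c := inf S.
have cS c' : S c' -> c <= c' by apply: ge_inf; exists 0.
have c0 : 0 <= c by apply: lb_le_inf; [exists (k1 / 1)|].
have seq n : exists lkv : R * R * (R -> R), [/\ 0 < lkv.1.1,
    eig L lkv.1.1 b lkv.1.2 lkv.2 & lkv.1.2 <= (c + n.+1%:R^-1) * lkv.1.1].
  have n0 : 0 < n.+1%:R^-1 :> R by rewrite invr_gt0.
  have [c' [lam [k [v [l0 ev ->]]]] hc] := inf_adherent n0 iS.
  by exists (lam, k, v); split=> //=; rewrite -ler_pdivrMr// ltW.
have {seq} [s hs] := choice seq.
pose l n := (s n).1.1; pose kk n := (s n).1.2; pose vs n := (s n).2.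
have n1 n : n.+1%:R^-1 <= 1 :> R by rewrite invf_le1 ?ler1n.
pose c1 := c + 1; have c10 : 0 < c1 by rewrite /c1; olra.
(* From [m / L + l ^ 2 <= kk <= c1 * l]: the square gives the upper bound on [l], the constant term
   the lower one. *)
have lb n : [/\ 0 < l n, l n <= c1, m / L / c1 <= l n & kk n <= c1 ^+ 2].
  case: (hs n); rewrite -/(l n) -/(kk n) -/(vs n) => l0 ev hk.
  have h1 : kk n <= c1 * l n.
    by apply: le_trans hk _; rewrite ler_pM2r// lerD2l.
  have h2 := kge _ _ _ ev; have mL : 0 < m / L by rewrite divr_gt0.
  have h3 : l n <= c1.
    rewrite -(ler_pM2r l0) -expr2; olra.
  split=> //; first by rewrite ler_pdivrMr// mulrC; have := sqr_ge0 (l n); olra.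
  by apply: le_trans h1 _; rewrite expr2 ler_pM2l.
pose K := c1 ^+ 2; have K0 : 0 <= K := sqr_ge0 _.
have bnd n x : 0 <= x <= L -> `|vs n x| <= K + 1.
  case: (hs n) => l0 ev _; have [_ _ _ kK] := lb n.
  apply: (subsol_bound L0 bb b01 kK (riccati_subsol ev.1)).
  by rewrite ev.2 mulr_gt0.
pose C := K + h + (K + 1) ^+ 2; have C0 : 0 <= C by rewrite !addr_ge0 ?sqr_ge0.
have lips n x y : 0 <= x -> x <= y -> y <= L -> `|vs n y - vs n x| <= C * (y - x).
  move=> x0 xy yL; case: (hs n) => l0 ev _; have [_ _ _ kK] := lb n.
  have [[hv _] _] := ev; have bv := prim_bm hv.
  have k0 := subsol_ge0 L0 bb b01 (riccati_subsol ev.1).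
  rewrite (proj2 hv)//; apply: ig_abs => //.
    by apply: (@bm_sub _ 0 L) => //; bm_tac.
  move=> t /andP[xt ty]; have ht : 0 <= t <= L by olra.
  have /andP[q1 q2] := b01 t ht; have := bnd n t ht; rewrite ler_norml => /andP[q3 q4].
  have q5 : vs n t ^+ 2 <= (K + 1) ^+ 2 by rewrite /vs in q3 q4 *; onra.
  have q6 := sqr_ge0 (vs n t).
  move: kK q5 q6; rewrite ler_norml /C -/K /kk /vs => kK q5 q6; olra.
have [v lv hv] := equilip_selection L0' C0 bnd lips.
have lv' : lip 0 L v by exists C.
have bv := lip_bm lv'.
pose lam := ig v 0 L / L.
have mv : ig v 0 L = lam * L by rewrite divfK// gt_eqF.
have lclose e : 0 < e -> forall N, exists2 n, (N <= n)%N &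
    `|l n - lam| <= e /\ forall x, 0 <= x <= L -> `|vs n x - v x| <= e.
  move=> e0 N; have [n Nn he] := hv e N e0; exists n => //; split=> //.
  case: (hs n) => l0 [[hvn _] mvn] _; have bvn : bm 0 L (vs n) := prim_bm hvn.
  rewrite -(ler_pM2r L0).
  have -> : `|l n - lam| * L = `|(l n - lam) * L| by rewrite normrM (gtr0_norm L0).
  rewrite mulrBl -mv -mvn -igB//; apply: le_trans (ig_abs (M := e) L0' _ _) _ => //.
    by bm_tac.
  by rewrite subr0.
have lam0 : 0 < lam.
  have d0 : 0 < m / L / c1 / 2 by rewrite !divr_gt0.
  have [n _ [hn _]] := lclose _ d0 0%N; have [_ _ h1 _] := lb n.
  by move: hn; rewrite ler_norml; olra.
have sv : subsol L b (c * lam) v.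
  apply: (subsol_closed L0 bb) => // e e0.
  (* Chosen so that [(c + d) * (lam + Num.min d 1)] exceeds [c * lam] by at most [e]. *)
  pose d := Num.min e (e / (c1 + lam + 1)).
  have q0 : 0 < c1 + lam + 1 by olra.
  have d0 : 0 < d by rewrite lt_min e0 divr_gt0.
  have de : d <= e by rewrite ge_min lexx.
  have dq : d * (c1 + lam + 1) <= e.
    by rewrite -ler_pdivlMr// ge_min lexx orbT.
  have d1 : 0 < Num.min d 1 by rewrite lt_min d0 ltr01.
  have dd : Num.min d 1 <= d by rewrite ge_min lexx.
  have d11 : Num.min d 1 <= 1 by rewrite ge_min lexx orbT.
  have [n Nn [hn hvn]] := lclose _ d1 (Num.bound d^-1).
  case: (hs n) => l0 ev hk; exists (kk n), (vs n); split.
  - exact: riccati_subsol ev.1.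
  - apply: le_trans hk _.
    have nd : n.+1%:R^-1 <= d.
      rewrite invf_ple ?posrE// ltW//; apply: lt_le_trans (archi_boundP _) _.
        by rewrite invr_ge0 ltW.
      by rewrite ler_nat ltnW.
    apply: (@le_trans _ _ ((c + d) * l n)); first by rewrite ler_pM2r// lerD2l.
    have ln : l n <= lam + Num.min d 1 by move: hn; rewrite ler_norml; olra.
    apply: (@le_trans _ _ ((c + d) * (lam + Num.min d 1))).
      by rewrite ler_wpM2l//; olra.
    have : c * Num.min d 1 <= c * d by rewrite ler_wpM2l.
    have : d * Num.min d 1 <= d * 1 by rewrite ler_wpM2l// ltW.
    move: dq; rewrite /c1; olra.
  - by move=> x hx; apply: le_trans (hvn x hx) _; exact: le_trans dd de.
have [k [u ek]] := adm_eig L0 lam0 ab.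
exists lam, k, u; split=> // lam' k' v' l0' e'.
apply: (@le_trans _ _ c); last by apply: cS; exists lam', k', v'.
rewrite ler_pdivrMr//; apply: (riccati_minimal L0 bb ek.1 sv).
  by rewrite ek.2 mulr_gt0.
by rewrite ek.2 mv.
Qed.

End MinimalSpeed.

(** * From the eigenvalue problem to the Riccati equation and back *)

Section Interface.
Context {R : realType}.
Implicit Types (c d e r s t : R).
Notation mu := (@lebesgue_measure R).
Implicit Types (x y k lam : R).

Lemma ae_imp (P Q : R -> Prop) : (forall x, P x -> Q x) ->
  {ae mu, forall x, P x} -> {ae mu, forall x, Q x}.
Proof.
by move=> PQ; apply: filterS => //; exact: (ae_filter_ringOfSetsType mu).
Qed.

Lemma ae_imp2 (P P' Q : R -> Prop) : (forall x, P x -> P' x -> Q x) ->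
  {ae mu, forall x, P x} -> {ae mu, forall x, P' x} -> {ae mu, forall x, Q x}.
Proof.
by move=> PQ; apply: filterS2 => //; exact: (ae_filter_ringOfSetsType mu).
Qed.

Lemma ae_ig x y (f g : R -> R) : bm x y f -> bm x y g ->
  {ae mu, forall t, x <= t <= y -> f t = g t} -> ig f x y = ig g x y.
Proof.
move=> bf bg fg; rewrite /ig /Rintegral; congr fine; apply: ae_eq_integral => //.
- by apply/measurable_EFinP; exact: (proj1 bf).
- by apply/measurable_EFinP; exact: (proj1 bg).
- by move: fg; apply: ae_imp => t h; rewrite /= in_itv/= => /h ->.
Qed.

Lemma prim_ae a b (F f g : R -> R) : prim a b F f -> bm a b g ->
  {ae mu, forall t, a <= t <= b -> f t = g t} -> prim a b F g.
Proof.
move=> [bf hF] bg fg; split=> // x y ax xy yb; rewrite hF//.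
apply: ae_ig; [exact: bm_sub bf|exact: bm_sub bg|].
by apply: (ae_imp _ fg) => t h ht; apply: h; olra.
Qed.

(** An eigenfunction must be differentiable in the classical sense; a Lipschitz density makes the
    remainder of the primitive quadratic at every point. *)
Lemma prim_derive (G g : R -> R) x :
  prim (x - 1) (x + 1) G g -> lip (x - 1) (x + 1) g -> is_derive x 1 G (g x).
Proof.
move=> hG lg; have bg := lip_bm lg; have [K K0 hK] := lg.
have key (t : R) : `|t| <= 1 -> `|G (t + x) - G x - t * g x| <= K * t ^+ 2.
  rewrite ler_norml => /andP[t1 t2]; have [t0|t0] := leP 0 t.
    have -> : G (t + x) - G x - t * g x = ig (fun s => g s - g x) x (t + x).
      rewrite igB; [|apply: bm_sub bg; olra|exact: bm_cst].
      by rewrite ig_cst -?(proj2 hG); [ring|olra..].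
    have -> : K * t ^+ 2 = K * t * (t + x - x) by ring.
    apply: ig_abs; first olra.
      by apply: bmB; [apply: bm_sub bg; olra|exact: bm_cst].
    move=> s /andP[xs st]; apply: le_trans (hK _ _ _ _ _) _; [olra..|].
    by rewrite ler_wpM2l//; olra.
  have -> : G (t + x) - G x - t * g x = - ig (fun s => g s - g x) (t + x) x.
    rewrite igB; [|apply: bm_sub bg; olra|exact: bm_cst].
    by rewrite ig_cst -?(proj2 hG); [ring|olra..].
  have -> : K * t ^+ 2 = K * (- t) * (x - (t + x)) by ring.
  rewrite normrN; apply: ig_abs; first olra.
    by apply: bmB; [apply: bm_sub bg; olra|exact: bm_cst].
  move=> s /andP[xs st]; rewrite distrC; apply: le_trans (hK _ _ _ _ _) _; [olra..|].
  by rewrite ler_wpM2l//; olra.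
have cv : (fun h : R => h^-1 *: (G (h *: 1 + x) - G x)) @ 0^' --> g x.
  apply/cvgrPdist_le => e e0; near=> t.
  have t0 : t != 0 by near: t; exact: nbhs_dnbhs_neq.
  have t1 : `|t| <= 1.
    by near: t; apply: dnbhs0_le.
  have te : `|t| <= e / (K + 1).
    by near: t; apply: dnbhs0_le; rewrite divr_gt0//; olra.
  rewrite [t *: 1]mulr1 distrC.
  have -> : t^-1 *: (G (t + x) - G x) - g x = t^-1 * (G (t + x) - G x - t * g x).
    by rewrite /GRing.scale/= [RHS]mulrBr mulKf.
  rewrite normrM normfV ler_pdivrMl ?normr_gt0//.
  apply: le_trans (key t t1) _.
  rewrite -real_normK ?num_real// expr2 mulrCA ler_wpM2l//.
  apply: (@le_trans _ _ ((K + 1) * `|t|)); first by rewrite ler_wpM2r//; olra.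
  by rewrite mulrC -ler_pdivlMr//; olra.
have dG : derivable G x 1 by apply/cvg_ex; exists (g x).
by apply: DeriveDef => //; apply: cvg_lim.
Unshelve. all: end_near. Qed.

Lemma bm_locally_integrable (f : R -> R) : (forall a b, bm a b f) ->
  locally_integrable setT f.
Proof.
move=> bf; split; last 1 first.
- move=> A _ cA; have [M [_ hM]] := compact_bounded cA.
  pose N := `|M| + 1.
  have AN : A `<=` `[- N, N]%classic.
    move=> t At; rewrite /= in_itv/= -ler_norml; apply: (hM N) => //.
    by rewrite /N; have := ler_norm M; olra.
  have mA := compact_measurable cA.
  have /integrableP[mf foo] := bm_integrable (bf (- N) N).
  apply: le_lt_trans foo; apply: ge0_subset_integral => //.
  apply/measurable_EFinP; apply: measurableT_comp => //.
  exact: (proj1 (bf _ _)).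
- have -> : [set: R] = \bigcup_(n : nat) `[- n%:R, n%:R]%classic.
    apply/seteqP; split=> t //= _; exists (Num.bound `|t|) => //=.
    rewrite in_itv/= -ler_norml; apply/ltW; exact: archi_boundP.
  by apply/measurable_fun_bigcup => // n; exact: (proj1 (bf _ _)).
- exact: openT.
Qed.

(** The second derivative is a priori only integrable. Integrability bounds [psi'] on a period, and
    then the equation itself bounds [psi''] almost everywhere; from there on the calculus of bounded
    densities applies to [psi' / psi + lam]. *)
Lemma pe_eig L lam (b bb : R -> R) k : 0 < L -> bm 0 L bb ->
  {ae mu, forall x, 0 <= x <= L -> b x = bb x} ->
  is_principal_eigenvalue L lam b k -> exists v, eig L lam bb (- k) v.
Proof.
move=> L0 hbb hae [psi [psi2 [per_psi pos der [[mloc _ iloc] wd] heq]]].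
have L0' := ltW L0; pose D := derive1 psi.
have derD x : is_derive x 1 psi (D x).
  by rewrite /D derive1E; exact: derivableP (der x).
have cpsi : continuous psi.
  by move=> x; apply: differentiable_continuous; apply/derivable1_diffP.
have mvt x y : x <= y -> exists2 c, x <= c <= y & psi y - psi x = D c * (y - x).
  move=> xy; have [c] := MVT_segment xy (fun t _ => derD t) (continuous_subspaceT cpsi).
  by rewrite in_itv/=; exists c.
have i2 x y : mu.-integrable `[x, y] (EFin \o psi2).
  apply/integrableP; split; first by apply/measurable_EFinP; exact: measurable_funTS.
  by apply: iloc => //; exact: segment_compact.
have i2' x y : mu.-integrable `[x, y] (EFin \o (fun t => `|psi2 t|)).
  exact: integrable_norm (i2 x y).
have [M M0 hM] : exists2 M, 0 <= M & forall x, 0 <= x <= L -> `|D x| <= M.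
  exists (`|D 0| + \int[mu]_(t in `[0, L]) `|psi2 t|).
    by rewrite addr_ge0// Rintegral_ge0.
  move=> x /andP[x0 xL]; rewrite -[D x](subrK (D 0)) addrC.
  apply: le_trans (ler_normD _ _) _; rewrite lerD2l wd//.
  apply: le_trans (le_normr_Rintegral _ (i2 0 x)) _ => //.
  rewrite -subr_ge0.
  have := @Rintegral_itvB R (fun t => `|psi2 t|) (BLeft 0) (BRight L) x (i2' 0 L).
  by rewrite !bnd_simp => /(_ x0 xL) ->; exact: Rintegral_ge0.
have lpsi : lip 0 L psi.
  exists M => // x y x0 xy yL; have [c hc ->] := mvt x y xy.
  by rewrite normrM (@ger0_norm _ (y - x)) ?subr_ge0// ler_wpM2r ?subr_ge0// hM//; olra.
have bpsi := lip_bm lpsi; have [N N0 hN] := bm_ge0 bpsi.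
have [B B0 hB] := bm_ge0 hbb.
have [eta e0 he] : exists2 eta, 0 < eta & forall x, 0 <= x <= L -> eta <= psi x.
  have [c _ hc] := EVT_min L0' (lip_continuous lpsi).
  by exists (psi c) => // x hx; apply: hc; rewrite in_itv.
pose C := 2 * `|lam| * M + (B + lam ^+ 2) * N + `|k| * N.
(* Clipping at the bound given by the equation yields a density bounded everywhere, changed only on
   a null set. *)
pose hcl t := Num.max (- C) (Num.min C (psi2 t)).
have C0 : 0 <= C by rewrite /C !addr_ge0 ?mulr_ge0 ?addr_ge0 ?sqr_ge0.
have bcl : bm 0 L hcl.
  split.
    apply: measurable_maxr; first exact: measurable_cst.
    apply: measurable_minr; first exact: measurable_cst.
    exact: measurable_funTS.
  exists C => t _; rewrite /hcl ler_norml le_max lexx/= ge_max ge_min lexx andbT; olra.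
pose g0 t := - 2 * lam * D t - (bb t + lam ^+ 2) * psi t - k * psi t.
have eq2 : {ae mu, forall x, 0 <= x <= L -> psi2 x = g0 x}.
  apply: (ae_imp2 _ hae heq) => x h1 h2 hx; rewrite /g0 -(h1 hx) /D; olra.
have g0C x : 0 <= x <= L -> `|g0 x| <= C.
  move=> hx; rewrite /g0 /C.
  have q1 : `|- 2 * lam * D x| <= 2 * `|lam| * M.
    have -> : - 2 * lam * D x = - (2 * (lam * D x)) by ring.
    rewrite normrN !normrM -mulrA normr_nat ler_pM2l// ler_wpM2l//.
    exact: hM.
  have q2 : `|(bb x + lam ^+ 2) * psi x| <= (B + lam ^+ 2) * N.
    rewrite normrM ler_pM ?hN//; apply: le_trans (ler_normD _ _) _.
    by rewrite (ger0_norm (sqr_ge0 lam)) lerD2r hB.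
  have q3 : `|k * psi x| <= `|k| * N by rewrite normrM ler_wpM2l// hN.
  apply: le_trans (ler_normB _ _) _; rewrite lerD//.
  by apply: le_trans (ler_normB _ _) _; rewrite lerD.
have clE x : 0 <= x <= L -> psi2 x = g0 x -> hcl x = g0 x.
  move=> hx e; rewrite /hcl e; have := g0C x hx; rewrite ler_norml => /andP[q1 q2].
  by rewrite min_r// max_r.
have hD : prim 0 L D hcl.
  split=> // x y x0 xy yL; rewrite wd// /ig /Rintegral; congr fine.
  apply: ae_eq_integral => //.
  - by apply/measurable_EFinP; exact: measurable_funTS.
  - by apply/measurable_EFinP; exact: (proj1 (bm_sub x0 yL bcl)).
  - apply: (ae_imp _ eq2) => t h; rewrite /= in_itv/= => ht.
    by rewrite clE ?h//; olra.
have bD := prim_bm hD.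
have bg0 : bm 0 L g0 by rewrite /g0; bm_tac.
have hD' : prim 0 L D g0.
  by apply: prim_ae hD bg0 _; apply: (ae_imp _ eq2) => t h ht; rewrite clE// h.
have [J J0 hJ] := prim_lip hD'.
have hpsi : prim 0 L psi D.
  apply: (@quad_prim _ _ _ _ _ J) => // x y x0 xy yL.
  have [c /andP[xc cy] ->] := mvt x y xy.
  have bDs : bm x y D by exact: bm_sub bD.
  rewrite -ig_cst// -igB//; last exact: bm_cst.
  rewrite expr2 mulrA; apply: ig_abs => //; first by apply: bmB => //; exact: bm_cst.
  move=> t /andP[xt ty]; have [tc|ct] := leP t c.
    by apply: le_trans (hJ _ _ _ tc _) _; [olra..|rewrite ler_wpM2l//; olra].
  rewrite distrC; apply: le_trans (hJ _ _ _ (ltW ct) _) _; [olra..|].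
  by rewrite ler_wpM2l//; olra.
have hinv := prim_inv L0' hpsi e0 he.
have hz := primM hD' hinv.
exists (fun t => D t * (psi t)^-1 + lam); split; last first.
  rewrite igD ?ig_cst ?subr0//; last 2 first.
  - exact: prim_bm hz.
  - exact: bm_cst.
  by rewrite (log_increment L0' hpsi e0 he) ?add0r// -[L]add0r per_psi.
split.
  apply: prim_ext (primD hz (prim_cst 0 L lam)) => // t ht.
  have pt := pos t; rewrite /g0; field.
  by rewrite gt_eqF.
have -> : psi L = psi 0 by rewrite -[L]add0r per_psi.
have -> : D L = D 0.
  have e : (fun t => t^-1 *: (psi (t + L) - psi L)) =
      (fun t => t^-1 *: (psi (t + 0) - psi 0)).
    apply/funext => t; have -> : psi L = psi 0 by rewrite -[L]add0r per_psi.
    by rewrite addr0 per_psi.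
  by rewrite /D /derive1 e.
by [].
Qed.

(** The eigenfunction is the exponential of a primitive of [v - lam]; the mean condition on [v] is
    exactly its periodicity. *)
Lemma eig_pe L lam (b g v : R -> R) k : 0 < L -> eq_ae b (per L g) ->
  eig L lam g k v -> is_principal_eigenvalue L lam b (- k).
Proof.
move=> L0 hb [[hv v0L] mv]; have bv := prim_bm hv.
have bvl : bm 0 L (fun t => v t - lam) by apply: bmB => //; exact: bm_cst.
have [F hF F0] := prim_exists (ltW L0) bvl.
have FL : F 0 = F L.
  have := proj2 hF 0 L (lexx _) (ltW L0) (lexx _).
  rewrite igB ?ig_cst ?(ltW L0)//; last exact: bm_cst.
  by rewrite mv subr0 subrr; olra.
have hFp := prim_per L0 hF FL; have hvp := prim_per L0 hv v0L.
pose psi x := expR (per L F x); pose pv := per L v.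
have hpsi x y : prim x y psi (fun t => (pv t - lam) * psi t) by exact: prim_exp.
have lpsi' x y : lip x y (fun t => (pv t - lam) * psi t).
  apply: lipM (prim_lip (hpsi x y)).
  exact: lipD (prim_lip (hvp x y)) (lip_cst _ _ _).
have dpsi x : is_derive x 1 psi ((pv x - lam) * psi x).
  exact: (@prim_derive psi (fun t => (pv t - lam) * psi t) x (hpsi _ _) (lpsi' _ _)).
have D1 x : derive1 psi x = (pv x - lam) * psi x.
  by rewrite derive1E; apply: derive_val.
pose psi2 t := (k - per L g t - pv t ^+ 2) * psi t + (pv t - lam) * ((pv t - lam) * psi t).
have hD x y : prim x y (derive1 psi) psi2.
  have := primM (primB (hvp x y) (prim_cst x y lam)) (hpsi x y).
  by apply: prim_ext => t _; rewrite ?D1// /psi2 /per subr0.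
exists psi, psi2; split.
- by move=> x; rewrite /psi per_periodic.
- by move=> x; exact: expR_gt0.
- by move=> x; exact: ex_derive.
- split; first by apply: bm_locally_integrable => x y; exact: (proj1 (hD x y)).
  by move=> x y xy; rewrite (proj2 (hD x y)).
- apply: (ae_imp _ hb) => x ->; rewrite D1 /psi2.
  ring.
Qed.

End Interface.

(** * Null sets, translations and the differentiation theorem *)

Section AlmostEverywhere.
Context {R : realType}.
Implicit Types (d e r s t : R).
Notation mu := (@lebesgue_measure R).
Implicit Types (x y c k lam : R).

Lemma ae_shift (P : R -> Prop) c :
  {ae mu, forall x, P x} -> {ae mu, forall x, P (x + c)}.
Proof.
move=> [A [mA A0 hA]]; exists ((fun t => t + c) @^-1` A); split.
- rewrite -[X in measurable X]setTI.
  have m : measurable_fun setT (fun t : R => t + c).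
    by apply: measurable_funD => //; exact: measurable_cst.
  exact: m.
- rewrite -[RHS]A0; apply: (@measure_isometry _ (fun t => t + c)) => //.
    by apply: measurable_funD => //; exact: measurable_cst.
  by move=> a b; exact: mu_preimage_shift.
- by move=> x /= hx; apply: hA.
Qed.

Lemma ae_all_int (P : int -> R -> Prop) :
  (forall j, {ae mu, forall x, P j x}) -> {ae mu, forall x, forall j, P j x}.
Proof.
move=> hP.
have hN : mu.-negligible (\bigcup_(n : nat) ~` [set x | P n%:Z x]).
  by apply: negligible_bigcup => n; exact: hP.
have hN' : mu.-negligible (\bigcup_(n : nat) ~` [set x | P (Negz n) x]).
  by apply: negligible_bigcup => n; exact: hP.
apply: negligibleS (negligibleU hN hN') => x /= /existsNP[[n|n] hn].
  by left; exists n.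
by right; exists n.
Qed.

Lemma ae_neq c : {ae mu, forall x, x <> c}.
Proof.
exists [set c]; split=> //; first exact: lebesgue_measure_set1.
by move=> x /= /contrapT.
Qed.

Lemma ae_eq_of_ig (L : R) (f g : R -> R) : 0 < L -> bm 0 L f -> bm 0 L g ->
  (forall x y, 0 <= x -> x <= y -> y <= L -> ig f x y = ig g x y) ->
  {ae mu, forall x, 0 <= x <= L -> f x = g x}.
Proof.
move=> L0 bf bg fg.
(* The difference is extended by zero to the whole line, where Lebesgue differentiation applies; the
   primitive from 0 vanishes on the period, hence so does its derivative at interior points. *)
pose d t := if 0 <= t <= L then f t - g t else 0.
have bd a b : bm a b d by apply: bm_if; [exact: bmB|exact: bm_cst].
have d0 x : 0 <= x <= L -> ig d 0 x = 0.
  move=> /andP[x0 xL]; rewrite (@ig_eq _ 0 x _ (fun t => f t - g t)).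
    rewrite igB ?fg ?subrr//; first exact: bm_sub bf.
    exact: bm_sub bg.
  by move=> t ht; rewrite /d ifT//; olra.
have ftc := @FTC1 R d (BLeft 0) (fun y => bm_integrable (bd 0 y))
  (bm_locally_integrable bd).
have h := ae_imp2 (Q := fun x => x <> 0 /\ x <> L) _ (ae_neq 0) (ae_neq L).
have {}h := h (fun x p q => conj p q).
apply: (ae_imp2 _ h ftc) => x [x0 xL] hx /andP[h0 hL].
have x0' : 0 < x by rewrite lt_neqAle eq_sym h0 andbT; exact/eqP.
have xL' : x < L by rewrite lt_neqAle hL andbT; exact/eqP.
have [|_] := hx; first by rewrite /= lte_fin.
rewrite /d h0 hL/= => e; apply/eqP; rewrite -subr_eq0 -e; apply/eqP.
rewrite derive1E (@near_eq_derive _ _ _ _ (cst 0)) ?derive_cst//.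
near=> t; apply: d0; apply/andP; split; apply: ltW; near: t.
  exact: lt_nbhsr.
exact: lt_nbhsl.
Unshelve. all: end_near. Qed.

End AlmostEverywhere.

(** * Everywhere defined representatives, the minimal speed and translates of the optimal
    coefficient *)

Section Representatives.
Context {R : realType}.
Implicit Types (c d e r s t y : R).
Notation mu := (@lebesgue_measure R).
Implicit Types (b g v : R -> R) (k lam x tau : R).
Variables (L alpha h : R).
Hypotheses (L0 : 0 < L) (alpha0 : 0 < alpha) (alphah : alpha < h).

Let h0 : 0 < h. Proof. exact: lt_trans alphah. Qed.
Let m0 : 0 < alpha * L. Proof. exact: mulr_gt0. Qed.
Let mh : alpha * L < h * L. Proof. by rewrite ltr_pM2r. Qed.

(* [g] is a bounded, everywhere defined representative of [b] on a period. *)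
Definition rep b g : Prop :=
  [/\ adm L h (alpha * L) g, eq_ae b (per L g) &
      {ae mu, forall x, 0 <= x <= L -> b x = g x}].

Lemma per_int g x (j : int) : (forall x, g (x + L) = g x) -> g (x + L * j%:~R) = g x.
Proof.
move=> gL; have nat_case (n : nat) y : g (y + L * n%:R) = g y.
  elim: n => [|n IH]; first by rewrite mulr0 addr0.
  by rewrite -natr1 mulrDr mulr1 addrA gL.
case: j => n; first exact: nat_case.
rewrite NegzE mulrNz mulrN -[in RHS](subrK (L * n.+1%:R) x).
by rewrite nat_case.
Qed.

Lemma A1_rep b : A1 L alpha h b -> exists g, rep b g.
Proof.
move=> [[mb _ ib] bL b01 bint].
(* Clipping makes the bounds hold at every point and leaves the class of [b] unchanged. *)
pose g t := Num.max 0 (Num.min h (b t)).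
have gb : {ae mu, forall x, g x = b x}.
  apply: (ae_imp _ b01) => x /andP[b0 bh].
  by rewrite /g min_r// max_r.
have bg x y : bm x y g.
  split.
    apply: measurable_maxr; first exact: measurable_cst.
    apply: measurable_minr; first exact: measurable_cst.
    exact: measurable_funTS.
  exists h => t _; have [_|?] := leP 0 (Num.min h (b t)); rewrite /g.
    rewrite ger0_norm ?le_max ?lexx// ge_max (ltW h0) ge_min lexx//.
  by rewrite ger0_norm ?le_max ?lexx// ge_max (ltW h0) ge_min lexx.
have g01 x : 0 <= g x <= h.
  by rewrite /g le_max lexx/= ge_max (ltW h0) ge_min lexx.
have bj (j : int) : {ae mu, forall x, b (x + L * j%:~R) = b x}.
  have up (n : nat) : {ae mu, forall x, b (x + L * n%:R) = b x}.
    elim: n => [|n IH]; first by apply: aeW => x; rewrite mulr0 addr0.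
    apply: (ae_imp2 _ IH (ae_shift (L * n%:R) bL)) => x e1 e2.
    by rewrite -natr1 mulrDr mulr1 addrA e2.
  case: j => n; first exact: up.
  apply: (ae_imp _ (ae_shift (- (L * n.+1%:R)) (up n.+1))) => x.
  by rewrite subrK NegzE mulrNz mulrN => ->.
(* The periodic extension shifts [x] by an integer that depends on [x], so one null set has to serve
   all integers. *)
have gj : {ae mu, forall x, forall j : int, g (x + L * j%:~R) = b x}.
  apply: ae_all_int => j.
  by apply: (ae_imp2 _ (bj j) (ae_shift (L * j%:~R) gb)) => x e1 e2; rewrite e2.
exists g; split.
- split=> //; rewrite -bint /ig /Rintegral; congr fine; apply: ae_eq_integral => //.
  + by apply/measurable_EFinP; exact: (proj1 (bg 0 L)).
  + by apply/measurable_EFinP; exact: measurable_funTS.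
  + by apply: (ae_imp _ gb) => x e _; rewrite e.
- apply: (ae_imp _ gj) => x e; rewrite /per.
  by have := e (- Num.floor (x / L)); rewrite mulrNz mulrN.
- by apply: (ae_imp _ gb) => x e _.
Qed.

Lemma A1_per g : adm L h (alpha * L) g -> A1 L alpha h (per L g).
Proof.
move=> [bg g01 gm]; split.
- by apply: bm_locally_integrable => x y; exact: bm_per.
- by apply: aeW => x; rewrite per_periodic.
- by apply: aeW => x; apply: g01; have := per_range L0 x; olra.
- rewrite -gm -(ig_per L0 0 bg) add0r; exact: erefl.
Qed.

Lemma rep_per g : adm L h (alpha * L) g -> rep (per L g) g.
Proof.
move=> ag; split=> //; first exact: aeW.
by apply: (ae_imp _ (ae_neq L)) => x xL hx; rewrite per_id//; olra.
Qed.

Lemma eig_unique lam g k k' v v' : 0 < lam -> adm L h (alpha * L) g ->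
  eig L lam g k v -> eig L lam g k' v' -> k = k'.
Proof.
move=> lam0 [bg g01 _] [rv mv] [rv' mv'].
have lL : 0 < lam * L by exact: mulr_gt0.
by apply/eqP; rewrite eq_le; apply/andP; split;
  [apply: (riccati_minimal L0 bg rv (riccati_subsol rv'))
  |apply: (riccati_minimal L0 bg rv' (riccati_subsol rv))]; rewrite ?mv ?mv'.
Qed.

Lemma eig_ae lam g g' k v : bm 0 L g' ->
  {ae mu, forall x, 0 <= x <= L -> g x = g' x} ->
  eig L lam g k v -> eig L lam g' k v.
Proof.
move=> bg' gg' [[hv v0L] mv]; split=> //; split=> //.
have bv := prim_bm hv; apply: prim_ae hv _ _; first by bm_tac.
by apply: (ae_imp _ gg') => x e hx; rewrite e.
Qed.

(** Settles the choice made by [get]: some eigenvalue exists, and whichever is selected leads back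
    to a Riccati solution, whose constant is unique. *)
Lemma principal_eigenvalueE lam b g k v : 0 < lam -> rep b g ->
  eig L lam g k v -> principal_eigenvalue L lam b = - k.
Proof.
move=> lam0 [ag bg bg'] ev.
have ex : exists k', is_principal_eigenvalue L lam b k'.
  by exists (- k); exact: eig_pe L0 bg ev.
have := getPex ex; rewrite -/(principal_eigenvalue L lam b) => pe.
have [bgg _ _] := ag.
have [v' ev'] := pe_eig L0 bgg bg' pe.
by rewrite -[LHS]opprK; congr (- _); exact: eig_unique ev' ev.
Qed.

Lemma cstarP b g : rep b g -> exists lam k v,
  [/\ 0 < lam, eig L lam g k v, cstar L b = k / lam &
      forall lam' k' v', 0 < lam' -> eig L lam' g k' v' ->
        cstar L b <= k' / lam'].
Proof.
move=> rb; have [ag _ _] := rb.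
have speedsE c : speeds L b c <->
    exists lam k v, [/\ 0 < lam, eig L lam g k v & c = k / lam].
  split=> [[lam /= l0 <-]|[lam [k [v [l0 ev ->]]]]].
    have [k [v ev]] := adm_eig L0 l0 ag; exists lam, k, v; split=> //.
    by rewrite (principal_eigenvalueE l0 rb ev) opprK.
  by exists lam => //=; rewrite (principal_eigenvalueE l0 rb ev) opprK.
have [lam [k [v [l0 ev hmin]]]] := ratio_min_attained L0 m0 ag.
have ex : exists c, speeds L b c /\ lbound (speeds L b) c.
  exists (k / lam); split; first by apply/speedsE; exists lam, k, v.
  by move=> c /speedsE[lam' [k' [v' [l0' ev' ->]]]]; exact: hmin ev'.
have [/speedsE[lam1 [k1 [v1 [l1 ev1 e1]]]] lb] := getPex ex.
exists lam1, k1, v1; split=> // lam' k' v' l0' ev'.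
by apply: lb; apply/speedsE; exists lam', k', v'.
Qed.

Definition bump x : R :=
  h * \1_(`[L / 2 - alpha * L / (2 * h), L / 2 + alpha * L / (2 * h)]%classic) x.

Let l := alpha * L / h.
Let l0 : 0 < l. Proof. by rewrite divr_gt0. Qed.
Let lL : l < L. Proof. by rewrite ltr_pdivrMr// mulrC ltr_pM2l. Qed.
Let l2 : alpha * L / (2 * h) = l / 2.
Proof. by rewrite /l; field; rewrite gt_eqF. Qed.

Lemma bumpE x : bump x = h * (L / 2 - l / 2 <= x <= L / 2 + l / 2)%R%:R.
Proof. by rewrite /bump indicE l2 mem_setE in_itv. Qed.

Lemma adm_bump : adm L h (alpha * L) bump.
Proof.
split.
- by apply: bmM; [exact: bm_cst|exact: bm_indic].
- by move=> x _; rewrite bumpE; case: (L / 2 - l / 2 <= x <= _); rewrite ?mulr1 ?mulr0; have := h0; olra.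
- rewrite /bump igZ; last exact: bm_indic.
  have := l0; have := lL => lL' l0'.
  rewrite ig_indic_itv l2; [|olra..].
  by rewrite /l; field; rewrite gt_eqF.
Qed.

Lemma b1_per : b1 L alpha h = per L bump.
Proof.
have l0' := l0; have lL' := lL; have L1 := L0.
apply/funext => x; rewrite /b1.
have hr := per_range L0 x; set k := Num.floor _ in hr.
(* Since [l < L] each interval lies inside its own period, so only the index [Num.floor (x / L)] can
   contribute. *)
rewrite -(@fsbig_widen _ _ _ _ [set k]) ?fsbig_set1//=.
  rewrite {1}/per -/k bumpE indicE; congr (h * _%:R).
  rewrite mem_setE in_itv/= l2; congr (nat_of_bool _).
  by apply/idP/idP => /andP[h1 h2]; apply/andP; split; olra.
move=> j [_ /= jk]; rewrite indicE memNset ?mulr0// /I1/= in_itv/= l2.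
move=> /andP[h1 h2]; apply: jk.
apply/esym; rewrite /k; apply: floor_def.
rewrite ler_pdivlMr// ltr_pdivrMr// intrD mulr1z; apply/andP; split; olra.
Qed.

Lemma rep_b1 : rep (b1 L alpha h) bump.
Proof. by rewrite b1_per; exact: rep_per adm_bump. Qed.

Lemma A1_b1 : A1 L alpha h (b1 L alpha h).
Proof. by rewrite b1_per; exact: A1_per adm_bump. Qed.

Lemma ae_periodic (f g : R -> R) : (forall x, f (x + L) = f x) ->
  (forall x, g (x + L) = g x) ->
  {ae mu, forall x, 0 <= x <= L -> f x = g x} -> eq_ae f g.
Proof.
move=> fL gL fg.
have : {ae mu, forall x, forall j : int,
    0 <= x + L * j%:~R <= L -> f (x + L * j%:~R) = g (x + L * j%:~R)}.
  by apply: ae_all_int => j; exact: (ae_shift (L * j%:~R) fg).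
apply: ae_imp => x /(_ (- Num.floor (x / L))).
rewrite !per_int// => -> //.
by rewrite mulrNz mulrN; have := per_range L0 x; olra.
Qed.

Lemma maximal_translate lam g k v : 0 < lam ->
  maximal L h (alpha * L) lam g k v ->
  exists tau, eq_ae (per L g) (fun x => b1 L alpha h (x + tau)).
Proof.
move=> lam0 mx; have [[bg _ _] _ _] := mx.
have [a [x0 [a0 aL hw]]] := maximal_window L0 h0 m0 mh lam0 mx.
have l0' := l0; have lL' := lL; have L1 := L0.
rewrite -/l in aL hw.
(* The shift that carries the window starting at [a] onto the centred one. *)
have [tau tauE] : exists tau, tau = L / 2 - l / 2 - a by eexists.
have win : {ae mu, forall x, 0 <= x <= L ->
    per L g (x + x0) = h * \1_(`[a, a + l]%classic) x}.
  apply: (ae_eq_of_ig L0) => //.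
    by apply: bm_shift; exact: bm_per.
  by apply: bmM; [exact: bm_cst|exact: bm_indic].
have key : eq_ae (fun x => per L g (x + x0)) (fun x => per L bump (x + tau)).
  apply: ae_periodic.
  - by move=> x; rewrite addrAC per_periodic.
  - by move=> x; rewrite addrAC per_periodic.
  have h2 := ae_imp2 (Q := fun x => x <> 0 /\ x <> L) (fun x p q => conj p q)
    (ae_neq 0) (ae_neq L).
  apply: (ae_imp2 _ h2 win) => x [x0' xL'] e hx; rewrite e//.
  have {x0' xL'} [xp xL] : 0 < x /\ x < L.
    move: hx => /andP[q1 q2]; rewrite !lt_neqAle q1 q2 !andbT eq_sym.
    by split; exact/eqP.
  rewrite indicE mem_setE in_itv/=.
  (* The shifted point may leave the period on either side; there it lies outside the window before
     and after reduction modulo [L], and both sides vanish. *)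
  have [y0|y0] := ltP (x + tau) 0.
    rewrite -per_periodic// per_id//; [|olra|olra].
    rewrite bumpE; congr (h * (nat_of_bool _)%:R).
    by apply/idP/idP => /andP[q1 q2]; exfalso; olra.
  have [yL|yL] := ltP (x + tau) L.
    rewrite per_id// bumpE; congr (h * (nat_of_bool _)%:R).
    by apply/idP/idP => /andP[q1 q2]; apply/andP; olra.
  rewrite -(subrK L (x + tau)) per_periodic// per_id//; [|olra|].
  rewrite bumpE; congr (h * (nat_of_bool _)%:R).
    by apply/idP/idP => /andP[q1 q2]; exfalso; olra.
  olra.
exists (tau - x0).
apply: (ae_imp _ (ae_shift (- x0) key)) => x.
by rewrite subrK b1_per addrA addrAC.
Qed.

(* A maximal potential is a translate of [b1] almost everywhere, so [b1] itself
   is maximal. *)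
Lemma b1_maximal lam : 0 < lam ->
  exists k v, maximal L h (alpha * L) lam bump k v.
Proof.
move=> lam0.
have [g [k [v mx]]] := maximal_exists L0 h0 m0 mh lam0.
have [ag ev hmax] := mx; have [bg _ _] := ag.
have [tau htau] := maximal_translate lam0 mx.
have [k1 [v1 ev1]] := adm_eig L0 lam0 adm_bump.
have e1 := eig_rotate L0 tau ev1.
have e2 : eig L lam g k1 (fun t => per L v1 (t + tau)).
  apply: eig_ae e1 => //.
  apply: (ae_imp2 _ htau (ae_neq L)) => x e xL hx.
  rewrite -b1_per -e per_id//; olra.
have kk1 := eig_unique lam0 ag ev e2.
exists k1, v1; split=> //; first exact: adm_bump.
by move=> b' k' v' ab' ev'; rewrite -kk1; exact: hmax ev'.
Qed.

End Representatives.

Theorem theorem2p2 (R : realType) (L alpha h : R)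
    (hL : 0 < L) (halpha : 0 < alpha) (hh : alpha < h) :
  is_maximizer L (A1 L alpha h) (b1 L alpha h) /\
  (forall b b' : R -> R,
     is_maximizer L (A1 L alpha h) b -> is_maximizer L (A1 L alpha h) b' ->
     exists t : R, eq_ae b' (fun x => b (x + t))).
Proof.
have r1 := rep_b1 hL halpha hh.
have [lam1 [k1 [v1 [l1 ev1 c1 min1]]]] := cstarP hL halpha r1.
have [K [V mx]] := b1_maximal hL halpha hh l1.
have [ab1 eV hmax] := mx.
have Kk1 : K = k1 := eig_unique hL l1 ab1 eV ev1.
have le_c1 b g : rep L alpha h b g -> exists k v,
    [/\ eig L lam1 g k v, k <= k1 & cstar L b <= k / lam1].
  move=> rb; have [ag _ _] := rb.
  have [k [v ev]] := adm_eig hL l1 ag; exists k, v; split=> //.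
    by rewrite -Kk1; exact: hmax ev.
  have [lam2 [k2 [v2 [_ _ _ min2]]]] := cstarP hL halpha rb.
  exact: min2 ev.
have b1max : is_maximizer L (A1 L alpha h) (b1 L alpha h).
  split; first exact: A1_b1.
  move=> b /(A1_rep halpha hh)[g /le_c1[k [v [_ kk1 cb]]]].
  by apply: le_trans cb _; rewrite c1 ler_pM2r ?invr_gt0.
have tr b : is_maximizer L (A1 L alpha h) b ->
    exists t, eq_ae b (fun x => b1 L alpha h (x + t)).
  move=> [Ab maxb]; have [g rb] := A1_rep halpha hh Ab.
  have [k [v [ev kk1 cb]]] := le_c1 b g rb; have [ag bg _] := rb.
  (* The chain [cstar L b1 <= cstar L b <= k / lam1 <= k1 / lam1] starts and ends at the same
     value. *)
  have kE : k = k1.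
    apply/eqP; rewrite eq_le kk1/=.
    have := le_trans (maxb _ b1max.1) cb.
    by rewrite c1 ler_pM2r ?invr_gt0.
  have mg : maximal L h (alpha * L) lam1 g k v.
    by split=> // g' k' v' ag' ev'; rewrite kE -Kk1; exact: hmax ev'.
  have [t ht] := maximal_translate hL halpha hh l1 mg.
  by exists t; apply: (ae_imp2 _ bg ht) => x -> ->.
split=> // b b' /tr[t bt] /tr[t' bt'].
(* Both maximisers are translates of [b1], by [t] and [t']; the difference carries one to the
   other. *)
exists (t' - t); apply: (ae_imp2 _ bt' (ae_shift (t' - t) bt)) => x -> ->.
by congr b1; ring.
Qed.
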